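(* Let $S$ be a finite set with $|S|\ge2$, let $(\mathcal{F}_n)_{n\ge0}$ be families of finite subsets of $\overline{S}=S^{\mathbb{N}}$ as described in the context, let $Y$ be a reflexive Banach space with a normalized $1$-unconditional basis $(e_j)_{j=0}^\infty$, and let $X$ be the associated space described in the context. If $(\mathcal{F}_n)$ satisfies the inclusion condition, in particular if the families $(\mathcal{F}_n)$ are maximal, then $X$ admits an equivalent norm that is $2R$ and for which the canonical basis $(1_{\{\gamma\}})_{\gamma\in\overline{S}}$ is $1$-unconditional.
   Context: A norm $\|\cdot\|$ on a Banach space $X$ is $2$-rotund ($2R$) if for every sequence $(x_n)\subset X$ with $\|x_n\|\le 1$ for all $n$ and $\lim_{m,n\to\infty}\|x_m+x_n\|=2$, there exists $x\in X$ with $x_n\to x$ in norm. Families of sets. Let $\overline{S}=S^{\mathbb{N}}$. For distinct $p=(p(i))_{i\ge1}$, $q=(q(i))_{i\ge1}$ in $\overline{S}$ let $d(p,q)=\min\{k\ge 1: p(k)\ne q(k)\}$. For $A\subset\overline{S}$ with $|A|\ge2$ let $A^\sharp=\min\{d(p,q):p,q\in A,\ p\ne q\}$. Let $\mathcal{F}_0=\{\emptyset\}\cup\{\{p\}:p\in\overline{S}\}$. For $n\ge1$, $\mathcal{F}_n$ is any hereditary family (closed under taking subsets) of finite subsets of $\overline{S}$ such that $\mathcal{F}_{n-1}\subseteq\mathcal{F}_n$ and every $A\in\mathcal{F}_n$ with $|A|\ge2$ can be written $A=\bigcup_{i=1}^{A^\sharp}A_i$ with $A_i\in\mathcal{F}_{n-1}$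 for $1\le i\le A^\sharp$. The families are maximal if, for every $n\ge1$, $\mathcal{F}_n$ consists of $\mathcal{F}_0$ together with all finite $A\subseteq\overline{S}$, $|A|\ge2$, of the form $A=\bigcup_{i=1}^{A^\sharp}B_i$ with $B_i\in\mathcal{F}_{n-1}$. Inclusion condition (for $S$ finite). (a) For each $n\ge1$ and $M\in\mathbb{N}$: whenever $(A_i)_{i=1}^\infty$ is a sequence of disjoint sets with $A_i\in\mathcal{F}_n$, $|A_i|\ge2$ (so that $A_i^\sharp$ is defined) and $A_i^\sharp\to\infty$, there exist $i_1<\dots<i_M$ with $\bigcup_{k=1}^MA_{i_k}\in\mathcal{F}_{n+1}$. (b) For every sequence $(\gamma_i)\subseteq\overline{S}$ and every $M\in\mathbb{N}$ there exist $i_1<\dots<i_M$ with $\{\gamma_{i_k}:1\le k\le M\}\in\mathcal{F}_1$. The space $X$. $c_{00}(\overline{S})$ is the space of finitely supported scalar functions on $\overline{S}$. For $j\ge0$ let $\|x\|_j=\sup_{F\in\mathcal{F}_j}\sum_{\gamma\in F}|x_\gamma|$. $X$ is the completion of $c_{00}(\overline{S})$ under $\|x\|=\big\|\sum_{j=0}^\infty2^{-j}\|x\|_je_j\big\|_Y$. A (possibly uncountable) basis $(u_i)$ is $1$-unconditional for a norm if $\|\sum\pm a_iu_i\|\le\|\sum a_iu_i\|$ for all finitely supported scalar families $(a_i)$ and all choices of signs. *)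

(* Defs.v *)
From mathcomp Require Import all_boot all_order all_algebra finmap.
From mathcomp Require Import all_classical all_reals all_analysis.
Import Order.TTheory GRing.Theory Num.Theory numFieldNormedType.Exports.

Set Implicit Arguments.
Unset Strict Implicit.
Unset Printing Implicit Defensive.

Local Open Scope classical_set_scope.
Local Open Scope fset_scope.
Local Open Scope ring_scope.

(* S^N; the informal p(i), i >= 1, is p (i - 1). *)
Notation branch S := (nat -> S) (only parsing).

(* The least element of P, with junk value 0 when P is empty. *)
Definition nat_min (P : set nat) : nat :=
  if pselect (exists n, `[< P n >]) is left h then ex_minn h else 0%N.

Section Families.
Variable S : finType.
Implicit Types (p q : branch S) (A B : {fset branch S}).
Implicit Types (F : nat -> set {fset branch S}).

(* The successor accounts for the shift of indices in branch. *)
Definition branch_dist p q : nat := (nat_min [set k | p k <> q k]).+1.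

Definition sharp A : nat :=
  nat_min [set branch_dist pq.1 pq.2 | pq in
            [set pq | [/\ pq.1 \in A, pq.2 \in A & pq.1 <> pq.2]]].

Definition hereditary (G : set {fset branch S}) : Prop :=
  forall A B, G A -> B `<=` A -> G B.

Definition sharp_union (G : set {fset branch S}) A : Prop :=
  exists B : nat -> {fset branch S},
    (forall i, (i < sharp A)%N -> G (B i)) /\
    A = (\bigcup_(i <- iota 0 (sharp A)) B i)%fset.

Definition family0 : set {fset branch S} :=
  [set A | A = fset0 \/ exists p, A = [fset p]].

Definition admissible F : Prop :=
  F 0%N = family0 /\
  forall n, [/\ hereditary (F n.+1),
                (forall A, F n A -> F n.+1 A) &
                forall A, F n.+1 A -> (2 <= #|` A|)%N -> sharp_union (F n) A].

Definition maximal F : Prop :=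
  forall n A, F n.+1 A <-> F 0%N A \/ ((2 <= #|` A|)%N /\ sharp_union (F n) A).

Definition inclusion_a F : Prop :=
  forall n M : nat, (1 <= n)%N ->
  forall A : nat -> {fset branch S},
    (forall i j, i != j -> A i `&` A j = fset0) ->
    (forall i, F n (A i) /\ (2 <= #|` A i|)%N) ->
    sharp (A i) @[i --> \oo] --> \oo ->
  exists s : seq nat, [/\ sorted ltn s, size s = M &
    F n.+1 (\bigcup_(i <- s) A i)%fset].

Definition inclusion_b F : Prop :=
  forall (g : nat -> branch S) (M : nat),
  exists s : seq nat, [/\ sorted ltn s, size s = M &
    F 1%N [fset g i | i in s]].

Definition inclusion_condition F : Prop := inclusion_a F /\ inclusion_b F.

End Families.

Section Banach.
Variable R : realType.

Section Norms.
Variable V : normedModType R.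
Implicit Types (N : V -> R).

Definition is_norm N : Prop :=
  [/\ forall x y, N (x + y) <= N x + N y,
      forall a x, N (a *: x) = `|a| * N x &
      forall x, N x = 0 -> x = 0].

Definition equivalent_norm N : Prop :=
  is_norm N /\
  exists c C : R, [/\ 0 < c, 0 < C & forall x, c * `|x| <= N x <= C * `|x|].

Definition two_rotund N : Prop :=
  forall x : nat -> V,
    (forall n, N (x n) <= 1) ->
    N (x mn.1 + x mn.2) @[mn --> (\oo, \oo)] --> (2 : R) ->
  exists l, N (x n - l) @[n --> \oo] --> (0 : R).

(* Finitely supported families are families on a finite set A of indices. *)
Definition unconditional1 (I : choiceType) N (u : I -> V) : Prop :=
  forall (A : {fset I}) (a : I -> R) (s : I -> bool),
    N (\sum_(i <- A) ((-1) ^+ s i * a i) *: u i) <= N (\sum_(i <- A) a i *: u i).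

Definition schauder_basis (e : nat -> V) : Prop :=
  forall y : V, exists! a : nat -> R, series (fun j => a j *: e j) @ \oo --> y.

Definition dual : set (V -> R) := [set f : V -> R | scalar f /\ continuous f].

Definition dual_norm (f : V -> R) : R :=
  sup [set `|f y| | y in [set y | `|y| <= 1]].

(* Only the values of phi on the dual matter. *)
Definition bidual : set ((V -> R) -> R) :=
  [set phi |
    (forall a f g, dual f -> dual g ->
       phi (fun y => a * f y + g y) = a * phi f + phi g) /\
    exists C : R, forall f, dual f -> `|phi f| <= C * dual_norm f].

Definition reflexive_space : Prop :=
  forall phi, bidual phi -> exists y, forall f, dual f -> phi f = f y.

End Norms.

Definition c00 (T : Type) : set (T -> R) :=
  [set x | finite_set [set g | x g != 0]].

Definition family_norm (S : finType) (G : set {fset branch S})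
    (x : branch S -> R) : R :=
  sup [set \sum_(g <- A) `|x g| | A in G].

Definition space_norm (S : finType) (F : nat -> set {fset branch S})
    (Y : completeNormedModType R) (e : nat -> Y) (x : branch S -> R) : R :=
  `| limn (series (fun j => (2 ^- j * family_norm (F j) x) *: e j)) |.

(* X, together with the embedding iota of c00 (only the values of iota on c00
   matter), is a completion of c00 under the norm nrm.  Completions are unique
   up to isometric isomorphism compatible with the embeddings. *)
Definition is_completion (T : Type) (nrm : (T -> R) -> R)
    (X : completeNormedModType R) (iota : (T -> R) -> X) : Prop :=
  [/\ forall a x y, c00 x -> c00 y ->
        iota (fun g => a * x g + y g) = a *: iota x + iota y,
      forall x, c00 x -> `|iota x| = nrm x &
      dense (iota @` @c00 T)].

End Banach.

(* Main.v *)
Require Import Defs.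
From mathcomp Require Import all_boot all_order all_algebra finmap.
From mathcomp Require Import all_classical all_reals all_analysis.
From mathcomp Require Import ring lra.
Import Order.TTheory GRing.Theory Num.Theory numFieldNormedType.Exports.

(** The new norm N is the square root of |x|^2 + sum_k 2^-(k+1) Q_k(x)^2, for
suitable countably many seminorms Q_k <= |x| which only depend on the absolute
values of the coordinates, so that N is 1-unconditional. If N(x_n) <= 1 and
N(x_m + x_n) -> 2, then the parallelogram defect of each Q_k tends to 0 along
the sequence: Q_k(x_n) tends to some a and Q_k(x_m + x_n) tends to 2 a
([renorm_flat]). Call such a sequence flat for Q_k. It suffices to find
seminorms, on finitely supported functions, for which every bounded flat
sequence is a Cauchy sequence ([renorming]). Three kinds of seminorms are used.

The Euclidean norms of the l largest coordinates ([top_norm]) make the sequence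
uniformly Cauchy, as Day's norm does on c_0: sets carrying almost all of
x_m + x_n do so for x_m and x_n, and x_m and x_n almost agree there. Part (b) of
the inclusion condition prevents the sequence from spreading large coordinates
over infinitely many places ([uniform_cauchy]).

The seminorms [tail_norm], with weight K on l free points and the norm of index
j on the other ones, pass from the norm of index j - 1 to the norm of index j
([family_cauchy]). Let x be the pointwise limit, and G the finite set on which
|x| exceeds a small threshold. For l = |G| and K large, the seminorm is K times
the mass on G plus the norm of index j outside G, so the latter is flat. Part
(a) of the inclusion condition shows that x is small outside G in the norm of
index j ([small_tail]). The remainders x_n - x tend to 0 in the norm of index
j - 1, so for n much larger than m no single set of the family of index j sees
both x_m - x and x_n - x ([not_normed_together]): outside G, the norm of
x_m + x_n is about the maximum, not the sum, of the norms of x_m and x_n. By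
flatness both are small.

The last seminorms control the tails of the vectors y_n of Y with coordinates
2^-j |x_n|_j. For such a tail t and a positive vector c from a countable dense
set, take |t + |t| c| ([twisted_tail]). Flatness for all c makes the norms of
iterated convex combinations of far members of the sequence of tails as large
as the limit of their norms. By the Hahn-Banach theorem and reflexivity, a weak
limit of the tails has at least this norm ([norm_weak_limit]). But the k-tails
converge weakly to the k-tail of a fixed vector, which is small for k large, so
the tails of the y_n are uniformly small ([small_profile_tails]). Together with
the convergence in each norm of index j, this shows that the sequence is Cauchy
([space_cauchy]).

Maximal families satisfy the inclusion condition by the pigeonhole principle:
as S is finite, infinitely many branches share a prefix of length M, and unions
of M sets of such branches have a sharp number larger than M
([maximal_union]). *)

Set Implicit Arguments.
Unset Strict Implicit.
Unset Printing Implicit Defensive.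

Local Open Scope classical_set_scope.
Local Open Scope ring_scope.

(** * Families of branches and the inclusion condition *)

Section NatMin.
Implicit Type P : set nat.

Lemma nat_min_le P n : P n -> (nat_min P <= n)%N.
Proof.
move=> Pn; rewrite /nat_min; case: pselect => // h.
by case: ex_minnP => m _; apply; apply/asboolP.
Qed.

Lemma nat_minP P n : P n -> P (nat_min P).
Proof.
move=> Pn; rewrite /nat_min; case: pselect => [h|[]].
  by case: ex_minnP => m /asboolP.
by exists n; apply/asboolP.
Qed.

End NatMin.

Section Combinatorics.
Variable S : finType.
Implicit Types (p q : branch S) (A B : {fset branch S}).

Lemma branch_distE p q : p <> q ->
  (forall i, (i.+1 < branch_dist p q)%N -> p i = q i).
Proof.
move=> pq i; rewrite /branch_dist ltnS => ilt; apply: contrapT => npq.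
by have := @nat_min_le [set k | p k <> q k] i npq; rewrite leqNgt ilt.
Qed.

Lemma branch_dist_gt p q d : p <> q -> (forall i, (i < d)%N -> p i = q i) ->
  (d < branch_dist p q)%N.
Proof.
move=> pq pqd; rewrite /branch_dist ltnS leqNgt; apply/negP => lt.
have [k pk] : exists k, p k <> q k.
  apply: contrapT => h; apply: pq; apply/funext => k; apply: contrapT => pk.
  by apply: h; exists k.
have := @nat_minP [set k | p k <> q k] k pk.
by apply; exact: pqd.
Qed.

Lemma sharp_le A p q : p \in A -> q \in A -> p <> q ->
  (sharp A <= branch_dist p q)%N.
Proof.
by move=> pA qA pq; apply: nat_min_le; exists (p, q).
Qed.

Lemma fset_two A : (2 <= #|` A|)%N ->
  exists p q, [/\ p \in A, q \in A & p <> q].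
Proof.
move=> A2; have /fset0Pn[p pA] : A != fset0 by rewrite -cardfs_gt0; exact: leq_trans A2.
have : (A `\ p)%fset != fset0.
  by rewrite -cardfs_gt0; move: A2; rewrite (cardfsD1 p) pA.
move=> /fset0Pn[q]; rewrite !inE => /andP[qp qA].
by exists p, q; split => // pq; rewrite pq eqxx in qp.
Qed.

Lemma sharp_gt A d : (2 <= #|` A|)%N ->
  (forall p q, p \in A -> q \in A -> p <> q -> (d < branch_dist p q)%N) ->
  (d < sharp A)%N.
Proof.
move=> /fset_two[p [q [pA qA pq]]] h.
have [] := @nat_minP [set branch_dist pq.1 pq.2 | pq in
  [set pq | [/\ pq.1 \in A, pq.2 \in A & pq.1 <> pq.2]]] (branch_dist p q).
  by exists (p, q).
by rewrite -/(sharp A) => -[p' q'] /= [? ? ?] <-; exact: h.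
Qed.

Lemma infinite_color (C : finType) (c : nat -> C) :
  exists col, forall n, exists2 i, (n <= i)%N & c i = col.
Proof.
apply: contrapT => h.
have /choice[f fP] : forall col, exists n, forall i, (n <= i)%N -> c i <> col.
  move=> col; apply: contrapT => h1; apply: h; exists col => n.
  apply: contrapT => h2; apply: h1; exists n => i ni ci; apply: h2.
  by exists i.
pose n := \max_(col : C) f col.
by apply: (fP (c n) n) => //; exact: leq_bigmax.
Qed.

Lemma infinite_increasing (P : nat -> Prop) :
  (forall n, exists2 i, (n <= i)%N & P i) ->
  forall M, exists s : seq nat, [/\ sorted ltn s, size s = M &
    forall i, i \in s -> P i].
Proof.
move=> h M.
suff hs : forall n, exists s : seq nat, [/\ sorted ltn s, size s = M &
    forall i, i \in s -> P i /\ (n <= i)%N].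
  by have [s [? ? sP]] := hs 0%N; exists s; split => // i /sP[].
elim: M => [|M IH] n; first by exists [::].
have [i ni Pi] := h n.
have [s [ss sM sP]] := IH i.+1.
exists (i :: s); split => //=; last 2 first.
- by rewrite sM.
- move=> k; rewrite inE => /predU1P[->//|/sP[Pk ik]]; split => //.
  by apply: leq_trans ni _; exact: ltnW.
- case: s ss sP {sM} => //= k s -> sP; rewrite andbT.
  by have [] := sP k (mem_head _ _).
Qed.

(** This is where the finiteness of S enters: there are only finitely many
prefixes of length M. *)
Lemma common_prefix (g : nat -> branch S) (M : nat) : exists w : nat -> S,
  forall n, exists2 i, (n <= i)%N & forall k, (k < M)%N -> g i k = w k.
Proof.
pose c i : {ffun 'I_M -> S} := [ffun k : 'I_M => g i k].
have [col h] := infinite_color c.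
have [i0 _ _] := h 0%N.
exists (fun k => if insub k is Some k' then col k' else g i0 k) => n.
have [i ni ci] := h n; exists i => // k kM.
by rewrite insubT -ci ffunE.
Qed.

Lemma mem_bigfcup (s : seq nat) (A : nat -> {fset branch S}) p :
  p \in (\bigcup_(i <- s) A i)%fset -> exists2 i, i \in s & p \in A i.
Proof.
by move=> /bigfcupP[i /andP[is_ _] pA]; exists i.
Qed.

Variable F : nat -> set {fset branch S}.
Hypothesis hF : admissible F.

Lemma admissible_mono n A : F 0%N A -> F n A.
Proof.
by elim: n => // n IH /IH; have [_ /(_ n)[_ h _]] := hF; exact: h.
Qed.

Lemma admissible0 n : F n fset0.
Proof. by apply: admissible_mono; case: hF => -> _; left. Qed.

Lemma admissible1 n p : F n [fset p]%fset.
Proof. by apply: admissible_mono; case: hF => -> _; right; exists p. Qed.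

Lemma admissible_sub n A B : F n A -> (B `<=` A)%fset -> F n B.
Proof.
case: n => [|n]; last by have [_ /(_ n)[h _ _]] := hF; exact: h.
case: hF => -> _ [->|[p ->]]; first by rewrite fsubset0 => /eqP ->; left.
by rewrite fsubset1 => /orP[] /eqP ->; [right; exists p|left].
Qed.

Lemma admissible_small n A : (#|` A| < 2)%N -> F n A.
Proof.
case: (posnP #|` A|) => [/cardfs0_eq -> _|A0 A1]; first exact: admissible0.
have /cardfs1P[p ->] : #|` A| == 1%N by rewrite eqn_leq -ltnS A1.
exact: admissible1.
Qed.

Lemma admissible_union n A : F n.+1 A -> (2 <= #|` A|)%N -> sharp_union (F n) A.
Proof. by have [_ /(_ n)[_ _]] := hF; exact. Qed.

Hypothesis hmax : maximal F.

(** Branches with a common prefix of length M have distances larger than M, so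
the union of at most M members of a family, all of whose branches share this
prefix, has a sharp number which allows that many pieces. The unused pieces are
empty. *)
Lemma maximal_union n (M : nat) (s : seq nat) (A : nat -> {fset branch S}) (w : nat -> S) :
  (size s <= M)%N ->
  (forall i, i \in s -> F n (A i)) ->
  (forall i p, i \in s -> p \in A i -> forall k, (k < M)%N -> p k = w k) ->
  F n.+1 (\bigcup_(i <- s) A i)%fset.
Proof.
move=> sM FA Aw; set U := (\bigcup_(i <- s) _)%fset.
have [U2|U2] := ltnP #|` U| 2; first exact: admissible_small.
apply/hmax; right; split => //.
have sU : (M < sharp U)%N.
  apply: sharp_gt => // p q /mem_bigfcup[i si pA] /mem_bigfcup[i' si' qA] pq.
  by apply: branch_dist_gt => // k kM; rewrite (Aw i) // (Aw i').
exists (fun i => if (i < size s)%N then A (nth 0%N s i) else fset0); split.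
  move=> i _; case: ifPn => [lt|_]; last exact: admissible0.
  by apply: FA; rewrite mem_nth.
apply/fsetP => p; apply/idP/idP.
- move=> /mem_bigfcup[i si pA]; apply/bigfcupP; exists (index i s).
    rewrite mem_iota add0n andbT /= (leq_ltn_trans _ sU)// (leq_trans _ sM)//.
    by rewrite ltnW// index_mem.
  by rewrite index_mem si nth_index.
- move=> /mem_bigfcup[i _]; case: ifPn; last by rewrite inE.
  by move=> lt pA; apply/bigfcupP; exists (nth 0%N s i); rewrite ?mem_nth.
Qed.

Lemma maximal_inclusion : inclusion_condition F.
Proof.
split.
- move=> n M _ A _ FA sA.
  have /choice[g gA] : forall i, exists p, p \in A i.
    move=> i; have [_] := FA i => A2.
    by have [p [_ [pA _ _]]] := fset_two A2; exists p.
  have [w wP] := common_prefix g M.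
  have [N _ NP] : \forall i \near \oo, (M < sharp (A i))%N.
    by apply: (sA [set k | (M < k)%N]); exact: nbhs_infty_gt.
  have [s [ss sM sP]] : exists s : seq nat, [/\ sorted ltn s, size s = M &
      forall i, i \in s -> (N <= i)%N /\ forall k, (k < M)%N -> g i k = w k].
    apply: infinite_increasing => m; have [i mi iw] := wP (maxn m N).
    by exists i; move: mi; rewrite geq_max => /andP[].
  exists s; split => //.
  apply: (@maximal_union _ M _ _ w) => [|i _|i p /sP[Ni gw] pA k kM].
  + by rewrite sM.
  + by have [] := FA i.
  + have [->|pg] := pselect (p = g i); first exact: gw.
    rewrite -gw// ; apply: (branch_distE pg).
    apply: leq_trans (sharp_le pA (gA i) pg).
    by rewrite (leq_trans _ (NP i Ni)).
- move=> g M; have [w wP] := common_prefix g M.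
  have [s [ss sM sP]] := infinite_increasing wP M.
  exists s; split => //.
  have -> : [fset g i | i in s]%fset = (\bigcup_(i <- s) [fset g i])%fset.
    apply/fsetP => p; apply/imfsetP/bigfcupP => /=.
    + by move=> [i si ->]; exists i; rewrite ?si ?inE.
    + by move=> [i /andP[si _]]; rewrite inE => /eqP ->; exists i.
  apply: (@maximal_union _ M _ _ w) => [|i _|i p si].
  + by rewrite sM.
  + exact: admissible1.
  + by rewrite inE => /eqP ->; exact: sP.
Qed.

End Combinatorics.

(** * Masses of finitely supported functions *)

Section SupImage.
Variables (R : realType) (I : Type) (G : set I) (f : I -> R).

Lemma sup_img_ub b i : (forall i, G i -> f i <= b) -> G i ->
  f i <= sup [set f i | i in G].
Proof.
move=> fb Gi; apply: ub_le_sup; last by exists i.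
by exists b => _ [k Gk <-]; exact: fb.
Qed.

Lemma sup_img_le b : G !=set0 -> (forall i, G i -> f i <= b) ->
  sup [set f i | i in G] <= b.
Proof.
move=> [i Gi] fb; apply: ge_sup; first by exists (f i), i.
by move=> _ [k Gk <-]; exact: fb.
Qed.

Lemma sup_img_adh b e : 0 < e -> G !=set0 -> (forall i, G i -> f i <= b) ->
  exists2 i, G i & sup [set f i | i in G] - e <= f i.
Proof.
move=> e0 [i Gi] fb.
have hs : has_sup [set f i | i in G].
  split; first by exists (f i), i.
  by exists b => _ [k Gk <-]; exact: fb.
by have [_ [k Gk <-] /ltW] := sup_adherent e0 hs; exists k.
Qed.

End SupImage.

Section Mass.
Variables (R : realType) (T : choiceType).
Implicit Types (x y : T -> R) (A B C G : {fset T}).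

Definition mass A x : R := \sum_(g <- A) `|x g|.

Lemma mass_ge0 A x : 0 <= mass A x.
Proof. exact: sumr_ge0. Qed.

Lemma massD A x y : mass A (x \+ y) <= mass A x + mass A y.
Proof. by rewrite -big_split /=; apply: ler_sum => g _; exact: ler_normD. Qed.

Lemma massB A x y : mass A (x \- y) <= mass A x + mass A y.
Proof. by rewrite -big_split /=; apply: ler_sum => g _; exact: ler_normB. Qed.

Lemma massZ A a x : mass A (a \*o x) = `|a| * mass A x.
Proof. by rewrite mulr_sumr; apply: eq_bigr => g _; rewrite normrM. Qed.

Lemma mass_le A x y : {in A, forall g, `|x g| <= `|y g|} -> mass A x <= mass A y.
Proof.
by move=> h; rewrite /mass big_seq [leRHS]big_seq; apply: ler_sum.
Qed.

Lemma mass_const A x (b : R) : {in A, forall g, `|x g| <= b} -> mass A x <= #|` A|%:R * b.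
Proof.
move=> h; rewrite (@le_trans _ _ (\sum_(g <- A) b))//.
  by rewrite /mass big_seq [leRHS]big_seq; apply: ler_sum.
by rewrite big_const_seq count_predT iter_addr addr0 mulr_natl.
Qed.

Lemma mass_sub A B x : (A `<=` B)%fset -> mass A x <= mass B x.
Proof.
move=> AB; rewrite /mass [leRHS](big_fsetID _ (mem A)) /=.
have -> : [fset g in B | g \in A]%fset = A.
  apply/fsetP => g; rewrite !inE andbC /=.
  by case: (boolP (g \in A)) => //= gA; rewrite (fsubsetP AB).
by rewrite lerDl sumr_ge0.
Qed.

Lemma massID A C x : mass A x = mass (A `&` C)%fset x + mass (A `\` C)%fset x.
Proof.
rewrite /mass (big_fsetID _ (mem C)) /=.
have -> : [fset g in A | g \in C]%fset = (A `&` C)%fset.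
  by apply/fsetP => g; rewrite !inE.
have -> // : [fset g in A | g \notin C]%fset = (A `\` C)%fset.
by apply/fsetP => g; rewrite !inE andbC.
Qed.

Lemma mass1 g x : mass [fset g]%fset x = `|x g|.
Proof. by rewrite /mass big_seq_fset1. Qed.

Lemma mass0 x : mass fset0 x = 0.
Proof. by rewrite /mass big_seq_fset0. Qed.

Lemma mass_mem A g x : g \in A -> `|x g| <= mass A x.
Proof. by move=> gA; rewrite -mass1; apply: mass_sub; rewrite fsub1set. Qed.

Lemma massU A B x : mass (A `|` B)%fset x <= mass A x + mass B x.
Proof.
rewrite (massID (A `|` B)%fset A) fsetDUl fsetDv fset0U lerD//.
- by apply: mass_sub; exact: fsubsetIr.
- by apply: mass_sub; exact: fsubsetDl.
Qed.

Lemma mass_bigcup (s : seq nat) (A : nat -> {fset T}) x (b : R) :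
  (forall i, i \in s -> mass (A i) x <= b) ->
  mass (\bigcup_(i <- s) A i)%fset x <= (size s)%:R * b.
Proof.
elim: s => [|i s IH] h; first by rewrite big_nil mass0 mul0r.
rewrite big_cons /= (le_trans (massU _ _ _))// -add1n natrD mulrDl mul1r lerD//.
  by apply: h; rewrite mem_head.
by apply: IH => k ks; apply: h; rewrite inE ks orbT.
Qed.

Lemma mass_bigcup_disj (s : seq nat) (A : nat -> {fset T}) x (b : R) :
  uniq s -> (forall i j, i != j -> A i `&` A j = fset0)%fset ->
  (forall i, i \in s -> b <= mass (A i) x) ->
  (size s)%:R * b <= mass (\bigcup_(i <- s) A i)%fset x.
Proof.
move=> + dA; elim: s => [_|i s IH /andP[iNs us] h].
  by rewrite big_nil mass0 mul0r.
rewrite big_cons /= -add1n natrD mulrDl mul1r.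
rewrite (massID (_ `|` _)%fset (A i)) lerD//.
  rewrite (le_trans (h i _)) ?mem_head//; apply: mass_sub.
  by rewrite fsubsetI fsubsetUl fsubset_refl.
rewrite (le_trans (IH us _)) => [//|k ks|]; first by apply: h; rewrite inE ks orbT.
apply: mass_sub; apply/fsubsetP => g gs.
have [k /andP[ks _] gk] := bigfcupP _ _ _ _ gs.
rewrite fsetDUl fsetDv fset0U inE gs andbT.
apply/negP => gi.
have : g \in (A i `&` A k)%fset by rewrite inE gi.
rewrite dA ?inE//; apply: contraNneq iNs => ->; exact: ks.
Qed.

Definition supp x : {fset T} := fset_set [set g | x g != 0].

Lemma suppP x g : c00 x -> x g != 0 -> g \in supp x.
Proof. by move=> cx xg; rewrite in_fset_set// inE. Qed.

Lemma supp_out x g : c00 x -> g \notin supp x -> x g = 0.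
Proof. by move=> cx; apply: contraNeq => /(suppP cx). Qed.

Lemma mass_supp x A : c00 x -> mass A x <= mass (supp x) x.
Proof.
move=> cx; rewrite (massID A (supp x)).
rewrite [X in _ + X](_ : _ = 0) ?addr0; first by apply: mass_sub; exact: fsubsetIr.
rewrite /mass big_seq big1// => g; rewrite !inE => /andP[gx _].
by rewrite (supp_out cx gx) normr0.
Qed.

Lemma c00_sub (x y z : T -> R) : c00 x -> c00 y ->
  (forall g, x g = 0 -> y g = 0 -> z g = 0) -> c00 z.
Proof.
move=> cx cy h; rewrite /c00 /=; apply: (@sub_finite_set _ _
  ([set g | x g != 0] `|` [set g | y g != 0])); last by rewrite finite_setU.
move=> g /= zg; have [xg|xg] := eqVneq (x g) 0; last by left.
by right; apply: contra_neq zg => yg; exact: h.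
Qed.

Lemma c00D x y : c00 x -> c00 y -> c00 (x \+ y).
Proof.
by move=> cx cy; apply: (c00_sub cx cy) => g /= -> ->; rewrite addr0.
Qed.

Lemma c00B x y : c00 x -> c00 y -> c00 (x \- y).
Proof.
by move=> cx cy; apply: (c00_sub cx cy) => g /= -> ->; rewrite subr0.
Qed.

Lemma c00Z a x : c00 x -> c00 (a \*o x).
Proof.
by move=> cx; apply: (c00_sub cx cx) => g /= ->; rewrite mulr0.
Qed.

Lemma c00_0 : c00 (fun _ : T => 0 : R).
Proof.
rewrite /c00 /= (_ : [set _ | _] = set0)//.
by apply/seteqP; split => g //=; rewrite eqxx.
Qed.

(** Monotonicity in the absolute values of the coordinates is what makes the
final norm 1-unconditional. *)
Definition lattice_seminorm (q : (T -> R) -> R) : Prop :=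
  [/\ forall x, c00 x -> 0 <= q x,
      forall x y, c00 x -> c00 y -> q (x \+ y) <= q x + q y,
      forall a x, c00 x -> q (a \*o x) = `|a| * q x &
      forall x y, c00 x -> c00 y -> (forall g, `|x g| <= `|y g|) -> q x <= q y].

Lemma seminormB q x y : lattice_seminorm q -> c00 x -> c00 y ->
  q (x \- y) <= q x + q y.
Proof.
move=> [_ qD qZ _] cx cy.
have -> : x \- y = x \+ ((-1) \*o y) by apply/funext => g /=; rewrite mulN1r.
rewrite (le_trans (qD _ _ cx (c00Z _ cy)))// qZ// normrN normr1 mul1r//.
Qed.

Lemma seminorm_dist q x y : lattice_seminorm q -> c00 x -> c00 y ->
  `|q x - q y| <= q (x \- y).
Proof.
move=> lq cx cy; have [_ qD _ qm] := lq.
have h u v : c00 u -> c00 v -> q u <= q v + q (u \- v).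
  move=> cu cv; rewrite -[X in X <= _](_ : q (v \+ (u \- v)) = _).
    by apply: qD => //; exact: c00B.
  by congr q; apply/funext => g /=; rewrite addrC subrK.
have := h _ _ cx cy; have := h _ _ cy cx.
have -> : q (y \- x) = q (x \- y).
  apply/eqP; rewrite eq_le; apply/andP.
  by split; apply: qm; try exact: c00B; move=> g /=; rewrite distrC.
by move=> h1 h2; rewrite ler_norml; apply/andP; split; lra.
Qed.

End Mass.

(** * Sums of squares of seminorms *)

Section Limits.
Variable R : realType.

Definition tends (u : nat -> R) (a : R) : Prop :=
  forall e, 0 < e -> exists M, forall n, (M <= n)%N -> `|u n - a| <= e.

(** With u n = q (x_n) and w m n = q (x_m + x_n) for a seminorm q, this says
that q (x_m + x_n) - q (x_m) - q (x_n) tends to 0 and that q (x_n) tends to a;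
the upper bound on w is the triangle inequality. *)
Definition flat (u : nat -> R) (w : nat -> nat -> R) (a : R) : Prop :=
  tends u a /\ forall e, 0 < e -> exists M, forall m n, (M <= m)%N -> (M <= n)%N ->
    2 * a - e <= w m n.

Lemma cauchy_seq_cvg (V : completeNormedModType R) (u : nat -> V) :
  (forall e : R, 0 < e -> exists M, forall m n, (M <= m)%N -> (M <= n)%N ->
    `|u m - u n| <= e) ->
  exists l, forall e : R, 0 < e -> exists M, forall n, (M <= n)%N -> `|u n - l| <= e.
Proof.
move=> h.
have cu : cvg (u @ \oo).
  apply/cauchy_cvgP/cauchy_ballP => e e0.
  have [M hM] := h (e / 2) (divr_gt0 e0 (ltr0Sn _ 1)).
  exists ([set u n | n in [set n | (M <= n)%N]], [set u n | n in [set n | (M <= n)%N]]).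
    by split; exists M => // n Mn; exists n.
  move=> [_ _] /= [[m Mm <-] [n Mn <-]]; rewrite -ball_normE /=.
  by rewrite (le_lt_trans (hM _ _ Mm Mn))// ltr_pdivrMr// ltr_pMr// ltr1n.
exists (lim (u @ \oo)) => e e0.
have /cvgrPdist_le/(_ e e0)[M _ hM] := cu.
by exists M => n Mn; rewrite distrC; exact: hM.
Qed.

Lemma cauchy_tends (u : nat -> R) :
  (forall e : R, 0 < e -> exists M, forall m n, (M <= m)%N -> (M <= n)%N ->
    `|u m - u n| <= e) -> exists a, tends u a.
Proof. by move=> /(@cauchy_seq_cvg R^o)[a ha]; exists a. Qed.

Lemma tends_le (u : nat -> R) a b : tends u a -> (forall n, u n <= b) -> a <= b.
Proof.
move=> ua ub; apply/ler_addgt0Pr => e e0; have [M /(_ M (leqnn _))] := ua e e0.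
by rewrite ler_norml => /andP[? ?]; have := ub M; lra.
Qed.

Lemma tends_ge (u : nat -> R) a b : tends u a -> (forall n, b <= u n) -> b <= a.
Proof.
move=> ua ub; apply/ler_addgt0Pr => e e0; have [M /(_ M (leqnn _))] := ua e e0.
by rewrite ler_norml => /andP[? ?]; have := ub M; lra.
Qed.

Lemma sqr_le_norm (a e : R) : 0 <= e -> a ^+ 2 <= e ^+ 2 -> `|a| <= e.
Proof.
by move=> e0; rewrite -(real_normK (num_real a)) ler_pXn2r// nnegrE.
Qed.

(** The inequality (u + v)^2 <= (1 + t) u^2 + (1 + 1/t) v^2 passes to sums and to
suprema of squares; for the best t it is the triangle inequality for the square
root. *)
Lemma sqrt_triangle (s a b : R) :
  (forall t, 0 < t -> s <= (1 + t) * a + (1 + t^-1) * b) ->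
  Num.sqrt s <= Num.sqrt `|a| + Num.sqrt `|b|.
Proof.
move=> h; apply/ler_addgt0Pr => e e0.
set A := Num.sqrt `|a| + e / 2; set B := Num.sqrt `|b| + e / 2.
have A0 : 0 < A by rewrite /A; have := sqrtr_ge0 `|a|; lra.
have B0 : 0 < B by rewrite /B; have := sqrtr_ge0 `|b|; lra.
have aA : a <= A ^+ 2.
  rewrite (le_trans (ler_norm _))// -[leLHS](@sqr_sqrtr _ `|a|)//.
  by rewrite ler_pXn2r ?nnegrE ?sqrtr_ge0// ?ltW// ltrDl divr_gt0.
have bB : b <= B ^+ 2.
  rewrite (le_trans (ler_norm _))// -[leLHS](@sqr_sqrtr _ `|b|)//.
  by rewrite ler_pXn2r ?nnegrE ?sqrtr_ge0// ?ltW// ltrDl divr_gt0.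
have t0 : 0 < B / A by exact: divr_gt0.
have -> : Num.sqrt `|a| + Num.sqrt `|b| + e = A + B by rewrite /A /B; lra.
rewrite -[leRHS](ger0_norm (ltW (addr_gt0 A0 B0))) -sqrtr_sqr ler_wsqrtr//.
rewrite (le_trans (h _ t0))// invf_div.
have -> : (A + B) ^+ 2 = (1 + B / A) * A ^+ 2 + (1 + A / B) * B ^+ 2.
  by field; rewrite !gt_eqF.
rewrite lerD// ler_wpM2l//; first by rewrite addr_ge0// ltW.
by rewrite addr_ge0// ltW// divr_gt0.
Qed.

Lemma sqrD_le (t u v w : R) : 0 < t -> `|w| <= `|u| + `|v| ->
  w ^+ 2 <= (1 + t) * u ^+ 2 + (1 + t^-1) * v ^+ 2.
Proof.
move=> t0 h; have w2 : w ^+ 2 <= (`|u| + `|v|) ^+ 2.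
  by rewrite -(real_normK (num_real w)) ler_pXn2r ?nnegrE// addr_ge0.
apply: (le_trans w2); rewrite -[u ^+ 2]real_normK ?num_real//.
rewrite -[v ^+ 2]real_normK ?num_real//.
move: `|u| `|v| => {h w2} a b; rewrite -subr_ge0.
rewrite [X in 0 <= X](_ : _ = t^-1 * (t * a - b) ^+ 2).
  by rewrite mulr_ge0 ?sqr_ge0// invr_ge0 ltW.
by field; rewrite gt_eqF.
Qed.

End Limits.

Definition seminorm (R : realType) (V : lmodType R) (q : V -> R) : Prop :=
  [/\ forall x, 0 <= q x, forall x y, q (x + y) <= q x + q y &
      forall a x, q (a *: x) = `|a| * q x].

Section Renorm.
Variables (R : realType) (V : normedModType R) (Q : nat -> V -> R).
Hypothesis Qsn : forall k, seminorm (Q k).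
Hypothesis Qle : forall k x, Q k x <= `|x|.

Let w k : R := 2 ^- k.+1.

Definition partial_sq n (x : V) : R := \sum_(k < n) 2 ^- k.+1 * Q k x ^+ 2.

Definition total_sq (x : V) : R :=
  `|x| ^+ 2 + sup [set partial_sq n x | n in setT].

Definition renorm (x : V) : R := Num.sqrt (total_sq x).

Let Q0 k x : 0 <= Q k x. Proof. by have [] := Qsn k. Qed.

Let w0 k : 0 < w k. Proof. by rewrite /w invr_gt0 exprn_gt0. Qed.

Lemma partial_sq_ge0 n x : 0 <= partial_sq n x.
Proof.
by apply: sumr_ge0 => k _; rewrite mulr_ge0 ?sqr_ge0// (ltW (w0 k)).
Qed.

Lemma partial_sq_le n x : partial_sq n x <= `|x| ^+ 2.
Proof.
have h : forall n, \sum_(k < n) w k = 1 - 2 ^- n.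
  elim=> [|m IH]; first by rewrite big_ord0 expr0 invr1 subrr.
  rewrite big_ord_recr /= IH /w exprS invfM.
  by have := (2^-m : R); move=> a; lra.
apply: (@le_trans _ _ (\sum_(k < n) w k * `|x| ^+ 2)).
  apply: ler_sum => k _; rewrite ler_wpM2l ?(ltW (w0 _))//.
  by rewrite ler_pXn2r ?nnegrE ?Qle ?Q0.
by rewrite -mulr_suml h ler_piMl ?sqr_ge0// gerBl invr_ge0 exprn_ge0.
Qed.

Let pS n x : partial_sq n x <= sup [set partial_sq n x | n in setT].
Proof.
apply: (@sup_img_ub _ _ setT (partial_sq^~ x) (`|x| ^+ 2)) => // k _.
exact: partial_sq_le.
Qed.

Let S_le x b : (forall n, partial_sq n x <= b) ->
  sup [set partial_sq n x | n in setT] <= b.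
Proof. by move=> h; apply: (@sup_img_le _ _ setT (partial_sq^~ x)) => //; exists 0%N. Qed.

Let S0 x : 0 <= sup [set partial_sq n x | n in setT].
Proof. exact: le_trans (partial_sq_ge0 0 x) (pS 0 x). Qed.

Lemma total_sq_ge0 x : 0 <= total_sq x.
Proof. by rewrite addr_ge0 ?sqr_ge0. Qed.

Lemma renorm_sqr x : renorm x ^+ 2 = total_sq x.
Proof. by rewrite sqr_sqrtr ?total_sq_ge0. Qed.

Lemma renorm_ge x : `|x| <= renorm x.
Proof.
by rewrite -[leLHS]ger0_norm// -sqrtr_sqr ler_wsqrtr// /total_sq lerDl.
Qed.

Lemma renorm_le x : renorm x <= 2 * `|x|.
Proof.
rewrite -[leRHS]ger0_norm ?mulr_ge0// -sqrtr_sqr ler_wsqrtr// /total_sq.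
have /S_le h := partial_sq_le^~ x.
by rewrite exprMn; have := sqr_ge0 `|x|; lra.
Qed.

Lemma renormD x y : renorm (x + y) <= renorm x + renorm y.
Proof.
rewrite /renorm -[in leRHS](ger0_norm (total_sq_ge0 x)).
rewrite -[in leRHS](ger0_norm (total_sq_ge0 y)).
apply: sqrt_triangle => t t0; rewrite /total_sq.
have h1 : `|x + y| ^+ 2 <= (1 + t) * `|x| ^+ 2 + (1 + t^-1) * `|y| ^+ 2.
  by apply: sqrD_le => //; rewrite !normr_id ler_normD.
have t1 : 0 <= 1 + t by rewrite addr_ge0// ltW.
have t2 : 0 <= 1 + t^-1 by rewrite addr_ge0// invr_ge0 ltW.
have h2 : sup [set partial_sq n (x + y) | n in setT] <=
  (1 + t) * sup [set partial_sq n x | n in setT] +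
  (1 + t^-1) * sup [set partial_sq n y | n in setT].
  apply: S_le => n.
  apply: (@le_trans _ _ ((1 + t) * partial_sq n x + (1 + t^-1) * partial_sq n y)).
    rewrite !mulr_sumr -big_split /=; apply: ler_sum => k _.
    rewrite [leRHS](_ : _ = w k * ((1 + t) * Q k x ^+ 2 + (1 + t^-1) * Q k y ^+ 2));
      last by rewrite /w; ring.
    rewrite ler_wpM2l ?(ltW (w0 _))//; apply: sqrD_le => //; rewrite !ger0_norm//.
    by have [] := Qsn k.
  by rewrite lerD// ler_wpM2l.
by move: h1 h2; rewrite !mulrDr; lra.
Qed.

Lemma renormZ a x : renorm (a *: x) = `|a| * renorm x.
Proof.
rewrite /renorm -sqrtr_sqr -sqrtrM ?sqr_ge0//; congr Num.sqrt.
rewrite /total_sq normrZ exprMn mulrDr real_normK ?num_real//; congr (_ + _).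
have h b z n : partial_sq n (b *: z) = b ^+ 2 * partial_sq n z.
  rewrite mulr_sumr; apply: eq_bigr => k _.
  have [_ _ ->] := Qsn k.
  by rewrite exprMn real_normK ?num_real// mulrCA.
apply/eqP; rewrite eq_le; apply/andP; split.
  by apply: S_le => n; rewrite h ler_wpM2l ?sqr_ge0.
have [->|a0] := eqVneq a 0; first by rewrite expr0n /= mul0r.
rewrite mulrC -ler_pdivlMr ?exprn_even_gt0//; apply: S_le => n.
rewrite ler_pdivlMr ?exprn_even_gt0// mulrC -h.
exact: pS.
Qed.

Lemma eq_renorm x y : `|x| = `|y| -> (forall k, Q k x = Q k y) ->
  renorm x = renorm y.
Proof.
move=> xy Qxy; rewrite /renorm /total_sq xy.
suff -> : (fun n => partial_sq n x) = (fun n => partial_sq n y) by [].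
by apply/funext => n; apply: eq_bigr => k _; rewrite Qxy.
Qed.

(** Each summand of the defect of the parallelogram inequality is nonnegative,
so the defect of a single seminorm is controlled by that of the sum. *)
Lemma renorm_parallelogram k x y :
  2 ^- k.+1 * (2 * Q k x ^+ 2 + 2 * Q k y ^+ 2 - Q k (x + y) ^+ 2) <=
  2 * renorm x ^+ 2 + 2 * renorm y ^+ 2 - renorm (x + y) ^+ 2.
Proof.
rewrite !renorm_sqr /total_sq.
have h1 : `|x + y| ^+ 2 <= 2 * `|x| ^+ 2 + 2 * `|y| ^+ 2.
  have := @sqrD_le _ 1 `|x| `|y| `|x + y| ltr01.
  by rewrite invr1 !normr_id; apply; exact: ler_normD.
suff h2 : sup [set partial_sq n (x + y) | n in setT] <=
  2 * sup [set partial_sq n x | n in setT] +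
  2 * sup [set partial_sq n y | n in setT] -
  w k * (2 * Q k x ^+ 2 + 2 * Q k y ^+ 2 - Q k (x + y) ^+ 2).
  by move: h1 h2; rewrite /w; lra.
apply: S_le => n.
apply: (@le_trans _ _ (partial_sq (n + k.+1) (x + y))).
  rewrite /partial_sq big_split_ord /= lerDl sumr_ge0// => i _.
  by rewrite mulr_ge0 ?sqr_ge0// ltW// -/(w (n + i)) w0.
have kn : (k < n + k.+1)%N by rewrite addnS ltnS leq_addl.
apply: (@le_trans _ _ (2 * partial_sq (n + k.+1) x + 2 * partial_sq (n + k.+1) y -
  w k * (2 * Q k x ^+ 2 + 2 * Q k y ^+ 2 - Q k (x + y) ^+ 2))); last first.
  by have := pS (n + k.+1) x; have := pS (n + k.+1) y; lra.
have split_k z : partial_sq (n + k.+1) z = w k * Q k z ^+ 2 +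
    \sum_(i < n + k.+1 | i != Ordinal kn) w i * Q i z ^+ 2.
  by rewrite /partial_sq (bigD1 (Ordinal kn)).
rewrite !split_k; set a := \sum_(i < _ | _) _; set b := \sum_(i < _ | _) _; set c := \sum_(i < _ | _) _.
suff : a <= 2 * b + 2 * c by lra.
rewrite /a /b /c !mulr_sumr -big_split /=; apply: ler_sum => i _.
rewrite [leRHS](_ : _ = w i * (2 * Q i x ^+ 2 + 2 * Q i y ^+ 2)); last by ring.
rewrite ler_wpM2l ?(ltW (w0 _))//; have := @sqrD_le _ 1 (Q i x) (Q i y) (Q i (x + y)) ltr01.
rewrite invr1 !ger0_norm//; apply.
by have [] := Qsn i.
Qed.

(** The parallelogram defect of the norm tends to 0 along the sequence, hence
so does that of every summand, which bounds both the square of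
Q (x_m) - Q (x_n) and the square of Q (x_m) + Q (x_n) - Q (x_m + x_n). *)
Lemma renorm_flat (x : nat -> V) :
  (forall n, renorm (x n) <= 1) ->
  (forall e : R, 0 < e -> exists M, forall m n, (M <= m)%N -> (M <= n)%N ->
    2 - e <= renorm (x m + x n)) ->
  forall k, exists a, flat (fun n => Q k (x n)) (fun m n => Q k (x m + x n)) a.
Proof.
move=> x1 x2 k.
have key (e : R) : 0 < e -> exists M, forall m n, (M <= m)%N -> (M <= n)%N ->
    `|Q k (x m) - Q k (x n)| <= e /\
    Q k (x m) + Q k (x n) - e <= Q k (x m + x n).
  move=> e0.
  (* If renorm (x m + x n) >= 2 - d, then the parallelogram defect is at most
     4 - (2 - d)^2 <= 4 d. *)
  pose d := Num.min (1 : R) (w k * e ^+ 2 / 4).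
  have d0 : 0 < d by rewrite lt_min ltr01 divr_gt0// mulr_gt0 ?w0// exprn_gt0.
  have d1 : d <= 1 by rewrite ge_min lexx.
  have d2 : 4 * d <= w k * e ^+ 2.
    by rewrite mulrC -ler_pdivlMr// ge_min lexx orbT.
  have [M hM] := x2 d d0; exists M => m n Mm Mn.
  have := renorm_parallelogram k (x m) (x n); rewrite -/(w k).
  set A := Q k (x m); set B := Q k (x n); set C := Q k (x m + x n).
  have A0 : 0 <= A by exact: Q0.
  have B0 : 0 <= B by exact: Q0.
  have C0 : 0 <= C by exact: Q0.
  have CAB : C <= A + B by rewrite /A /B /C; have [] := Qsn k.
  have hm : renorm (x m) ^+ 2 <= 1 by rewrite expr_le1 ?sqrtr_ge0.
  have hn : renorm (x n) ^+ 2 <= 1 by rewrite expr_le1 ?sqrtr_ge0.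
  have hmn : (2 - d) ^+ 2 <= renorm (x m + x n) ^+ 2.
    by rewrite ler_pXn2r ?nnegrE ?sqrtr_ge0 ?hM//; lra.
  move=> h.
  have {h} h : w k * (2 * A ^+ 2 + 2 * B ^+ 2 - C ^+ 2) <= w k * e ^+ 2.
    apply: le_trans d2; apply: (le_trans h).
    by move: hm hn hmn d0; rewrite sqrrB; have := sqr_ge0 d; lra.
  move: h; rewrite ler_pM2l ?w0// => h.
  have h1 : (A - B) ^+ 2 <= e ^+ 2.
    apply: le_trans h; rewrite -subr_ge0.
    rewrite [X in 0 <= X](_ : _ = (A + B) ^+ 2 - C ^+ 2); last by ring.
    by rewrite subr_ge0 ler_pXn2r ?nnegrE ?addr_ge0.
  have h2 : (A + B - C) ^+ 2 <= e ^+ 2.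
    apply: le_trans h; rewrite -subr_ge0.
    rewrite [X in 0 <= X](_ : _ = (A - B) ^+ 2 + 2 * C * (A + B - C)); last by ring.
    by rewrite addr_ge0 ?sqr_ge0// mulr_ge0// ?mulr_ge0// subr_ge0.
  split.
    exact: sqr_le_norm (ltW e0) h1.
  by have := sqr_le_norm (ltW e0) h2; rewrite ler_norml => /andP[_ ?]; lra.
have [a ha] : exists a, tends (fun n => Q k (x n)) a.
  apply: cauchy_tends => e /key[M hM]; exists M => m n Mm Mn.
  by have [] := hM m n Mm Mn.
exists a; split => // e e0.
have e3 : 0 < e / 3 by exact: divr_gt0.
have [M1 h1] := ha _ e3; have [M2 h2] := key _ e3.
exists (maxn M1 M2) => m n; rewrite !geq_max => /andP[m1 m2] /andP[n1 n2].
have [_] := h2 m n m2 n2.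
move: (h1 m m1) (h1 n n1); rewrite !ler_norml => /andP[? ?] /andP[? ?]; lra.
Qed.

End Renorm.

(** * Extension to the completion *)

Section InfImage.
Variables (R : realType) (I : Type) (G : set I) (f : I -> R).
Hypothesis f0 : forall i, G i -> 0 <= f i.

Lemma inf_img_lb i : G i -> inf [set f i | i in G] <= f i.
Proof.
move=> Gi; apply: ge_inf; last by exists i.
by exists 0 => _ [k Gk <-]; exact: f0.
Qed.

Lemma inf_img_ge b : G !=set0 -> (forall i, G i -> b <= f i) ->
  b <= inf [set f i | i in G].
Proof.
move=> [i Gi] fb; apply: lb_le_inf; first by exists (f i), i.
by move=> _ [k Gk <-]; exact: fb.
Qed.

Lemma inf_img_adh e : 0 < e -> G !=set0 ->
  exists2 i, G i & f i <= inf [set f i | i in G] + e.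
Proof.
move=> e0 [i Gi].
have hs : has_inf [set f i | i in G].
  split; first by exists (f i), i.
  by exists 0 => _ [k Gk <-]; exact: f0.
by have [_ [k Gk <-] /ltW] := inf_adherent e0 hs; exists k.
Qed.

End InfImage.

Section Completion.
Variables (R : realType) (T : choiceType) (nrm : (T -> R) -> R).
Variables (X : completeNormedModType R) (iota : (T -> R) -> X).
Hypothesis hX : is_completion nrm iota.

Lemma iotaD x y : c00 x -> c00 y -> iota (x \+ y) = iota x + iota y.
Proof.
case: hX => lin _ _ cx cy; have := lin 1 _ _ cx cy; rewrite scale1r => <-.
by congr iota; apply/funext => g /=; rewrite mul1r.
Qed.

Lemma iota0 : iota (fun=> 0) = 0.
Proof.
have := iotaD (c00_0 R T) (c00_0 R T).
rewrite (_ : _ \+ _ = fun=> 0); last by apply/funext => g /=; rewrite addr0.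
by move=> /esym/eqP; rewrite -subr_eq0 addrK => /eqP.
Qed.

Lemma iotaZ a x : c00 x -> iota (a \*o x) = a *: iota x.
Proof.
case: hX => lin _ _ cx; have := lin a _ _ cx (c00_0 R T); rewrite iota0 addr0 => <-.
by congr iota; apply/funext => g /=; rewrite addr0.
Qed.

Lemma iotaB x y : c00 x -> c00 y -> iota (x \- y) = iota x - iota y.
Proof.
move=> cx cy; rewrite -scaleN1r -iotaZ// -iotaD//; last exact: c00Z.
by congr iota; apply/funext => g /=; rewrite mulN1r.
Qed.

Lemma norm_iota x : c00 x -> `|iota x| = nrm x.
Proof. by case: hX => _ + _; exact. Qed.

Lemma iota_dense v e : 0 < e -> exists2 y, c00 y & `|v - iota y| <= e.
Proof.
case: hX => _ _ d e0.
have [u [/= vy [y cy yE]]] : ball v e `&` (iota @` @c00 R T) !=set0.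
  by apply: d; [exists v; exact: ballxx|exact: ball_open].
by exists y => //; rewrite yE; move: vy; rewrite -ball_normE /= => /ltW.
Qed.

Section Extension.
Variables (q : (T -> R) -> R) (C : R).
Hypotheses (lq : lattice_seminorm q) (C0 : 0 <= C).
Hypothesis qC : forall x, c00 x -> q x <= C * nrm x.

(** An infimal convolution: the largest seminorm which extends q and is still
dominated by C times the norm. Unlike an extension by continuity, it needs no
choice of approximating sequences. *)
Definition extend (v : X) : R := inf [set q y + C * `|v - iota y| | y in @c00 R T].

Let q0 x : c00 x -> 0 <= q x. Proof. by have [+ _ _ _] := lq; exact. Qed.

Let f0 v y : c00 y -> 0 <= q y + C * `|v - iota y|.
Proof. by move=> cy; rewrite addr_ge0 ?q0// mulr_ge0. Qed.

Let ne : @c00 R T !=set0. Proof. by exists (fun=> 0); exact: c00_0. Qed.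

Lemma extend_le v y : c00 y -> extend v <= q y + C * `|v - iota y|.
Proof. exact: (inf_img_lb (@f0 v)). Qed.

Lemma extend_ge v b : (forall y, c00 y -> b <= q y + C * `|v - iota y|) ->
  b <= extend v.
Proof. exact: (@inf_img_ge _ _ _ (fun y => q y + C * `|v - iota y|)). Qed.

Lemma extend_ge0 v : 0 <= extend v.
Proof. exact/extend_ge/f0. Qed.

Lemma extend_iota x : c00 x -> extend (iota x) = q x.
Proof.
move=> cx; apply/eqP; rewrite eq_le; apply/andP; split.
  by rewrite (le_trans (extend_le _ cx))// subrr normr0 mulr0 addr0.
apply: extend_ge => y cy.
have [_ qD _ _] := lq.
rewrite (_ : x = y \+ (x \- y)); last by apply/funext => g /=; rewrite addrC subrK.
rewrite (le_trans (qD _ _ cy (c00B cx cy)))// lerD2l.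
rewrite (le_trans (qC (c00B cx cy)))// -norm_iota; last exact: c00B.
rewrite iotaB// (_ : y \+ (x \- y) = x)//.
by apply/funext => g /=; rewrite addrC subrK.
Qed.

Lemma extend_norm v : extend v <= C * `|v|.
Proof.
rewrite (le_trans (extend_le v (c00_0 R T)))// iota0 subr0 -[leRHS]add0r lerD2r.
have [_ _ qZ _] := lq; have := qZ 0 _ (c00_0 R T); rewrite normr0 mul0r => q00.
by rewrite -[leRHS]q00; under [X in _ <= q X]funext do rewrite /= mul0r.
Qed.

Lemma extend_seminorm : seminorm extend.
Proof.
have [_ qD qZ _] := lq.
split; first exact: extend_ge0.
- move=> v w; apply/ler_addgt0Pr => e e0.
  have e2 : 0 < e / 2 by exact: divr_gt0.
  have [y cy hy] := inf_img_adh (@f0 v) e2 ne.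
  have [z cz hz] := inf_img_adh (@f0 w) e2 ne.
  rewrite (le_trans (extend_le _ (c00D cy cz)))//.
  move: hy hz; rewrite -/(extend v) -/(extend w) => hy hz.
  have h1 := qD _ _ cy cz.
  have h2 : C * `|v + w - iota (y \+ z)| <= C * `|v - iota y| + C * `|w - iota z|.
    by rewrite -mulrDr ler_wpM2l// iotaD// opprD addrACA ler_normD.
  lra.
- have h a v : a != 0 -> extend (a *: v) <= `|a| * extend v.
    move=> a0; rewrite mulrC -ler_pdivrMr ?normr_gt0//; apply: extend_ge => y cy.
    rewrite ler_pdivrMr ?normr_gt0// (le_trans (extend_le _ (c00Z a cy)))//.
    by rewrite iotaZ// -scalerBr normrZ qZ// mulrDl mulrC lerD2l mulrA mulrAC.
  move=> a v; have [->|a0] := eqVneq a 0.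
    rewrite scale0r normr0 mul0r; apply/eqP; rewrite eq_le extend_ge0 andbT.
    by rewrite (le_trans (extend_norm 0))// normr0 mulr0.
  apply/eqP; rewrite eq_le h//=.
  rewrite -[v in leLHS](scalerK a0) -ler_pdivlMl ?normr_gt0// -normfV.
  by rewrite h// invr_eq0.
Qed.

Lemma extend_dist v w : `|extend v - extend w| <= C * `|v - w|.
Proof.
have [_ hD hZ] := extend_seminorm.
have h u z : extend u <= extend z + C * `|u - z|.
  rewrite -{1}(subrK z u) addrC (le_trans (hD _ _))// lerD2l; exact: extend_norm.
have := h v w; have := h w v; rewrite distrC => h1 h2.
by rewrite ler_norml; apply/andP; split; lra.
Qed.

End Extension.

(** Reduction of the renorming problem to sequences of finitely supported
functions: the seminorms extend to the completion, their sum of squares gives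
the norm, and a flat sequence of the completion is approximated by finitely
supported functions, which are flat as well because the extensions are
Lipschitz. *)
Lemma renorming (I : countType) (q : I -> (T -> R) -> R) (C : I -> R) :
  (forall i, lattice_seminorm (q i)) ->
  (forall i, 0 < C i) ->
  (forall i x, c00 x -> q i x <= C i * nrm x) ->
  (forall x y, c00 x -> c00 y -> (forall g, `|x g| = `|y g|) -> nrm x = nrm y) ->
  (forall x : nat -> T -> R, (forall n, c00 (x n)) -> (forall n, nrm (x n) <= 2) ->
     (forall i, exists a, flat (fun n => q i (x n)) (fun m n => q i (x m \+ x n)) a) ->
     forall e : R, 0 < e -> exists M, forall m n, (M <= m)%N -> (M <= n)%N ->
       nrm (x m \- x n) <= e) ->
  exists N : X -> R, [/\ equivalent_norm N, two_rotund N &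
    unconditional1 N (fun g : T => iota \1_[set g])].
Proof.
move=> lq C0 qC nrm_abs core.
pose Q k v := if @choice.unpickle I k is Some i then (C i)^-1 * @extend (q i) (C i) v else 0.
have Ege0 i v : 0 <= extend (q i) (C i) v by apply: extend_ge0 => //; exact: ltW.
have Qsn k : seminorm (Q k).
  rewrite /Q; case: (@choice.unpickle I k) => [i|]; last first.
    by split => [//|x y|a x]; rewrite ?addr0 ?mulr0.
  have [E0 ED EZ] := extend_seminorm (lq i) (ltW (C0 i)).
  have Ci : 0 <= (C i)^-1 by rewrite invr_ge0 ltW.
  split => [x|x y|a x]; first by rewrite mulr_ge0.
  - by rewrite -mulrDr ler_wpM2l.
  - by rewrite EZ mulrCA.
have Qle k x : Q k x <= `|x|.
  rewrite /Q; case: (@choice.unpickle I k) => [i|//].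
  by rewrite mulrC ler_pdivrMr// mulrC; apply: extend_norm => //; exact: ltW.
exists (renorm Q).
have Nge := renorm_ge Qsn Qle; have Nle := renorm_le Qsn Qle.
split.
- split.
    split; [exact: renormD|exact: renormZ|].
    move=> x Nx; apply/eqP; rewrite -normr_le0 -Nx; exact: Nge.
  exists 1, 2; split => // x; rewrite mul1r Nge; exact: Nle.
- move=> x x1 x2.
  have x3 (e : R) : 0 < e -> exists M, forall m n, (M <= m)%N -> (M <= n)%N ->
      2 - e <= renorm Q (x m + x n).
    move=> e0; move/cvgrPdist_le : x2 => /(_ e e0)[[A B] /= [[M1 _ h1] [M2 _ h2]] h].
    exists (maxn M1 M2) => m n; rewrite !geq_max => /andP[m1 m2] /andP[n1 n2].
    have := h (m, n) (conj (h1 _ m1) (h2 _ n2)); rewrite /= ler_norml => /andP[_ ?].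
    by lra.
  have flatQ := renorm_flat Qsn Qle x1 x3.
  have xb n : `|x n| <= 1 by exact: le_trans (Nge _) (x1 n).
  have /choice[y hy] : forall n, exists y, c00 y /\ `|x n - iota y| <= n.+1%:R^-1.
    move=> n; have n0 : 0 < n.+1%:R^-1 :> R by rewrite invr_gt0.
    by have [y cy yn] := iota_dense (x n) n0; exists y.
  have cy n : c00 (y n) by have [] := hy n.
  have xy (e : R) : 0 < e -> exists M, forall n, (M <= n)%N -> `|x n - iota (y n)| <= e.
    move=> e0; have [M _ hM] := near_infty_natSinv_lt (PosNum e0).
    exists M => n /hM /= h; have [_ h'] := hy n; exact: le_trans h' (ltW h).
  have yb n : nrm (y n) <= 2.
    rewrite -norm_iota// -(subrK (x n) (iota (y n))) (le_trans (ler_normD _ _))//.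
    have [_] := hy n; rewrite distrC => h; have := xb n.
    have : n.+1%:R^-1 <= 1 :> R by rewrite invf_le1// ler1n.
    by move: (n.+1%:R^-1 : R) h => t h t1 h'; apply: (le_trans (lerD h h')); lra.
  have fy i : exists a, flat (fun n => q i (y n)) (fun m n => q i (y m \+ y n)) a.
    have [a [h1 h2]] := flatQ (choice.pickle i); rewrite /Q choice.pickleK in h1 h2.
    exists (C i * a).
    have Ed v w : `|extend (q i) (C i) v - extend (q i) (C i) w| <= C i * `|v - w|.
      by apply: extend_dist => //; exact: ltW.
    have EE v : extend (q i) (C i) v = C i * ((C i)^-1 * extend (q i) (C i) v).
      by rewrite mulrA divff ?mul1r// gt_eqF.
    have Ei v : c00 v -> extend (q i) (C i) (iota v) = q i v.
      by apply: extend_iota => //; [exact: ltW|exact: qC].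
    split => e e0.
    + pose d := e / (2 * C i).
      have d0 : 0 < d by rewrite divr_gt0// mulr_gt0.
      have dC : C i * d = e / 2 by rewrite /d; field; rewrite gt_eqF.
      have [M1 g1] := h1 d d0; have [M2 g2] := xy d d0.
      exists (maxn M1 M2) => n; rewrite geq_max => /andP[n1 n2].
      rewrite -Ei//.
      have := Ed (iota (y n)) (x n); rewrite distrC => k1.
      have k2 : C i * `|x n - iota (y n)| <= e / 2 by rewrite -dC ler_pM2l// g2.
      have k3 : `|extend (q i) (C i) (x n) - C i * a| <= e / 2.
        by rewrite EE -mulrBr normrM (gtr0_norm (C0 i)) -dC ler_pM2l// g1.
      rewrite distrC in k1; move: k1 k3; rewrite distrC in k2.
      move=> k1 k3; rewrite (le_trans (ler_distD (extend (q i) (C i) (x n)) _ _))//.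
      by move: k1 k2 k3; lra.
    + pose d := e / (3 * C i).
      have d0 : 0 < d by rewrite divr_gt0// mulr_gt0.
      have dC : C i * d = e / 3 by rewrite /d; field; rewrite gt_eqF.
      have [M1 g1] := h2 d d0; have [M2 g2] := xy d d0.
      exists (maxn M1 M2) => m n; rewrite !geq_max => /andP[m1 m2] /andP[n1 n2].
      rewrite -Ei; last exact: c00D.
      have := Ed (x m + x n) (iota (y m \+ y n)); rewrite iotaD// => k1.
      have k2 : C i * `|x m + x n - (iota (y m) + iota (y n))| <= e / 3 + e / 3.
        rewrite -dC -mulrDr ler_pM2l// opprD addrACA (le_trans (ler_normD _ _))//.
        by rewrite lerD// g2.
      have k3 : 2 * (C i * a) - e / 3 <= extend (q i) (C i) (x m + x n).
        by rewrite EE -dC mulrCA -mulrBr ler_pM2l// g1.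
      by move: k1; rewrite ler_norml => /andP[_ k1]; move: k1 k2 k3; lra.
  have ycauchy := core y cy yb fy.
  have [l hl] : exists l, forall e : R, 0 < e ->
      exists M, forall n, (M <= n)%N -> `|x n - l| <= e.
    apply: cauchy_seq_cvg => e e0.
    have e3 : 0 < e / 3 by exact: divr_gt0.
    have [M1 g1] := ycauchy _ e3; have [M2 g2] := xy _ e3.
    exists (maxn M1 M2) => m n; rewrite !geq_max => /andP[m1 m2] /andP[n1 n2].
    have := g1 m n m1 n1; rewrite -norm_iota ?iotaB//; last exact: c00B.
    have := g2 m m2; have := g2 n n2.
    rewrite distrC; set u := iota (y m); set v := iota (y n) => k1 k2 k3.
    have : `|x m - x n| <= `|x m - u| + `|u - v| + `|v - x n|.
      rewrite (le_trans (ler_distD v _ _))// lerD2r; exact: ler_distD.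
    by lra.
  exists l; apply/cvgrPdist_le => e e0.
  have e2 : 0 < e / 2 by exact: divr_gt0.
  have [M hM] := hl _ e2; exists M => // n /= Mn.
  rewrite sub0r normrN ger0_norm ?sqrtr_ge0//.
  by have := Nle (x n - l); have := hM n Mn; lra.
- move=> A a s /=.
  have cs (b : T -> R) : c00 (fun h => if h \in A then b h else 0).
    rewrite /c00 /=; apply: (@sub_finite_set _ _ [set` A]); last exact: finite_fset.
    by move=> h /=; case: ifP => //; rewrite eqxx.
  have iotaS (b : T -> R) : \sum_(g <- A) b g *: iota \1_[set g] =
      iota (fun h => if h \in A then b h else 0).
    have -> : (fun h => if h \in A then b h else 0) =
        (fun h => \sum_(g <- A) b g * \1_[set g] h).
      apply/funext => h; case: ifPn => hA.
        rewrite (big_fsetD1 h)//= indicE mem_set// mulr1 big_seq big1 ?addr0//.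
        move=> g; rewrite !inE => /andP[gh _]; rewrite indicE memNset ?mulr0//=.
        by move/esym/eqP; rewrite (negbTE gh).
      rewrite big_seq big1// => g gA; rewrite indicE memNset ?mulr0//=.
      by move=> hg; rewrite hg gA in hA.
    have c1 g : c00 (\1_[set g] : T -> R).
      rewrite /c00 /=; apply: (@sub_finite_set _ _ [set g]) => // h /=.
      rewrite indicE; case: (boolP (h \in [set g])); rewrite ?eqxx// => /set_mem -> //.
    have : c00 (fun h => \sum_(g <- A) b g * \1_[set g] h) /\
      \sum_(g <- A) b g *: iota \1_[set g] =
      iota (fun h => \sum_(g <- A) b g * \1_[set g] h).
      elim: (enum_fset A) => [|g r [IH1 IH2]].
        have -> : (fun h => \sum_(g <- [::]) b g * \1_[set g] h) = (fun=> 0).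
          by apply/funext => h; rewrite big_nil.
        by rewrite big_nil iota0; split => //; exact: c00_0.
      have -> : (fun h => \sum_(i <- g :: r) b i * \1_[set i] h) =
          (b g \*o \1_[set g]) \+ (fun h => \sum_(i <- r) b i * \1_[set i] h).
        by apply/funext => h; rewrite big_cons.
      split; first by apply: c00D => //; exact: c00Z.
      by rewrite big_cons iotaD// ?iotaZ ?IH2//; exact: c00Z.
    by case.
  rewrite !iotaS le_eqVlt; apply/orP; left; apply/eqP; apply: eq_renorm.
    rewrite !norm_iota//; apply: nrm_abs => // h.
    by case: ifP => // _; rewrite normrM normrX normrN1 expr1n mul1r.
  move=> k; rewrite /Q; case: (@choice.unpickle I k) => [i|//]; congr (_ * _).
  have Ei v : c00 v -> extend (q i) (C i) (iota v) = q i v.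
    by apply: extend_iota => //; [exact: ltW|exact: qC].
  rewrite !Ei//; have [_ _ _ qm] := lq i.
  apply/eqP; rewrite eq_le !qm// => h; case: ifP => // _;
    by rewrite normrM normrX normrN1 expr1n mul1r.
Qed.

End Completion.

(** * The auxiliary seminorms *)

Lemma sup_lattice_seminorm (R : realType) (T : choiceType) (I : Type) (G : set I)
    (m : I -> (T -> R) -> R) (bd : (T -> R) -> R) : G !=set0 ->
  (forall i x, 0 <= m i x) ->
  (forall i x y, m i (x \+ y) <= m i x + m i y) ->
  (forall i a x, m i (a \*o x) = `|a| * m i x) ->
  (forall i x y, (forall g, `|x g| <= `|y g|) -> m i x <= m i y) ->
  (forall i x, G i -> c00 x -> m i x <= bd x) ->
  lattice_seminorm (fun x => sup [set m i x | i in G]).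
Proof.
move=> ne m0 mD mZ mm mb.
have ub i x : G i -> c00 x -> m i x <= sup [set m i x | i in G].
  move=> Gi cx; apply: (@sup_img_ub _ _ G (m^~ x) (bd x)) => // k Gk; exact: mb.
have le x b : (forall i, G i -> m i x <= b) -> sup [set m i x | i in G] <= b.
  exact: (@sup_img_le _ _ G (m^~ x)).
have hZ a x : c00 x -> sup [set m i (a \*o x) | i in G] <= `|a| * sup [set m i x | i in G].
  by move=> cx; apply: le => i Gi; rewrite mZ ler_wpM2l// ub.
split.
- by move=> x cx; have [i Gi] := ne; exact: le_trans (m0 i x) (ub _ _ Gi cx).
- move=> x y cx cy; apply: le => i Gi.
  by rewrite (le_trans (mD _ _ _))// lerD// ub.
- move=> a x cx; apply/eqP; rewrite eq_le hZ//=.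
  have [->|a0] := eqVneq a 0.
    rewrite normr0 mul0r; have [i Gi] := ne.
    by rewrite (le_trans (m0 i (0 \*o x)))// ub//; exact: c00Z.
  rewrite -ler_pdivlMl ?normr_gt0// -normfV.
  have := hZ a^-1 _ (c00Z a cx).
  by rewrite (_ : a^-1 \*o (a \*o x) = x)//; apply/funext => g /=; rewrite mulKf.
- move=> x y cx cy xy; apply: le => i Gi.
  by rewrite (le_trans (mm _ _ _ xy))// ub.
Qed.

Section FamilyNorm.
Variables (R : realType) (S : finType).
Local Notation T := (branch S).
Implicit Types (x y : T -> R) (A B C : {fset T}) (G : set {fset T}).

Lemma family_ub G x A : c00 x -> G A -> mass A x <= family_norm G x.
Proof.
move=> cx GA; apply: (@sup_img_ub _ _ G (fun A => mass A x) (mass (supp x) x)) => //.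
by move=> B _; exact: mass_supp.
Qed.

Lemma family_le G x b : G !=set0 -> (forall A, G A -> mass A x <= b) ->
  family_norm G x <= b.
Proof. exact: (@sup_img_le _ _ G (fun A => mass A x)). Qed.

Lemma family_adh G x e : c00 x -> 0 < e -> G !=set0 ->
  exists2 A, G A & family_norm G x - e <= mass A x.
Proof.
move=> cx e0 ne.
apply: (@sup_img_adh _ _ G (fun A => mass A x) (mass (supp x) x)) => //.
by move=> B _; exact: mass_supp.
Qed.

Lemma family_seminorm G : G !=set0 -> lattice_seminorm (@family_norm R S G).
Proof.
move=> ne; apply: (@sup_lattice_seminorm _ _ _ G (fun A x => mass A x)
  (fun x => mass (supp x) x)) => //.
- by move=> *; exact: mass_ge0.
- by move=> *; exact: massD.
- by move=> *; exact: massZ.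
- by move=> A x y xy; apply: mass_le => g _.
- by move=> *; exact: mass_supp.
Qed.

Definition sq x : T -> R := fun g => x g ^+ 2.

Lemma c00_sq x : c00 x -> c00 (sq x).
Proof.
by move=> cx; apply: (c00_sub cx cx) => g xg _; rewrite /sq xg expr0n.
Qed.

Lemma norm_sq x g : `|sq x g| = x g ^+ 2.
Proof. by rewrite ger0_norm// sqr_ge0. Qed.

Lemma mass_sq A x : mass A (sq x) = \sum_(g <- A) x g ^+ 2.
Proof. by apply: eq_bigr => g _; exact: norm_sq. Qed.

Definition small l : set {fset T} := [set A | (#|` A| <= l)%N].

Lemma small0 l : small l fset0.
Proof. by rewrite -[small _ _]/(is_true (#|` @fset0 T| <= l)%N) cardfs0. Qed.

Lemma small_ne l : small l !=set0. Proof. by exists fset0; exact: small0. Qed.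

Definition top_sq l x : R := family_norm (small l) (sq x).

(** The Euclidean norm of the l largest coordinates, a symmetric substitute for
Day's norm on c_0. *)
Definition top_norm l x : R := Num.sqrt (top_sq l x).

Lemma top_sq_ge0 l x : c00 x -> 0 <= top_sq l x.
Proof. by move=> cx; have [+ _ _ _] := family_seminorm (small_ne l); apply; exact: c00_sq. Qed.

Lemma top_norm_sqr l x : c00 x -> top_norm l x ^+ 2 = top_sq l x.
Proof. by move=> cx; rewrite sqr_sqrtr ?top_sq_ge0. Qed.

Lemma top_norm_seminorm l : lattice_seminorm (top_norm l).
Proof.
have [_ _ sZ sm] := family_seminorm (small_ne l).
split.
- by move=> x _; exact: sqrtr_ge0.
- move=> x y cx cy; rewrite /top_norm -[in leRHS](ger0_norm (top_sq_ge0 l cx)).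
  rewrite -[in leRHS](ger0_norm (top_sq_ge0 l cy)); apply: sqrt_triangle => t t0.
  have t1 : 0 <= 1 + t by rewrite addr_ge0// ltW.
  have t2 : 0 <= 1 + t^-1 by rewrite addr_ge0// invr_ge0 ltW.
  apply: family_le; first exact: small_ne.
  move=> A sA; apply: (@le_trans _ _ ((1 + t) * mass A (sq x) + (1 + t^-1) * mass A (sq y))).
    rewrite !mass_sq !mulr_sumr -big_split /=; apply: ler_sum => g _.
    by apply: sqrD_le => //; exact: ler_normD.
  by rewrite lerD// ler_wpM2l//; apply: family_ub => //; exact: c00_sq.
- move=> a x cx; rewrite /top_norm /top_sq.
  have -> : sq (a \*o x) = (a ^+ 2) \*o sq x by apply/funext => g; rewrite /sq /= exprMn.
  rewrite sZ; last exact: c00_sq.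
  by rewrite sqrtrM// normrX sqrtr_sqr normr_id.
- move=> x y cx cy xy; apply: ler_wsqrtr; apply: sm; try exact: c00_sq.
  move=> g; rewrite !norm_sq -[x g ^+ 2]real_normK ?num_real//.
  by rewrite -[y g ^+ 2]real_normK ?num_real// ler_pXn2r ?nnegrE.
Qed.

Lemma top_norm_le l x (b : R) : 0 <= b -> (forall g, `|x g| <= b) ->
  top_norm l x <= l.+1%:R * b.
Proof.
move=> b0 xb; rewrite -[leRHS]ger0_norm ?mulr_ge0// -sqrtr_sqr ler_wsqrtr//.
apply: family_le; first exact: small_ne.
move=> A sA; rewrite (@le_trans _ _ (#|` A|%:R * b ^+ 2))//.
  apply: mass_const => g _; rewrite norm_sq -[x g ^+ 2]real_normK ?num_real//.
  by rewrite ler_pXn2r ?nnegrE.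
rewrite exprMn ler_wpM2r ?sqr_ge0// -natrX ler_nat (leq_trans sA)//.
by rewrite (leq_trans (leqnSn l))// -mulnn leq_pmulr.
Qed.

(** Taking K large forces an almost optimal set C to carry the l largest
coordinates of x, if there is a gap after them. The supremum is then, up to
finitely many coordinates, the family norm of the remaining part of x. *)
Definition tail_term (K : nat) (CB : {fset T} * {fset T}) x : R :=
  K%:R * mass CB.1 x + mass (CB.2 `\` CB.1)%fset x.

Definition tail_norm G (l K : nat) x : R :=
  sup [set tail_term K CB x | CB in [set CB | small l CB.1 /\ G CB.2]].

Lemma tail_ne G l : G !=set0 -> [set CB : {fset T} * {fset T} | small l CB.1 /\ G CB.2] !=set0.
Proof. by move=> [B GB]; exists (fset0, B); split => //; exact: small0. Qed.

Lemma tail_term_supp K CB x : c00 x ->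
  tail_term K CB x <= K%:R * mass (supp x) x + mass (supp x) x.
Proof. by move=> cx; rewrite lerD ?ler_wpM2l// mass_supp. Qed.

Lemma tail_seminorm G l K : G !=set0 -> lattice_seminorm (tail_norm G l K).
Proof.
move=> ne; apply: (@sup_lattice_seminorm _ _ _ _ (tail_term K)
  (fun x => K%:R * mass (supp x) x + mass (supp x) x)).
- exact: tail_ne.
- by move=> CB x; rewrite addr_ge0 ?mulr_ge0 ?mass_ge0.
- move=> CB x y; rewrite /tail_term addrACA -mulrDr lerD ?massD//.
  by rewrite ler_wpM2l// massD.
- by move=> CB a x; rewrite /tail_term !massZ mulrDr mulrCA.
- by move=> CB x y xy; rewrite lerD// ?ler_wpM2l//; apply: mass_le => g _.
- by move=> CB x _; exact: tail_term_supp.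
Qed.

Lemma tail_ub G l K x CB : c00 x -> small l CB.1 -> G CB.2 ->
  tail_term K CB x <= tail_norm G l K x.
Proof.
move=> cx sC GB; apply: (@sup_img_ub _ _ _ ((tail_term K)^~ x)
  (K%:R * mass (supp x) x + mass (supp x) x)) => //.
by move=> CB' _; exact: tail_term_supp.
Qed.

Lemma tail_le G l K x b : G !=set0 ->
  (forall C B, small l C -> G B -> tail_term K (C, B) x <= b) ->
  tail_norm G l K x <= b.
Proof.
move=> ne h; apply: (@sup_img_le _ _ _ ((tail_term K)^~ x)); first exact: tail_ne.
by move=> [C B] [sC GB]; exact: h.
Qed.

Lemma tail_norm_bound G l K x (b : R) : c00 x -> G !=set0 ->
  (forall A B, G A -> (B `<=` A)%fset -> G B) ->
  (forall g, `|x g| <= b) -> family_norm G x <= b -> 0 <= b ->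
  tail_norm G l K x <= (K * l).+1%:R * b.
Proof.
move=> cx ne hG xb fb b0; apply: tail_le => // C B sC GB.
rewrite /tail_term /= -addn1 natrD mulrDl mul1r lerD//.
  rewrite natrM -mulrA ler_wpM2l// (@le_trans _ _ (#|` C|%:R * b))//.
    by apply: mass_const => g _.
  by rewrite ler_wpM2r// ler_nat.
rewrite (le_trans _ fb)//; apply: family_ub => //; apply: (hG B) => //.
exact: fsubsetDl.
Qed.

End FamilyNorm.

(** * Uniform convergence *)

Section UniformCauchy.
Variables (R : realType) (S : finType).
Local Notation T := (branch S).
Variables (F : nat -> set {fset T}) (x : nat -> T -> R).
Hypothesis cx : forall n, c00 (x n).
Hypothesis flat_top : forall l, exists a,
  flat (fun n => top_norm l (x n)) (fun m n => top_norm l (x m \+ x n)) a.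

Lemma flat_top_sq l : exists d, tends (fun n => top_sq l (x n)) d /\
  forall e, 0 < e -> exists M, forall m n, (M <= m)%N -> (M <= n)%N ->
    4 * d - e <= top_sq l (x m \+ x n).
Proof.
have [a [h1 h2]] := flat_top l; exists (a ^+ 2).
have a0 : 0 <= a by apply: (tends_ge h1) => n; exact: sqrtr_ge0.
have pick e : 0 < e -> exists2 d : R, 0 < d & d <= 1 /\ d * (4 * a + 1) <= e.
  move=> e0; have a4 : 0 < 4 * a + 1 by lra.
  exists (Num.min 1 (e / (4 * a + 1))); first by rewrite lt_min ltr01 divr_gt0.
  by split; [rewrite ge_min lexx|rewrite -ler_pdivlMr// ge_min lexx orbT].
split=> e e0; have [d d0 [d1 de]] := pick e e0.
- have [M hM] := h1 d d0; exists M => n /hM.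
  rewrite -top_norm_sqr//; set u := top_norm _ _ => hu.
  rewrite subr_sqr normrM; apply: le_trans de.
  have u0 : 0 <= u by exact: sqrtr_ge0.
  rewrite ler_pM// ger0_norm ?addr_ge0//.
  by move: hu; rewrite ler_norml => /andP[? ?]; lra.
- have [M hM] := h2 d d0; exists M => m n /hM h /h {h}.
  rewrite -top_norm_sqr; last exact: c00D.
  set u := top_norm _ _ => hu; have u0 : 0 <= u by exact: sqrtr_ge0.
  have [h|h] := leP (2 * a) d.
    have : (2 * a) ^+ 2 <= d ^+ 2 by rewrite ler_pXn2r ?nnegrE// ?mulr_ge0// ltW.
    have : d ^+ 2 <= d by rewrite expr2 ler_piMl// ltW.
    rewrite exprMn; have := sqr_ge0 u; have := mulr_ge0 (ltW d0) a0.
    by move: de; rewrite mulrDr mulr1 mulrA; lra.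
  have : (2 * a - d) ^+ 2 <= u ^+ 2 by rewrite ler_pXn2r ?nnegrE// subr_ge0 ltW.
  rewrite sqrrB exprMn; have := sqr_ge0 d.
  by move: de; rewrite mulrDr mulr1 mulrCA; lra.
Qed.

(** A set which is almost optimal for x_m + x_n is almost optimal for both x_m
and x_n, and the parallelogram identity on it shows that these functions almost
agree there. *)
Lemma common_top_set l d : tends (fun n => top_sq l (x n)) d ->
  (forall e, 0 < e -> exists M, forall m n, (M <= m)%N -> (M <= n)%N ->
    4 * d - e <= top_sq l (x m \+ x n)) ->
  forall e, 0 < e -> exists M, forall m n, (M <= m)%N -> (M <= n)%N ->
    exists A, [/\ small l A, mass A (sq (x m \- x n)) <= e,
      d - e <= mass A (sq (x m)) & d - e <= mass A (sq (x n))].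
Proof.
move=> h1 h2 e e0; have e6 : 0 < e / 6 by exact: divr_gt0.
have [M1 g1] := h1 _ e6; have [M2 g2] := h2 _ e6.
exists (maxn M1 M2) => m n; rewrite !geq_max => /andP[m1 m2] /andP[n1 n2].
have [A sA hA] := @family_adh _ _ _ _ _ (c00_sq (c00D (cx m) (cx n))) e6 (@small_ne S l).
have dm : mass A (sq (x m)) <= d + e / 6.
  have := family_ub (c00_sq (cx m)) sA; rewrite -/(top_sq _ _).
  by have := g1 m m1; rewrite ler_norml => /andP[_ ?]; lra.
have dn : mass A (sq (x n)) <= d + e / 6.
  have := family_ub (c00_sq (cx n)) sA; rewrite -/(top_sq _ _).
  by have := g1 n n1; rewrite ler_norml => /andP[_ ?]; lra.
have par : mass A (sq (x m \- x n)) + mass A (sq (x m \+ x n)) =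
    2 * mass A (sq (x m)) + 2 * mass A (sq (x n)).
  rewrite !mass_sq !mulr_sumr -!big_split /=; apply: eq_bigr => g _.
  by rewrite sqrrB sqrrD; lra.
have := g2 m n m2 n2; move: hA; rewrite -/(top_sq _ _) => hA hs.
have := mass_ge0 A (sq (x m \- x n)).
exists A; split => //; lra.
Qed.

Lemma mass_fsetU1 A g (y : T -> R) : g \notin A ->
  mass (g |` A)%fset y = `|y g| + mass A y.
Proof. by move=> gA; rewrite /mass big_fsetU1. Qed.

Section Gap.
Variable d : nat -> R.
Hypothesis hd : forall l, tends (fun n => top_sq l (x n)) (d l).
Hypothesis hd2 : forall l e, 0 < e -> exists M, forall m n, (M <= m)%N -> (M <= n)%N ->
    4 * d l - e <= top_sq l (x m \+ x n).

(** If a coordinate of x_m in an almost optimal set of l + 1 points were small,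
then dropping it would give a set of l points of almost the same weight,
against the increment of d at l. *)
Lemma large_common_set b l : 0 < b -> d l + b <= d l.+1 ->
  exists M, forall m n, (M <= m)%N -> (M <= n)%N ->
    exists A : {fset T}, (l < #|` A|)%N /\
      forall g, g \in A -> b / 2 <= x m g ^+ 2 /\ b / 2 <= x n g ^+ 2.
Proof.
move=> b0 db; have b4 : 0 < b / 4 by exact: divr_gt0.
have [M1 g1] := hd l b4.
have [M2 g2] := common_top_set (hd l.+1) (@hd2 l.+1) b4.
exists (maxn M1 M2) => m n; rewrite !geq_max => /andP[m1 m2] /andP[n1 n2].
have [A [sA _ hm hn]] := g2 m n m2 n2.
have key k : (M1 <= k)%N -> forall B, small l B -> mass B (sq (x k)) <= d l + b / 4.
  move=> k1 B sB; have := family_ub (c00_sq (cx k)) sB; rewrite -/(top_sq _ _).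
  by have := g1 k k1; rewrite ler_norml => /andP[_ ?]; lra.
exists A; split.
  rewrite ltnNge; apply/negP => sA'; have := key m m1 A sA'; lra.
have big k : (M1 <= k)%N -> d l.+1 - b / 4 <= mass A (sq (x k)) ->
    forall g, g \in A -> b / 2 <= x k g ^+ 2.
  move=> k1 hk g gA.
  have gA' : g \notin (A `\ g)%fset by rewrite !inE eqxx.
  have := hk; rewrite -(fsetD1K gA) mass_fsetU1// norm_sq.
  have sA' : small l (A `\ g)%fset.
    by move: sA; rewrite /small /= (cardfsD1 g) gA.
  have := key k k1 _ sA'; lra.
by move=> g gA; split; exact: big.
Qed.

Hypothesis hb : inclusion_b F.
Hypothesis bounded1 : exists C, forall n, family_norm (F 1%N) (x n) <= C.

(** If all increments of d were at least b, then, along an ultrafilter, the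
coordinates would stay large at infinitely many places: the large common sets
of a fixed x_m with almost all x_n lie in the finite support of x_m. By the
inclusion condition, arbitrarily many of these places form a set of the family
of index 1, so the norms of index 1 would be unbounded. *)
Lemma small_increment b : 0 < b -> exists l, d l.+1 < d l + b.
Proof.
move=> b0; apply: contrapT => /forallNP h.
have {}h l : d l + b <= d l.+1 by rewrite leNgt; apply/negP.
have [U [UU sU]] := @ultraFilterLemma nat \oo _.
pose L := [set g : T | U [set n | b / 2 <= x n g ^+ 2]].
have infL : infinite_set L.
  move=> finL; pose A0 := fset_set L.
  have [M hM] := large_common_set b0 (h #|` A0|).
  pose Q := supp (x M).
  have : U ([set n | (M <= n)%N] `&`
      [set n | forall g, g \in Q -> ~ L g -> ~ (b / 2 <= x n g ^+ 2)]).
    apply: filterI; first by apply: sU; exact: nbhs_infty_ge.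
    suff h' (r : seq T) : U [set n | forall g, g \in r -> ~ L g -> ~ (b / 2 <= x n g ^+ 2)].
      exact: (h' (enum_fset Q)).
    elim: r => [|g r IH]; first by apply: filterS filterT => n _ g.
    have [Lg|Lg] := pselect (L g).
      apply: filterS IH => n hn g'; rewrite inE => /predU1P[->//|].
      exact: hn.
    have [//|Ug] := in_ultra_setVsetC [set n | b / 2 <= x n g ^+ 2] UU.
    apply: filterS (filterI IH Ug) => n [hn ngn] g'.
    by rewrite inE => /predU1P[->//|]; exact: hn.
  move=> /filter_ex[n [Mn hn]].
  have [A [cA hA]] := hM M n (leqnn _) Mn.
  have : (A `<=` A0)%fset.
    apply/fsubsetP => g gA; have [am an] := hA g gA.
    rewrite in_fset_set// inE; apply: contrapT => Lg; apply: (hn g) => //.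
    apply: suppP => //; apply/negP => /eqP xg.
    by move: am; rewrite xg expr0n /= leNgt divr_gt0.
  by move=> /fsubset_leq_card; rewrite leqNgt cA.
have [g ginj gL] : exists2 g : nat -> T, injective g & forall i, L (g i).
  move/infiniteP : infL => /card_leP[f].
  exists (fun i => set_val (f (SigSub (mem_setT i)))).
    move=> i j /val_inj /(@inj _ _ _ f) /= h1.
    have : SigSub (mem_setT i) = SigSub (mem_setT j) :> {x : nat | x \in [set: nat]}.
      by apply: h1; rewrite inE.
    by move=> /(congr1 val).
  by move=> i; have /set_mem := valP (f (SigSub (mem_setT i))).
have [C hC] := bounded1.
pose eta := Num.sqrt (b / 2).
have eta0 : 0 < eta by rewrite sqrtr_gt0 divr_gt0.
have [K hK] : exists K : nat, C < K%:R * eta.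
  exists (Num.truncn (C / eta)).+1; rewrite -ltr_pdivrMr//.
  exact: truncnS_gt.
have [s [ss sK Fs]] := hb g K.
have : U [set n | forall i, i \in s -> b / 2 <= x n (g i) ^+ 2].
  elim: (s : seq nat) => [|i r IH]; first by apply: filterS filterT => n _ i.
  apply: filterS (filterI IH (gL i)) => n [hn hi] k.
  by rewrite inE => /predU1P[->//|]; exact: hn.
move=> /filter_ex[n hn].
have us : uniq s by apply: (sorted_uniq _ _ ss); [exact: ltn_trans|exact: ltnn].
have := family_ub (cx n) Fs; rewrite leNgt => /negP; apply.
apply: (le_lt_trans (hC n)); apply: (lt_le_trans hK).
have -> : K%:R * eta = \sum_(i <- s) eta.
  by rewrite big_const_seq count_predT iter_addr addr0 sK mulr_natl.
rewrite /mass big_imfset /=; last by move=> i j _ _; exact: ginj.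
rewrite undup_id// [leLHS]big_seq [leRHS]big_seq; apply: ler_sum => i si.
rewrite -sqrtr_sqr; apply: ler_wsqrtr; exact: hn.
Qed.

(** Where the increment of d is small, an almost optimal set A for x_m + x_n
settles everything: on A the functions almost agree, and a large value of x_m
or x_n outside A could be added to A. *)
Lemma uniform_cauchy_of_increments e : 0 < e -> exists M, forall m n, (M <= m)%N -> (M <= n)%N ->
  forall g, `|x m g - x n g| <= e.
Proof.
move=> e0; pose b := e ^+ 2 / 16.
have e20 : 0 < e ^+ 2 by exact: exprn_gt0.
have b0 : 0 < b by exact: divr_gt0.
have [l hl] := small_increment b0.
have [M1 g1] := hd l.+1 b0.
have [M2 g2] := common_top_set (hd l) (@hd2 l) b0.
exists (maxn M1 M2) => m n; rewrite !geq_max => /andP[m1 m2] /andP[n1 n2] g.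
have [A [sA hA hm hn]] := g2 m n m2 n2.
apply: sqr_le_norm; first exact: ltW.
have [gA|gA] := boolP (g \in A).
  have := @mass_mem _ _ A g (sq (x m \- x n)) gA; rewrite norm_sq /= /b in hA *.
  lra.
have out k : (M1 <= k)%N -> d l - b <= mass A (sq (x k)) -> x k g ^+ 2 <= 3 * b.
  move=> k1 hk.
  have sA' : small l.+1 (g |` A)%fset.
    by rewrite /small /= cardfsU1 gA add1n ltnS.
  have := family_ub (c00_sq (cx k)) sA'; rewrite -/(top_sq _ _).
  rewrite mass_fsetU1// norm_sq.
  by have := g1 k k1; rewrite ler_norml => /andP[_ ?]; lra.
have := out m m1 hm; have := out n n1 hn.
have := @sqrD_le _ 1 (x m g) (x n g) (x m g - x n g) ltr01 (ler_normB _ _).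
by rewrite invr1 /b; lra.
Qed.

End Gap.

Lemma uniform_cauchy : inclusion_b F ->
  (exists C, forall n, family_norm (F 1%N) (x n) <= C) ->
  forall e, 0 < e -> exists M, forall m n, (M <= m)%N -> (M <= n)%N ->
    forall g, `|x m g - x n g| <= e.
Proof.
move=> hb b1 e e0; have /choice[d hd] := flat_top_sq.
apply: (@uniform_cauchy_of_increments d) => // l; first by have [] := hd l.
by have [_] := hd l.
Qed.

End UniformCauchy.

(** * Convergence in the family norms *)

Section Threshold.
Variables (R : realType) (S : finType).
Local Notation T := (branch S).
Implicit Types (x y : T -> R) (A B C G : {fset T}).

Lemma finite_positive_bound (A : {fset T}) (f : T -> R) :
  exists2 e : R, 0 < e & forall g, g \in A -> 0 < f g -> e < f g.
Proof.
suff h (r : seq T) : exists2 e : R, 0 < e & forall g, g \in r -> 0 < f g -> e < f g.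
  exact: (h (enum_fset A)).
elim: r => [|g r [e e0 IH]]; first by exists 1.
have [fg|fg] := ltP 0 (f g); last first.
  exists e => // g'; rewrite inE => /predU1P[->|]; last exact: IH.
  by rewrite ltNge fg.
exists (Num.min e (f g / 2)); first by rewrite lt_min e0 divr_gt0.
move=> g'; rewrite inE gt_min => /predU1P[-> _|/IH h /h ->//].
by apply/orP; right; lra.
Qed.

Definition away (G : {fset T}) (GF : set {fset T}) : set {fset T} :=
  [set (B `\` G)%fset | B in GF].

(** Replacing a point of C outside G by a point of G missing from C gains K times
the gap in the first term of the seminorm, which outweighs the loss of that
point in the second one. *)
Lemma tail_norm_gap (GF : set {fset T}) (l K : nat) G (w : T -> R) (v : R) :
  c00 w -> GF !=set0 -> #|` G| = l -> 0 <= v ->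
  (forall g, g \notin G -> `|w g| <= v) ->
  (forall g, g \in G -> `|w g| <= K%:R * (`|w g| - v)) ->
  tail_norm GF l K w = K%:R * mass G w + family_norm (away G GF) w.
Proof.
move=> cw ne Gl v0 wout win.
have ne' : away G GF !=set0 by have [B GB] := ne; exists (B `\` G)%fset, B.
apply/eqP; rewrite eq_le; apply/andP; split; last first.
  rewrite addrC -lerBrDr; apply: family_le => // _ [B GB <-].
  rewrite lerBrDr addrC.
  have := @tail_ub _ _ GF l K w (G, B) cw; apply => //.
  by rewrite /small /= Gl.
apply: tail_le => // C B sC GB; rewrite /tail_term /=.
have h1 : mass (B `\` C)%fset w <= mass (B `\` G)%fset w + mass (G `\` C)%fset w.
  apply: le_trans (massU _ _ _); apply: mass_sub; apply/fsubsetP => g.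
  by rewrite !inE => /andP[gC gB]; rewrite gC gB andbT /=; case: (g \in G).
have h2 : mass (B `\` G)%fset w <= family_norm (away G GF) w.
  by apply: family_ub => //; exists B.
have h3 : mass (C `\` G)%fset w <= #|` (G `\` C)%fset|%:R * v.
  rewrite (@le_trans _ _ (#|` (C `\` G)%fset|%:R * v))//.
    by apply: mass_const => g; rewrite !inE => /andP[gG _]; exact: wout.
  rewrite ler_wpM2r// ler_nat.
  rewrite -(leq_add2l #|` (C `&` G)%fset|) cardfsID fsetIC cardfsID Gl; exact: sC.
have h4 : mass (G `\` C)%fset w <=
    K%:R * mass (G `\` C)%fset w - K%:R * (#|` (G `\` C)%fset|%:R * v).
  rewrite -mulrBr (_ : #|` (G `\` C)%fset|%:R * v = \sum_(g <- (G `\` C)%fset) v); last first.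
    by rewrite big_const_seq count_predT iter_addr addr0 mulr_natl.
  rewrite /mass -sumrB mulr_sumr big_seq [leRHS]big_seq; apply: ler_sum => g.
  by rewrite !inE => /andP[_ gG]; exact: win.
rewrite (massID C G) (massID G C) (fsetIC G C) !mulrDr.
have h5 : K%:R * mass (C `\` G)%fset w <= K%:R * (#|` (G `\` C)%fset|%:R * v) by rewrite ler_wpM2l.
by move: h1 h2 h3 h4 h5; lra.
Qed.

End Threshold.

Section Step.
Variables (R : realType) (S : finType).
Local Notation T := (branch S).
Variables (F : nat -> set {fset T}) (j : nat) (x : nat -> T -> R).
Hypotheses (hF : admissible F) (ha : inclusion_a F).
Hypothesis cx : forall n, c00 (x n).
Hypothesis bounded : forall i, exists C, forall n, family_norm (F i) (x n) <= C.
Hypothesis flat_tail : forall l K, exists a,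
  flat (fun n => tail_norm (F j.+1) l K (x n))
       (fun m n => tail_norm (F j.+1) l K (x m \+ x n)) a.
Hypothesis cauchy_j : forall e, 0 < e -> exists M, forall m n, (M <= m)%N -> (M <= n)%N ->
  family_norm (F j) (x m \- x n) <= e.

Let neF i : F i !=set0. Proof. by exists fset0; exact: admissible0. Qed.

Lemma mass_cauchy e : 0 < e -> exists M, forall m n, (M <= m)%N -> (M <= n)%N ->
  forall B, F j B -> mass B (x m \- x n) <= e.
Proof.
move=> e0; have [M hM] := cauchy_j e0; exists M => m n Mm Mn B FB.
apply: le_trans (hM m n Mm Mn); apply: family_ub => //; exact: c00B.
Qed.

Lemma pointwise_cauchy e : 0 < e -> exists M, forall m n, (M <= m)%N -> (M <= n)%N ->
  forall g, `|x m g - x n g| <= e.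
Proof.
move=> e0; have [M hM] := mass_cauchy e0; exists M => m n Mm Mn g.
have := hM m n Mm Mn [fset g]%fset (admissible1 hF j g).
by rewrite mass1.
Qed.

Lemma limit_exists : exists xl : T -> R, forall e, 0 < e -> exists M, forall n, (M <= n)%N ->
  forall g, `|x n g - xl g| <= e.
Proof.
have /choice[xl hxl] : forall g, exists l, tends (fun n => x n g) l.
  move=> g; apply: cauchy_tends => e /pointwise_cauchy[M hM].
  by exists M => m n Mm Mn; exact: hM.
exists xl => e e0; have e2 : 0 < e / 2 by exact: divr_gt0.
have [M hM] := pointwise_cauchy e2; exists M => n Mn g.
have [M' hM'] := hxl g _ e2.
have := hM n (maxn M M') Mn (leq_maxl _ _) g; have := hM' _ (leq_maxr M M').
have := ler_distD (x (maxn M M') g) (x n g) (xl g).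
by lra.
Qed.

Variable xl : T -> R.
Hypothesis unif : forall e, 0 < e -> exists M, forall n, (M <= n)%N ->
  forall g, `|x n g - xl g| <= e.

Lemma mass_unif (B : {fset T}) e : 0 < e -> exists M, forall n, (M <= n)%N ->
  mass B (x n \- xl) <= e.
Proof.
move=> e0; have c0 : 0 < (#|` B|.+1%:R : R) by rewrite ltr0n.
have [M hM] := unif (divr_gt0 e0 c0); exists M => n Mn.
rewrite (@le_trans _ _ (#|` B|%:R * (e / #|` B|.+1%:R)))//.
  by apply: mass_const => g _; exact: hM.
by rewrite mulrCA ger_pMr// ler_pdivrMr// mul1r ler_nat.
Qed.

Lemma mass_conv e : 0 < e -> exists M, forall n, (M <= n)%N ->
  forall B, F j B -> mass B (x n \- xl) <= e.
Proof.
move=> e0; have e2 : 0 < e / 2 by exact: divr_gt0.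
have [M hM] := mass_cauchy e2; exists M => n Mn B FB.
have [M' hM'] := mass_unif B e2.
have := hM n (maxn M M') Mn (leq_maxl _ _) B FB; have := hM' _ (leq_maxr M M').
have := massD B (x n \- x (maxn M M')) (x (maxn M M') \- xl).
rewrite [X in mass B X <= _](_ : _ = x n \- xl); first by lra.
by apply/funext => g /=; rewrite addrA subrK.
Qed.

Lemma mass_limit_le B b : (forall n, mass B (x n) <= b) -> mass B xl <= b.
Proof.
move=> h; apply/ler_addgt0Pr => e e0; have [M /(_ M (leqnn _)) hM] := mass_unif B e0.
have := massB B (x M) (x M \- xl).
rewrite [X in mass B X <= _](_ : _ = xl).
  by have := h M; lra.
by apply/funext => g /=; rewrite opprB addrC subrK.
Qed.

(** The limit is approximated, in the norm of index j, by finitely supported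
functions. *)
Lemma small_tail_old e : 0 < e -> exists G : {fset T}, forall B, F j B ->
  mass (B `\` G)%fset xl <= e.
Proof.
move=> e0; have [M /(_ M (leqnn _)) hM] := mass_conv e0.
exists (supp (x M)) => B FB.
apply: (@le_trans _ _ (mass (B `\` supp (x M))%fset (x M \- xl))).
  apply: mass_le => g; rewrite !inE => /andP[gs _] /=.
  by rewrite (supp_out _ gs)// sub0r normrN.
by apply: hM; apply: (admissible_sub hF FB); exact: fsubsetDl.
Qed.

(** Otherwise the limit has infinitely many disjoint pieces of norm at least e
in the family of index j + 1. Their sharp numbers tend to infinity, as a piece
with sharp number at most i is a union of i sets of the family of index j, for
which the tails are small. By the inclusion condition any number of these
pieces is normed by a single set of the family of index j + 2. *)
Lemma small_tail e : 0 < e -> exists G : {fset T}, forall B, F j.+1 B ->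
  mass (B `\` G)%fset xl <= e.
Proof.
move=> e0; apply: contrapT => /forallNP h.
have /choice[b hb] : forall G, exists B, F j.+1 B /\ e < mass (B `\` G)%fset xl.
  move=> G; apply: contrapT => /forallNP h'; apply: (h G) => B FB.
  by rewrite leNgt; apply/negP => lt; apply: (h' B).
have /choice[t ht] : forall i : nat, exists G : {fset T}, forall B, F j B ->
    mass (B `\` G)%fset xl <= e / i.+2%:R.
  by move=> i; apply: small_tail_old; rewrite divr_gt0// ltr0n.
(* [U i] collects the first i pieces; the next one avoids both [U i] and a set
   [t i] beyond which the old norm of the limit is at most e / (i + 2). *)
pose piece i (U : {fset T}) := (b (U `|` t i) `\` (U `|` t i))%fset.
pose U := fix U i := if i is i'.+1 then (U i' `|` piece i' (U i'))%fset else fset0.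
pose A i := piece i (U i).
have FA i : F j.+1 (A i).
  have [FB _] := hb (U i `|` t i)%fset.
  by apply: (admissible_sub hF FB); exact: fsubsetDl.
have mA i : e < mass (A i) xl by have [_] := hb (U i `|` t i)%fset.
have At i g : g \in A i -> g \notin t i by rewrite !inE negb_or => /andP[/andP[]].
have AU i g : g \in A i -> g \notin U i by rewrite !inE negb_or => /andP[/andP[]].
have Usub i k : (i < k)%N -> (A i `<=` U k)%fset.
  elim: k => // k IH; rewrite ltnS leq_eqVlt => /predU1P[->|/IH h'].
    by rewrite /= fsubsetUr.
  by apply: fsubset_trans h' _; rewrite /= fsubsetUl.
have dA : forall i k, i != k -> (A i `&` A k)%fset = fset0.
  have h' i k : (i < k)%N -> (A i `&` A k)%fset = fset0.
    move=> ik; apply/fsetP => g; rewrite in_fset0; apply/negP.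
    rewrite inE => /andP[gi /AU /negP]; apply.
    by move/fsubsetP : (Usub _ _ ik); apply.
  move=> i k; rewrite neq_ltn => /orP[/h'//|/h'].
  by rewrite fsetIC.
have small_old i B : F j B -> (B `<=` A i)%fset -> mass B xl <= e / i.+2%:R.
  move=> FB BA; rewrite (le_trans _ (ht i B FB))//; apply: mass_sub.
  apply/fsubsetP => g gB; rewrite inE gB andbT; apply: At.
  by move/fsubsetP : BA; apply.
have ei i : e / i.+2%:R < e by rewrite ltr_pdivrMr ?ltr0n// ltr_pMr// ltr1n.
have A2 i : (2 <= #|` A i|)%N.
  rewrite leqNgt; apply/negP => /(@admissible_small _ _ hF j) FjA.
  have := small_old i _ FjA (fsubset_refl _).
  by rewrite leNgt (lt_trans (ei i) (mA i)).
have sA i : (i < sharp (A i))%N.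
  rewrite ltnNge; apply/negP => si.
  have [B [FB AB]] := admissible_union hF (FA i) (A2 i).
  have : mass (A i) xl <= i%:R * (e / i.+2%:R).
    rewrite {1}AB (le_trans (@mass_bigcup _ _ _ _ _ (e / i.+2%:R) _))//.
      move=> k; rewrite mem_iota add0n /= => ks; apply: small_old; first exact: FB.
      rewrite AB; apply/fsubsetP => g gB; apply/bigfcupP; exists k => //.
      by rewrite mem_iota add0n /= ks.
    by rewrite size_iota ler_wpM2r// ?ler_nat// ltW// divr_gt0// ltr0n.
  apply/negP; rewrite -ltNge; apply: le_lt_trans (mA i).
  by rewrite mulrCA ger_pMr// ler_pdivrMr ?ltr0n// mul1r ler_nat -addn2 leq_addr.
have sAoo : sharp (A i) @[i --> \oo] --> \oo.
  move=> P [N _ NP]; exists N => // i /= Ni; apply: NP => /=.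
  by rewrite (leq_trans Ni)// ltnW.
have [C hC] := bounded j.+2.
have [M hM] : exists M : nat, C < M%:R * e.
  by exists (Num.truncn (C / e)).+1; rewrite -ltr_pdivrMr// truncnS_gt.
have [s [ss sM Fs]] := @ha j.+1 M isT A dA (fun i => conj (FA i) (A2 i)) sAoo.
have us : uniq s by apply: (sorted_uniq _ _ ss); [exact: ltn_trans|exact: ltnn].
have := @mass_bigcup_disj _ _ s A xl e us dA (fun i _ => ltW (mA i)).
apply/negP; rewrite -ltNge sM; apply: le_lt_trans hM.
apply: mass_limit_le => n; rewrite (le_trans _ (hC n))//.
exact: family_ub.
Qed.

Section Cut.
Variables (G : {fset T}) (d : R).
Hypothesis tailG : forall B, F j.+1 B -> mass (B `\` G)%fset xl <= d.

Let rest := family_norm (R := R) (away G (F j.+1)).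

Let ne_away : away G (F j.+1) !=set0.
Proof. by exists (fset0 `\` G)%fset, fset0 => //; exact: admissible0. Qed.

(** Fix m, let the finite set H carry almost all of x_m - xl, and take n large.
A set of the new family which meets H twice has a sharp number bounded in terms
of H, hence is a bounded union of sets of the old family and does not see
x_n - xl; a set which meets H at most once does not see x_m - xl. *)
Lemma not_normed_together e M : 0 < e -> exists m n, [/\ (M <= m)%N, (M <= n)%N &
  rest (x m \+ x n) <= Num.max (rest (x m)) (rest (x n)) + d + 2 * e].
Proof.
move=> e0; have [M1 h1] := unif e0.
pose m := maxn M M1; have [Gt hGt] := small_tail e0.
pose H := (supp (x m) `|` Gt)%fset.
have mH B : F j.+1 B -> mass (B `\` H)%fset (x m \- xl) <= e.
  move=> FB; apply: le_trans (hGt B FB).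
  rewrite (@le_trans _ _ (mass (B `\` H)%fset xl))//.
    apply: mass_le => g; rewrite !inE negb_or => /andP[/andP[gs _] _].
    by rewrite /= (supp_out _ gs)// sub0r normrN.
  by apply: mass_sub; rewrite fsetDS// fsubsetUr.
have [D hD] : exists D, forall p q, p \in H -> q \in H -> (branch_dist p q <= D)%N.
  exists (\max_(p <- H) \max_(q <- H) branch_dist p q) => p q pH qH.
  by rewrite (leq_trans _ (leq_bigmax_seq _ pH _))// (leq_bigmax_seq _ qH).
have D0 : 0 < (D.+1%:R : R) by rewrite ltr0n.
have [M2 h2] := mass_conv (divr_gt0 e0 D0).
pose n := maxn M M2; exists m, n; split; [exact: leq_maxl|exact: leq_maxl|].
apply: family_le => // _ [B FB <-].
have restm : mass (B `\` G)%fset (x m) <= rest (x m) by apply: family_ub => //; exists B.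
have restn : mass (B `\` G)%fset (x n) <= rest (x n) by apply: family_ub => //; exists B.
have tB := tailG FB.
have [BH|BH] := ltnP #|` (B `&` H)%fset| 2.
- have -> : x m \+ x n = (x n \+ xl) \+ (x m \- xl).
    by apply/funext => g /=; lra.
  have k1 : mass (B `\` G)%fset (x m \- xl) <= e + e.
    rewrite (@le_trans _ _ (mass B (x m \- xl)))//.
      by apply: mass_sub; exact: fsubsetDl.
    rewrite (massID _ H) lerD ?mH//.
    rewrite (@le_trans _ _ (#|` (B `&` H)%fset|%:R * e))//.
      by apply: mass_const => g _; apply: h1; exact: leq_maxr.
    by rewrite ler_piMl ?(ltW e0)// lern1 -ltnS.
  have k2 := massD (B `\` G)%fset (x n) xl.
  have k3 := massD (B `\` G)%fset (x n \+ xl) (x m \- xl).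
  have : rest (x n) <= Num.max (rest (x m)) (rest (x n)) by rewrite le_max lexx orbT.
  by lra.
- have [p [q [pB qB pq]]] := fset_two BH.
  have {}pq' : (sharp B <= D)%N.
    move: pB qB; rewrite !in_fsetI => /andP[pB pH] /andP[qB qH].
    by apply: leq_trans (hD p q pH qH); exact: sharp_le.
  have B2 : (2 <= #|` B|)%N by apply: leq_trans BH _; apply: fsubset_leq_card; exact: fsubsetIl.
  have [Bi [FBi BBi]] := admissible_union hF FB B2.
  have -> : x m \+ x n = (x m \+ xl) \+ (x n \- xl).
    by apply/funext => g /=; lra.
  have k1 : mass (B `\` G)%fset (x n \- xl) <= e.
    rewrite (@le_trans _ _ (mass B (x n \- xl)))//.
      by apply: mass_sub; exact: fsubsetDl.
    rewrite BBi (le_trans (@mass_bigcup _ _ _ _ _ (e / D.+1%:R) _))//.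
      move=> k; rewrite mem_iota add0n /= => ks; apply: h2; last exact: FBi.
      exact: leq_maxr.
    rewrite size_iota mulrCA ger_pMr// ler_pdivrMr// mul1r ler_nat.
    exact: leqW.
  have k2 := massD (B `\` G)%fset (x m) xl.
  have k3 := massD (B `\` G)%fset (x m \+ xl) (x n \- xl).
  have : rest (x m) <= Num.max (rest (x m)) (rest (x n)) by rewrite le_max lexx.
  by lra.
Qed.

End Cut.

(** Let G consist of the points at which the limit exceeds a threshold. The gap
at the threshold lets the tail seminorm with a large factor isolate the norm of
x_n outside G, so this norm is flat, with limit a. As the parts of x_m and x_n
beyond the limit cannot be normed together, 2 a <= a + d. *)
Lemma small_rest d : 0 < d -> exists G a, a <= d /\
  tends (fun n => family_norm (away G (F j.+1)) (x n)) a.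
Proof.
move=> d0; have [G0 hG0] := small_tail d0.
have [eta eta0 heta] := finite_positive_bound G0 (fun g => `|xl g|).
have [G hG] : exists G : {fset T}, forall g, (g \in G) = (eta < `|xl g|).
  have [M /(_ M (leqnn _)) hM] := unif (divr_gt0 eta0 (ltr0Sn _ 1)).
  exists [fset g in supp (x M) | eta < `|xl g|]%fset => g; rewrite !inE /=.
  apply: andb_idl => hg; apply: suppP => //; apply/negP => /eqP xg.
  by have := hM g; rewrite xg sub0r normrN; lra.
exists G.
have tailG B : F j.+1 B -> mass (B `\` G)%fset xl <= d.
  move=> FB; apply: le_trans (hG0 B FB); rewrite (massID _ G0).
  have -> : mass ((B `\` G) `&` G0)%fset xl = 0.
    rewrite /mass big_seq big1// => g; rewrite !inE => /andP[/andP[gG _] gG0].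
    apply/eqP; rewrite normr_eq0; apply: contraNT gG => xg; rewrite hG.
    by apply: heta => //; rewrite normr_gt0.
  rewrite add0r; apply: mass_sub; apply/fsubsetP => g.
  by rewrite !inE => /and3P[-> _ ->].
have [kap kap0 hkap] := finite_positive_bound G (fun g => `|xl g| - eta).
have {}hkap g : g \in G -> eta + kap <= `|xl g|.
  by move=> gG; rewrite -lerBrDl ltW// hkap// subr_gt0 -hG.
have [C0 hC0] : exists C0, forall n g, `|x n g| <= C0.
  have [C hC] := bounded j; exists C => n g; rewrite -mass1 (le_trans _ (hC n))//.
  by apply: family_ub => //; exact: admissible1.
have [K hK] : exists K : nat, 4 * C0 <= K%:R * kap.
  exists (Num.truncn (4 * C0 / kap)).+1; rewrite -ler_pdivrMr//.
  by rewrite ltW// truncnS_gt.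
have [M1 hM1] := unif (divr_gt0 kap0 (ltr0Sn _ 3)).
pose rest := family_norm (R := R) (away G (F j.+1)).
pose tl := tail_norm (R := R) (F j.+1) #|` G| K.
have eq1 n : (M1 <= n)%N -> tl (x n) = K%:R * mass G (x n) + rest (x n).
  move=> n1; apply: (@tail_norm_gap _ _ _ _ _ _ _ (eta + kap / 4)) => //.
  - by rewrite addr_ge0 ?ltW// divr_gt0.
  - move=> g; rewrite hG -leNgt => hg.
    have := hM1 n n1 g; have := ler_distD (xl g) (x n g) 0; rewrite !subr0; lra.
  - move=> g gG.
    have h1 := hkap g gG; have h2 := hM1 n n1 g.
    have h3 := ler_distD (x n g) (xl g) 0; rewrite !subr0 distrC in h3.
    have h4 : K%:R * (kap / 2) <= K%:R * (`|x n g| - (eta + kap / 4)).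
      by rewrite ler_wpM2l//; lra.
    have := hC0 n g; have := normr_ge0 (x n g); lra.
have eq2 m n : (M1 <= m)%N -> (M1 <= n)%N ->
    tl (x m \+ x n) = K%:R * mass G (x m \+ x n) + rest (x m \+ x n).
  move=> m1 n1; apply: (@tail_norm_gap _ _ _ _ _ _ _ (2 * eta + kap / 2)) => //.
  - exact: c00D.
  - by rewrite addr_ge0 ?divr_ge0 ?mulr_ge0 ?(ltW eta0) ?(ltW kap0).
  - move=> g; rewrite hG -leNgt => hg /=.
    have h1 := hM1 n n1 g; have h2 := hM1 m m1 g.
    have h3 : `|x m g + x n g| <= `|x m g| + `|x n g| by exact: ler_normD.
    have h4 := ler_distD (xl g) (x n g) 0; have h5 := ler_distD (xl g) (x m g) 0.
    rewrite !subr0 in h4 h5; lra.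
  - move=> g gG /=.
    have h1 := hkap g gG; have h2 := hM1 n n1 g; have h2' := hM1 m m1 g.
    have h3 : 2 * `|xl g| <= `|x m g + x n g| + `|x m g - xl g| + `|x n g - xl g|.
      have -> : 2 * `|xl g| = `|(x m g + x n g) - ((x m g - xl g) + (x n g - xl g))|.
        have -> : x m g + x n g - (x m g - xl g + (x n g - xl g)) = 2 * xl g by lra.
        by rewrite normrM gtr0_norm.
      by rewrite -[leRHS]addrA (le_trans (ler_normB _ _))// lerD2l ler_normD.
    have h4 : K%:R * kap <= K%:R * (`|x m g + x n g| - (2 * eta + kap / 2)).
      by rewrite ler_wpM2l//; lra.
    have h5 : `|x m g + x n g| <= `|x m g| + `|x n g| by exact: ler_normD.
    have := hC0 n g; have := hC0 m g; have := normr_ge0 (x n g); lra.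
have [nu [fl1 fl2]] := flat_tail #|` G| K.
have massG (e : R) : 0 < e -> exists M, forall n, (M <= n)%N ->
    `|K%:R * mass G (x n) - K%:R * mass G xl| <= e.
  move=> e0; have K0 : 0 < (K.+1%:R : R) by rewrite ltr0n.
  have [M hM] := mass_unif G (divr_gt0 e0 K0); exists M => n /hM {hM} h.
  have : `|mass G (x n) - mass G xl| <= e / K.+1%:R.
    apply: le_trans h; rewrite /mass -sumrB (le_trans (ler_norm_sum _ _ _))//.
    by apply: ler_sum => g _; exact: ler_dist_dist.
  move=> h'; rewrite -mulrBr normrM ger0_norm// (@le_trans _ _ (K%:R * (e / K.+1%:R)))//; first by rewrite ler_wpM2l.
  by rewrite mulrCA ger_pMr// ler_pdivrMr// mul1r ler_nat.
pose a := nu - K%:R * mass G xl; exists a.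
have lim1 : tends (fun n => rest (x n)) a.
  move=> e e0; have e2 : 0 < e / 2 by exact: divr_gt0.
  have [N1 g1] := fl1 _ e2; have [N2 g2] := massG _ e2.
  exists (maxn M1 (maxn N1 N2)) => n; rewrite !geq_max => /and3P[n1 n2 n3].
  have := g1 n n2; have := g2 n n3; rewrite -/(tl _) (eq1 n n1).
  by rewrite /a !ler_norml => /andP[? ?] /andP[? ?]; apply/andP; split; lra.
split => //.
apply/ler_addgt0Pr => e e0; have e10 : 0 < e / 10 by exact: divr_gt0.
have [N1 g1] := lim1 _ e10; have [N2 g2] := fl2 _ e10; have [N3 g3] := massG _ e10.
have [m [n [+ + h]]] := not_normed_together tailG (maxn (maxn M1 N1) (maxn N2 N3)) e10.
rewrite !geq_max => /andP[/andP[m1 m2] /andP[m3 m4]] /andP[/andP[n1 n2] /andP[n3 n4]].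
have := g2 m n m3 n3; rewrite -/(tl _) eq2//.
have : K%:R * mass G (x m \+ x n) <= K%:R * mass G (x m) + K%:R * mass G (x n).
  by rewrite -mulrDr ler_wpM2l// massD.
have := g3 m m4; have := g3 n n4.
rewrite !ler_norml => /andP[? ?] /andP[? ?].
have : Num.max (rest (x m)) (rest (x n)) <= a + e / 10.
  rewrite ge_max; apply/andP; split.
    by have := g1 m m2; rewrite ler_norml => /andP[_ ?]; lra.
  by have := g1 n n2; rewrite ler_norml => /andP[_ ?]; lra.
by move: h; rewrite -/rest /a; lra.
Qed.

Lemma family_cauchy_step e : 0 < e -> exists M, forall m n, (M <= m)%N -> (M <= n)%N ->
  family_norm (F j.+1) (x m \- x n) <= e.
Proof.
move=> e0; have e5 : 0 < e / 5 by exact: divr_gt0.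
have [G [a [ae hrest]]] := small_rest e5.
have [M1 h1] := hrest _ e5.
have c0 : 0 < (#|` G|.+1%:R : R) by rewrite ltr0n.
have [M2 h2] := pointwise_cauchy (divr_gt0 e5 c0).
exists (maxn M1 M2) => m n; rewrite !geq_max => /andP[m1 m2] /andP[n1 n2].
apply: family_le => // B FB.
rewrite (massID B G).
have k1 : mass (B `&` G)%fset (x m \- x n) <= e / 5.
  rewrite (@le_trans _ _ (mass G (x m \- x n)))//.
    by apply: mass_sub; exact: fsubsetIr.
  rewrite (@le_trans _ _ (#|` G|%:R * (e / 5 / #|` G|.+1%:R)))//.
    by apply: mass_const => g _; exact: h2.
  by rewrite mulrCA ger_pMr// ler_pdivrMr// mul1r ler_nat.
have k2 k : mass (B `\` G)%fset (x k) <= family_norm (away G (F j.+1)) (x k).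
  by apply: family_ub => //; exists B.
have := massB (B `\` G)%fset (x m) (x n); have := k2 m; have := k2 n.
have := h1 m m1; have := h1 n n1; rewrite !ler_norml => /andP[? ?] /andP[? ?].
by lra.
Qed.

End Step.

(** Induction on the index of the family; the family of index 0 gives the
supremum norm. *)
Lemma family_cauchy (R : realType) (S : finType) (F : nat -> set {fset branch S})
    (x : nat -> branch S -> R) :
  admissible F -> inclusion_condition F -> (forall n, c00 (x n)) ->
  (forall i, exists C, forall n, family_norm (F i) (x n) <= C) ->
  (forall l, exists a, flat (fun n => top_norm l (x n)) (fun m n => top_norm l (x m \+ x n)) a) ->
  (forall j l K, exists a, flat (fun n => tail_norm (F j) l K (x n))
       (fun m n => tail_norm (F j) l K (x m \+ x n)) a) ->
  forall j e, 0 < e -> exists M, forall m n, (M <= m)%N -> (M <= n)%N ->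
    family_norm (F j) (x m \- x n) <= e.
Proof.
move=> hF [ha hb] cx bd ft ftl; elim=> [|j IH] e e0; last first.
  have [xl hxl] := limit_exists hF cx IH.
  exact: (family_cauchy_step hF ha cx bd (ftl j.+1) IH hxl).
have [M hM] := uniform_cauchy cx ft hb (bd 1%N) e0.
exists M => m n Mm Mn; apply: family_le; first by exists fset0; exact: admissible0.
have [-> _] := hF; move=> A [->|[p ->]]; first by rewrite mass0 ltW.
by rewrite mass1; exact: hM.
Qed.

(** * The Hahn-Banach theorem and weak limits *)

Section HahnBanach.
Variables (R : realType) (V : lmodType R).

Definition sublinear (p : V -> R) : Prop :=
  (forall x y, p (x + y) <= p x + p y) /\
  (forall a x, 0 <= a -> p (a *: x) = a * p x).

Lemma sublinear0 p : sublinear p -> p 0 = 0.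
Proof. by move=> [_ pZ]; rewrite -(scale0r (0 : V)) pZ// mul0r. Qed.

Lemma sublinearN p x : sublinear p -> - p (- x) <= p x.
Proof.
move=> sp; have := sublinear0 sp; have [pD _] := sp.
by have := pD x (- x); rewrite subrr => h1 h2; lra.
Qed.

Lemma inf_sublinear (I : Type) (G : set I) (h : I -> V -> R) (b : V -> R) :
  G !=set0 ->
  (forall i x, G i -> b x <= h i x) ->
  (forall i k x y, G i -> G k -> exists2 l, G l & h l (x + y) <= h i x + h k y) ->
  (forall i a x, 0 < a -> G i -> exists2 l, G l & h l (a *: x) <= a * h i x) ->
  inf [set h i 0 | i in G] = 0 ->
  sublinear (fun x => inf [set h i x | i in G]).
Proof.
move=> [i0 G0] hb hD hZ h0.
have lb i x : G i -> inf [set h i x | i in G] <= h i x.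
  move=> Gi; apply: ge_inf; last by exists i.
  by exists (b x) => _ [k Gk <-]; exact: hb.
have ge x c : (forall i, G i -> c <= h i x) -> c <= inf [set h i x | i in G].
  move=> hc; apply: lb_le_inf; first by exists (h i0 x), i0.
  by move=> _ [k Gk <-]; exact: hc.
split.
- move=> x y; rewrite -lerBlDr; apply: (ge) => i Gi.
  suff : inf [set h i (x + y) | i in G] - h i x <= inf [set h i y | i in G] by lra.
  apply: (ge) => k Gk; have [l Gl hl] := hD i k x y Gi Gk.
  by have := lb l (x + y) Gl; lra.
- have key a x : 0 < a -> inf [set h i (a *: x) | i in G] <= a * inf [set h i x | i in G].
    move=> a0; rewrite mulrC -ler_pdivrMr//; apply: ge => i Gi.
    rewrite ler_pdivrMr// mulrC; have [l Gl] := hZ i a x a0 Gi.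
    exact: le_trans (lb _ _ Gl).
  move=> a x; rewrite le_eqVlt => /predU1P[<-|a0].
    by rewrite scale0r mul0r.
  apply/eqP; rewrite eq_le key//= -ler_pdivlMl//.
  have := key a^-1 (a *: x); rewrite scalerA mulVf ?gt_eqF// scale1r.
  by apply; rewrite invr_gt0.
Qed.

(** Zorn's lemma applies because a sublinear functional below p is bounded below
by x |-> - p (- x), so that infima of chains are again sublinear. *)
Lemma minimal_sublinear (p : V -> R) : sublinear p ->
  exists h, [/\ sublinear h, forall x, h x <= p x &
    forall g, sublinear g -> (forall x, g x <= h x) -> g = h].
Proof.
move=> sp.
pose T := {h : V -> R | sublinear h /\ forall x, h x <= p x}.
pose r (s t : T) := `[< forall x, sval t x <= sval s x >].
have [//||||t ht] := @Zorn T r.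
- by move=> t; apply/asboolP.
- move=> t u v /asboolP tu /asboolP uv; apply/asboolP => x.
  exact: le_trans (uv x) (tu x).
- move=> [s hs] [t ht] /asboolP /= st /asboolP /= ts; apply: eq_exist.
  by apply/funext => x; apply/eqP; rewrite eq_le st ts.
- move=> A totA; have [A0|/forallNP A0] := pselect (exists t, A t); last first.
    by exists (exist _ p (conj sp (fun x => lexx _))) => s /A0.
  have hb (s : T) x : A s -> - p (- x) <= sval s x.
    by case: s => s [ss sle] As /=; rewrite (le_trans _ (sublinearN x ss))// lerN2.
  have sinf : sublinear (fun x => inf [set sval s x | s in A]).
    apply: (inf_sublinear (b := fun x => - p (- x))) => //.
    + move=> s t x y As At; have [st|st] := totA s t As At.
      * exists t => //; have [[tD _] _] := svalP t.
        by rewrite (le_trans (tD _ _))// lerD2r; move/asboolP : st; exact.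
      * exists s => //; have [[tD _] _] := svalP s.
        by rewrite (le_trans (tD _ _))// lerD2l; move/asboolP : st; exact.
    + by move=> s a x a0 As; exists s => //; have [[_ sZ] _] := svalP s; rewrite sZ ?(ltW a0).
    + rewrite (_ : [set _ | _ in _] = [set 0]) ?inf1//.
      apply/seteqP; split => [_ [s As <-]|_ ->] /=.
        by have [ss _] := svalP s; exact: sublinear0.
      by have [s As] := A0; exists s => //; have [ss _] := svalP s; exact: sublinear0.
  have lb (s : T) x : A s -> inf [set sval s x | s in A] <= sval s x.
    move=> As; apply: ge_inf; last by exists s.
    by exists (- p (- x)) => _ [k Ak <-]; exact: hb.
  have lep x : inf [set sval s x | s in A] <= p x.
    have [s As] := A0; apply: le_trans (lb s x As) _.
    by have [_] := svalP s; exact.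
  exists (exist (fun h => sublinear h /\ forall x, h x <= p x) _ (conj sinf lep)) => s As; apply/asboolP => x /=.
  exact: lb.
- exists (sval t); have [st tp] := svalP t; split => // g sg gt.
  have gp x : g x <= p x by exact: le_trans (gt x) (tp x).
  have := ht (exist _ g (conj sg gp)).
  by move=> /(_ (introT (asboolP _) gt)) /(congr1 sval).
Qed.

(** A minimal sublinear functional h is linear, since
x |-> inf_(t >= 0) h (x + t v) - t h v is a sublinear functional below h, hence
equal to h. *)
Theorem hahn_banach (p : V -> R) : sublinear p ->
  exists2 f : V -> R, scalar f & forall x, f x <= p x.
Proof.
move=> /minimal_sublinear[h [sh hp hmin]]; exists h => //.
have [hD hZ] := sh; have h0 := sublinear0 sh.
have sup_add x v : h x + h v <= h (x + v).
  pose k (t : R) (z : V) := h (z + t *: v) - t * h v.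
  have kb t z : 0 <= t -> - h (- z) <= k t z.
    move=> t0; have := hD (z + t *: v) (- z).
    by rewrite addrAC subrr add0r hZ// /k; lra.
  have kl z t : 0 <= t -> inf [set k t z | t in [set t : R | 0 <= t]] <= k t z.
    move=> t0; apply: ge_inf; last by exists t.
    by exists (- h (- z)) => _ [s s0 <-]; exact: kb.
  have sg : sublinear (fun z => inf [set k t z | t in [set t : R | 0 <= t]]).
    apply: (inf_sublinear (b := fun x => - h (- x))).
    - by exists 0 => /=.
    - by move=> t z t0; exact: kb.
    - move=> s t z w s0 t0; exists (s + t); first by rewrite /= addr_ge0.
      have := hD (z + s *: v) (w + t *: v); rewrite addrACA -scalerDl /k => ?.
      by rewrite mulrDl; lra.
    - move=> t a z a0 t0; exists (a * t); first by rewrite /= mulr_ge0// ltW.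
      by rewrite /k -scalerA -scalerDr hZ ?(ltW a0)// mulrBr mulrA.
    - rewrite (_ : [set _ | _ in _] = [set 0]) ?inf1//.
      apply/seteqP; split => [_ [s s0 <-]|_ ->] /=.
        by rewrite /k add0r hZ// subrr.
      by exists 0 => //=; rewrite /k add0r scale0r h0 mul0r subrr.
  have gh z : inf [set k t z | t in [set t : R | 0 <= t]] <= h z.
    by rewrite (le_trans (kl z 0 (lexx _)))// /k scale0r addr0 mul0r subr0.
  have := kl x 1 ler01; rewrite [X in X <= _ -> _](_ : _ = h x).
    by rewrite /k scale1r mul1r; lra.
  by have := hmin _ sg gh => /(congr1 (fun f => f x)).
have hadd x y : h (x + y) = h x + h y.
  by apply/eqP; rewrite eq_le hD sup_add.
have hN x : h (- x) = - h x.
  by have := hadd x (- x); rewrite subrr h0; lra.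
move=> a x y; rewrite hadd; congr (_ + _).
have [a0|a0] := leP 0 a; first exact: hZ.
by rewrite -[a in LHS]opprK scaleNr hN hZ ?oppr_ge0 ?ltW// mulNr opprK.
Qed.

End HahnBanach.

Section DualSpace.
Variables (R : realType) (V : normedModType R).

Lemma functional0 (f : V -> R) : scalar f -> f 0 = 0.
Proof.
by move=> fl; have := fl (-1) 0 0; rewrite scaler0 addr0 mulN1r addNr.
Qed.

Lemma functionalZ (f : V -> R) a x : scalar f -> f (a *: x) = a * f x.
Proof. by move=> fl; have := fl a x 0; rewrite !addr0 (functional0 fl) addr0. Qed.

Lemma functionalB (f : V -> R) x y : scalar f -> f (x - y) = f x - f y.
Proof.
by move=> fl; rewrite addrC -scaleN1r fl mulN1r addrC.
Qed.

Lemma bounded_dual (f : V -> R) (C : R) : scalar f ->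
  (forall x, `|f x| <= C * `|x|) -> dual f.
Proof.
move=> fl fC; split => // x; apply/cvgrPdist_le => e e0.
have C0 : 0 < `|C| + 1 by rewrite ltr_pwDr.
near=> y; rewrite -functionalB// (le_trans (fC _))//.
rewrite (@le_trans _ _ ((`|C| + 1) * `|x - y|))//.
  by rewrite ler_wpM2r// (le_trans (ler_norm _))// lerDl.
rewrite mulrC -ler_pdivlMr//; near: y.
by apply: cvgr_dist_le; [exact: cvg_id|exact: divr_gt0].
Unshelve. all: by end_near. Qed.

Lemma dual_bounded (f : V -> R) : dual f -> exists2 C : R, 0 <= C & forall x, `|f x| <= C * `|x|.
Proof.
move=> [fl fc].
have /cvgrPdist_le/(_ 1 ltr01) := fc 0.
rewrite (functional0 fl) => /nbhs_ballP[d /= d0 hd].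
exists (2 / d); first by rewrite divr_ge0// ltW.
move=> x; have [->|x0] := eqVneq x 0; first by rewrite (functional0 fl) !normr0 mulr0.
have nx : 0 < `|x| by rewrite normr_gt0.
pose t := d / (2 * `|x|).
have t0 : 0 < t by rewrite divr_gt0// mulr_gt0.
have := hd (t *: x); rewrite -ball_normE /= sub0r normrN normrZ gtr0_norm//.
have -> : t * `|x| = d / 2 by rewrite /t; field; rewrite gt_eqF.
move=> /(_ _); rewrite sub0r normrN functionalZ// normrM gtr0_norm// => h.
rewrite -(ler_pM2l t0) (le_trans (h _))//; first by rewrite ltr_pdivrMr// ltr_pMr// ltr1n.
rewrite mulrCA -[t * `|x|](_ : d / 2 = _); last by rewrite /t; field; rewrite gt_eqF.
suff -> : 2 / d * (d / 2) = 1 by [].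
by field; rewrite gt_eqF.
Qed.

Lemma dual_norm_le (f : V -> R) x : dual f -> `|f x| <= dual_norm f * `|x|.
Proof.
move=> df; have [C C0 hC] := dual_bounded df.
have fl : scalar f by case: df.
have [->|x0] := eqVneq x 0; first by rewrite (functional0 fl) !normr0 mulr0.
have nx : 0 < `|x| by rewrite normr_gt0.
rewrite -ler_pdivrMr//.
have := @sup_img_ub _ _ [set y : V | `|y| <= 1] (fun y => `|f y|) C (`|x|^-1 *: x).
rewrite functionalZ// normrM normfV normr_id mulrC; apply.
- by move=> y /= y1; rewrite (le_trans (hC _))// -[leRHS]mulr1 ler_wpM2l.
- by rewrite /= normrZ normfV normr_id mulVf// gt_eqF.
Qed.

(** The Hahn-Banach theorem is applied to the infimum, over the nonnegative
combinations w of the given vectors, with sum of coefficients s, of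
|z + w| - a s; taking z = - w i gives the lower bound on f (w i). *)
Lemma norming_functional (w : nat -> V) (a : R) :
  (forall (N : nat) (b : nat -> R), (forall i, 0 <= b i) ->
    a * (\sum_(i < N) b i) <= `|\sum_(i < N) b i *: w i|) ->
  exists f : V -> R, [/\ scalar f, forall x, f x <= `|x| & forall i, a <= f (w i)].
Proof.
move=> hw.
(* [K] is the cone of finitely supported nonnegative coefficients, [s b] their
   sum and [W b] the combination they define. *)
pose K := [set b : nat -> R | (forall i, 0 <= b i) /\ exists N, forall i, (N <= i)%N -> b i = 0].
have KN (b : nat -> R) : K b -> exists N, forall M, (N <= M)%N ->
    \sum_(i < M) b i = \sum_(i < N) b i /\ \sum_(i < M) b i *: w i = \sum_(i < N) b i *: w i.
  move=> [_ [N hN]]; exists N => M NM; split.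
  - rewrite [RHS](big_ord_widen _ (fun i => b i) NM) [RHS]big_mkcond /=.
    by apply: eq_bigr => i _; case: ifPn => //; rewrite -leqNgt => /hN.
  - rewrite [RHS](big_ord_widen _ (fun i => b i *: w i) NM) [RHS]big_mkcond /=.
    by apply: eq_bigr => i _; case: ifPn => //; rewrite -leqNgt => /hN ->; rewrite scale0r.
have /choice[sz hsz] : forall b : nat -> R, exists N, K b -> forall M, (N <= M)%N ->
    \sum_(i < M) b i = \sum_(i < N) b i /\ \sum_(i < M) b i *: w i = \sum_(i < N) b i *: w i.
  move=> b; have [Kb|nKb] := pselect (K b); last by exists 0%N.
  by have [N hN] := KN b Kb; exists N.
pose s (b : nat -> R) := \sum_(i < sz b) b i.
pose W (b : nat -> R) := \sum_(i < sz b) b i *: w i.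
have sE b M : K b -> (sz b <= M)%N -> s b = \sum_(i < M) b i.
  by move=> Kb h; have [] := hsz b Kb M h.
have WE b M : K b -> (sz b <= M)%N -> W b = \sum_(i < M) b i *: w i.
  by move=> Kb h; have [] := hsz b Kb M h.
have KD b c : K b -> K c -> [/\ K (b \+ c), s (b \+ c) = s b + s c & W (b \+ c) = W b + W c].
  move=> Kb Kc.
  have Kbc : K (b \+ c).
    have [b0 [N hN]] := Kb; have [c0 [M hM]] := Kc.
    split; first by move=> i; rewrite addr_ge0.
    exists (maxn N M) => i; rewrite geq_max => /andP[/hN Hb /hM Hc].
    by rewrite /= Hb Hc addr0.
  pose M := maxn (sz (b \+ c)) (maxn (sz b) (sz c)).
  have [h1 h2 h3] : [/\ (sz (b \+ c) <= M)%N, (sz b <= M)%N & (sz c <= M)%N].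
    by split; rewrite /M !leq_max leqnn ?orbT.
  split => //.
    by rewrite (sE _ M)// (sE _ M Kb)// (sE _ M Kc)// -big_split.
  rewrite (WE _ M)// (WE _ M Kb)// (WE _ M Kc)// -big_split /=.
  by apply: eq_bigr => i _; rewrite scalerDl.
have KZ t b : 0 <= t -> K b -> [/\ K (t \*o b), s (t \*o b) = t * s b & W (t \*o b) = t *: W b].
  move=> t0 Kb.
  have Kbc : K (t \*o b).
    have [b0 [N hN]] := Kb.
    split; first by move=> i; rewrite mulr_ge0.
    by exists N => i /hN Hb; rewrite /= Hb mulr0.
  pose M := maxn (sz (t \*o b)) (sz b).
  have [h1 h2] : (sz (t \*o b) <= M)%N /\ (sz b <= M)%N.
    by split; rewrite /M !leq_max leqnn ?orbT.
  split => //.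
    by rewrite (sE _ M)// (sE _ M Kb)// mulr_sumr.
  rewrite (WE _ M)// (WE _ M Kb)// scaler_sumr /=.
  by apply: eq_bigr => i _; rewrite scalerA.
have K0 : K (fun=> 0) by split => //; exists 0%N.
have s0 : s (fun=> 0) = 0 by rewrite /s big1.
have W0 : W (fun=> 0) = 0 by rewrite /W big1// => i _; rewrite scale0r.
pose g b z := `|z + W b| - a * s b.
have gb b z : K b -> - `|z| <= g b z.
  move=> [b0 _]; rewrite /g; have := hw (sz b) b b0; rewrite -/(s b) -/(W b) => h.
  have := ler_normB (z + W b) z; rewrite [z + W b]addrC addrK; lra.
have sg : sublinear (fun z => inf [set g b z | b in K]).
  apply: (inf_sublinear (b := fun z => - `|z|)).
  - by exists (fun=> 0).
  - by move=> b z; exact: gb.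
  - move=> b c z v Kb Kc; have [Kbc sbc Wbc] := KD b c Kb Kc.
    exists (b \+ c) => //; rewrite /g sbc Wbc.
    have := ler_normD (z + W b) (v + W c); rewrite addrACA; lra.
  - move=> b t z t0 Kb; have [Ktb stb Wtb] := KZ t b (ltW t0) Kb.
    exists (t \*o b) => //.
    by rewrite /g stb Wtb -scalerDr normrZ gtr0_norm// mulrBr mulrCA.
  - apply/eqP; rewrite eq_le; apply/andP; split.
      apply: (@le_trans _ _ (g (fun=> 0) 0)).
        apply: ge_inf; last by exists (fun=> 0).
        by exists (- `|0 : V|) => _ [b Kb <-]; exact: gb.
      by rewrite /g s0 W0 addr0 normr0 mulr0 subr0.
    apply: lb_le_inf; first by exists (g (fun=> 0) 0), (fun=> 0).
    by move=> _ [b Kb <-]; have := gb b 0 Kb; rewrite normr0 oppr0.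
have [f fl fg] := hahn_banach sg.
have fgb z b : K b -> f z <= g b z.
  move=> Kb; apply: (le_trans (fg z)); apply: ge_inf; last by exists b.
  by exists (- `|z|) => _ [c Kc <-]; exact: gb.
exists f; split => //.
  by move=> z; have := fgb z _ K0; rewrite /g W0 s0 addr0 mulr0 subr0.
move=> i.
pose b := fun k => (k == i)%:R : R.
have Kb : K b.
  by split => [k|]; [rewrite /b ler0n|exists i.+1 => k ik; rewrite /b gtn_eqF].
pose M := maxn (sz b) i.+1; have iM : (i < M)%N by rewrite leq_max leqnn orbT.
have := fgb (- w i) b Kb; rewrite /g (WE b M) ?leq_maxl// (sE b M) ?leq_maxl//.
rewrite (bigD1 (Ordinal iM))//= big1 ?addr0; last first.
  by move=> k; rewrite -val_eqE /= => /negbTE ki; rewrite /b ki scale0r.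
rewrite (bigD1 (Ordinal iM))//= big1 ?addr0; last first.
  by move=> k; rewrite -val_eqE /= => /negbTE ki; rewrite /b ki.
rewrite /b eqxx scale1r addNr normr0 mulr1 sub0r.
by rewrite -scaleN1r functionalZ// mulN1r lerN2.
Qed.

Hypothesis hV : reflexive_space V.

(** The limit along an ultrafilter of the evaluations at y n is an element of the
bidual. *)
Lemma weak_limit (y : nat -> V) (C : R) : (forall n, `|y n| <= C) ->
  exists z, (forall f a, dual f -> tends (fun n => f (y n)) a -> f z = a) /\
    (forall f a, dual f -> (forall n, a <= f (y n)) -> a <= f z).
Proof.
move=> yC.
have [U [UU sU]] := @ultraFilterLemma nat \oo _.
have C0 : 0 <= C by exact: le_trans (normr_ge0 _) (yC 0%N).
have fC f n : dual f -> `|f (y n)| <= dual_norm f * C.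
  move=> df; rewrite (le_trans (dual_norm_le _ df))// ler_wpM2l//.
  have := dual_norm_le (y n) df.
  rewrite /dual_norm; have [B B0 hB] := dual_bounded df.
  move=> _; apply: (le_trans (normr_ge0 (f 0))).
  apply: (@sup_img_ub _ _ [set y : V | `|y| <= 1] (fun y => `|f y|) B); last by rewrite /= normr0.
  by move=> v /= v1; rewrite (le_trans (hB _))// -[leRHS]mulr1 ler_wpM2l.
have /choice[phi hphi] : forall f : V -> R, exists l : R, dual f -> f (y n) @[n --> U] --> l.
  move=> f; have [df|ndf] := pselect (dual f); last by exists 0.
  have cpt : compact `[- (dual_norm f * C), dual_norm f * C].
    exact: segment_compact.
  have [|l [_ hl]] := cpt ((fun n => f (y n)) @ U) _.
    apply: (@filterS _ U _ setT) => [n _|]; last exact: filterT.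
    by rewrite /= in_itv /= -ler_norml; exact: fC.
  exists l => _ B lB.
  have [//|nB] := in_ultra_setVsetC ((fun n => f (y n)) @^-1` B) UU.
  by have [v [nBv Bv]] := hl (~` B) B nB lB.
have hphi_near f e : dual f -> 0 < e -> exists n, `|phi f - f (y n)| <= e.
  move=> df e0; have /cvgrPdist_le/(_ e e0) := hphi f df.
  exact: filter_ex.
have bphi : bidual phi.
  split.
  - move=> a f g df dg.
    have dfg : dual (fun v => a * f v + g v).
      have [A A0 hA] := dual_bounded df; have [B B0 hB] := dual_bounded dg.
      have [fl _] := df; have [gl _] := dg.
      apply: (bounded_dual (C := `|a| * A + B)).
        by move=> t u v; rewrite fl gl; lra.
      move=> v; rewrite (le_trans (ler_normD _ _))// mulrDl lerD//.
      by rewrite normrM -mulrA ler_wpM2l.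
    apply: (@cvg_unique _ (@Rhausdorff R) (fmap (fun n => a * f (y n) + g (y n)) U)).
      exact: hphi _ dfg.
    by apply: cvgD (hphi _ dg); apply: cvgMr; exact: hphi _ df.
  - exists C => f df; rewrite mulrC.
    apply/ler_addgt0Pr => e e0; have [n hn] := hphi_near f e df e0.
    by have := fC f n df; have := ler_distD (f (y n)) (phi f) 0; rewrite !subr0; lra.
have [z hz] := hV bphi.
exists z; split.
- move=> f a df ta; rewrite -hz//.
  apply: (@cvg_unique _ (@Rhausdorff R) (fmap (fun n => f (y n)) U)); first exact: hphi.
  apply: cvg_trans; first by apply: cvg_app; exact: sU.
  by apply/cvgrPdist_le => e /ta[M hM]; exists M => // n /hM; rewrite distrC.
- move=> f a df hf; rewrite -hz//.
  apply/ler_addgt0Pr => e e0; have [n] := hphi_near f e df e0.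
  by have := hf n; rewrite ler_norml => ? /andP[? ?]; lra.
Qed.

End DualSpace.

(** * Unconditional bases *)

Section Basis.
Variables (R : realType) (Y : completeNormedModType R) (e : nat -> Y).
Hypotheses (he : schauder_basis e) (he1 : forall j, `|e j| = 1).
Hypothesis heu : unconditional1 (fun y : Y => `|y|) e.

Definition coef (y : Y) : nat -> R := sval (cid (he y)).

Lemma coef_cvg y : series (fun j => coef y j *: e j) @ \oo --> y.
Proof. by rewrite /coef; case: cid => a []. Qed.

Lemma coef_unique y a : series (fun j => a j *: e j) @ \oo --> y -> coef y = a.
Proof. by rewrite /coef; case: cid => b /= [_ hb] /hb. Qed.

Lemma eq_coef u v : coef u =1 coef v -> u = v.
Proof.
move=> /funext uv; apply: (@cvg_unique _ (@norm_hausdorff _ Y) (series (fun j => coef u j *: e j) @ \oo)).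
  exact: coef_cvg.
by rewrite uv; exact: coef_cvg.
Qed.

Lemma coefD u v j : coef (u + v) j = coef u j + coef v j.
Proof.
rewrite (@coef_unique (u + v) (coef u \+ coef v))//.
rewrite (_ : series _ = series (fun j => coef u j *: e j) \+ series (fun j => coef v j *: e j)).
  by apply: cvgD; exact: coef_cvg.
apply/funext => n; rewrite /series /= -big_split /=.
by apply: eq_bigr => i _; rewrite scalerDl.
Qed.

Lemma coefZ a u j : coef (a *: u) j = a * coef u j.
Proof.
rewrite (@coef_unique (a *: u) (a \*o coef u))//.
rewrite (_ : series _ = a \*: series (fun j => coef u j *: e j)).
  by apply: cvgZr; exact: coef_cvg.
apply/funext => n; rewrite /series /= scaler_sumr /=.
by apply: eq_bigr => i _; rewrite scalerA.
Qed.

Lemma coef0 j : coef 0 j = 0.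
Proof. by rewrite -(scale0r (0 : Y)) coefZ mul0r. Qed.

Lemma coef_scalar j : scalar (coef^~ j).
Proof. by move=> a u v; rewrite coefD coefZ. Qed.

Lemma coefB u v j : coef (u - v) j = coef u j - coef v j.
Proof. by rewrite -scaleN1r coefD coefZ mulN1r. Qed.

Lemma coef_sum (n : nat) (a : nat -> R) j :
  coef (\sum_(0 <= i < n) a i *: e i) j = if (j < n)%N then a j else 0.
Proof.
rewrite (@coef_unique _ (fun j => if (j < n)%N then a j else 0))//.
apply: cvg_near_cst; exists n => // m /= nm; rewrite /series /=.
rewrite (big_cat_nat (n := n))//=.
have -> : \sum_(n <= i < m) (if (i < n)%N then a i else 0) *: e i = 0.
  by rewrite big_nat_cond big1// => i /andP[/andP[ni _] _]; rewrite ltnNge ni scale0r.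
by rewrite addr0; apply: eq_big_nat => i /andP[_ ->].
Qed.

Definition psum n (a : nat -> R) : R := `|\sum_(0 <= j < n) a j *: e j|.

Lemma psum_sign n a (s : nat -> bool) :
  psum n (fun j => (-1) ^+ s j * a j) <= psum n a.
Proof.
pose A := [fset i in iota 0 n]%fset.
have AE (f : nat -> Y) : \sum_(i <- A) f i = \sum_(0 <= i < n) f i.
  apply: perm_big; apply: uniq_perm; [exact: fset_uniq|exact: iota_uniq|].
  by move=> i; rewrite !inE /= mem_index_iota mem_iota.
by have := heu A a s; rewrite !AE.
Qed.

(** Changing one coefficient a to c, with |c| <= |a|, amounts to a convex
combination of keeping it and changing its sign. *)
Lemma psum_one n a i c : `|c| <= `|a i| ->
  psum n (fun j => if j == i then c else a j) <= psum n a.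
Proof.
move=> ca; have [a0|a0] := eqVneq (a i) 0.
  rewrite (_ : (fun j => _) = a)//; apply/funext => j; case: eqP => // ->.
  by apply/eqP; move: ca; rewrite a0 normr0 normr_le0.
pose t := c / a i.
have t1 : `|t| <= 1 by rewrite normrM normfV ler_pdivrMr ?normr_gt0// mul1r.
pose a' j := (-1) ^+ (j == i) * a j.
have h := psum_sign n a (fun j => j == i).
rewrite -/a' in h.
have -> : psum n (fun j => if j == i then c else a j) =
    `|((1 + t) / 2) *: (\sum_(0 <= j < n) a j *: e j) +
      ((1 - t) / 2) *: (\sum_(0 <= j < n) a' j *: e j)|.
  rewrite /psum !scaler_sumr -big_split /=; congr `|_|; apply: eq_bigr => j _.
  rewrite !scalerA -scalerDl; congr (_ *: _); rewrite /a'.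
  case: eqP => [->|_]; last by rewrite expr0; field.
  by rewrite expr1 /t; field.
move: t1; rewrite ler_norml => /andP[t1 t2].
have pos (s : R) (u : Y) : 0 <= s -> `|s *: u| = s * `|u|.
  by move=> s0; rewrite normrZ ger0_norm.
apply: (le_trans (ler_normD _ _)); rewrite !pos; [|lra|lra].
rewrite -!/(psum n _).
have k1 : (1 - t) / 2 * psum n a' <= (1 - t) / 2 * psum n a by rewrite ler_wpM2l//; lra.
by move: k1; lra.
Qed.

Lemma psum_mono n a b : (forall j, `|b j| <= `|a j|) -> psum n b <= psum n a.
Proof.
move=> ba; pose h k j := if (j < k)%N then b j else a j.
suff hk k : psum n (h k) <= psum n a.
  rewrite (_ : psum n b = psum n (h n))//; congr `|_|.
  by apply: eq_big_nat => j /andP[_ jn]; rewrite /h jn.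
elim: k => [|k IH]; first by rewrite (_ : h 0%N = a).
apply: le_trans IH; rewrite (_ : h k.+1 = fun j => if j == k then b k else h k j).
  by apply: psum_one; rewrite /h ltnn.
apply/funext => j; rewrite /h ltnS leq_eqVlt.
by have [->|] := eqVneq j k.
Qed.

Lemma norm_mono u v : (forall j, `|coef u j| <= `|coef v j|) -> `|u| <= `|v|.
Proof.
move=> uv.
have cn y : psum n (coef y) @[n --> \oo] --> `|y|.
  by apply: cvg_norm; exact: coef_cvg.
apply: (@ler_cvg_to _ _ _ _ _ _ _ _ (cn u) (cn v)); exists 0%N => // n _.
exact: psum_mono.
Qed.

Lemma norm_mono_twist u v r (a b : R) : (forall j, 0 <= coef u j) ->
  (forall j, coef u j <= coef v j) -> (forall j, 0 <= coef r j) -> 0 <= a -> a <= b ->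
  `|u + a *: r| <= `|v + b *: r|.
Proof.
move=> u0 uv r0 a0 ab; apply: norm_mono => j; rewrite !coefD !coefZ.
have b0 : 0 <= b by exact: le_trans ab.
have v0 : 0 <= coef v j by exact: le_trans (uv j).
by rewrite !ger0_norm ?addr_ge0 ?mulr_ge0// lerD// ler_wpM2r.
Qed.

Lemma norm_mono_ge0 u v : (forall j, 0 <= coef u j) ->
  (forall j, coef u j <= coef v j) -> `|u| <= `|v|.
Proof.
move=> u0 uv; apply: norm_mono => j.
by rewrite !ger0_norm// (le_trans (u0 j)).
Qed.

Lemma coef_basis i : coef (e i) = fun j => (j == i)%:R.
Proof.
apply: coef_unique; apply: cvg_near_cst; exists i.+1 => // n /= ni.
rewrite /series /= (bigD1_seq i)/= ?mem_index_iota ?iota_uniq ?ni//.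
rewrite eqxx scale1r big1 ?addr0// => j ji.
by rewrite (negbTE ji) scale0r.
Qed.

Lemma coef_le y j : `|coef y j| <= `|y|.
Proof.
rewrite -[leLHS]mulr1 -(he1 j) -normrZ; apply: norm_mono => i.
rewrite coefZ coef_basis; have [->|_] := eqVneq i j; first by rewrite mulr1.
by rewrite mulr0 normr0.
Qed.

Lemma coef_dual j : dual (coef^~ j).
Proof.
apply: (bounded_dual (C := 1)); first exact: coef_scalar.
by move=> y; rewrite mul1r coef_le.
Qed.

Definition basis_tail k (y : Y) : Y := y - \sum_(0 <= j < k) coef y j *: e j.

Lemma coef_basis_tail k y j : coef (basis_tail k y) j = if (j < k)%N then 0 else coef y j.
Proof.
rewrite coefB coef_sum; case: ifP => _; first by rewrite subrr.
by rewrite subr0.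
Qed.

Lemma basis_tail_le k y : `|basis_tail k y| <= `|y|.
Proof.
by apply: norm_mono => j; rewrite coef_basis_tail; case: ifP; rewrite ?normr0.
Qed.

Lemma basis_tail_small y d : 0 < d -> exists k, `|basis_tail k y| <= d.
Proof.
move=> d0; have /cvgrPdist_le/(_ d d0)[k _ /(_ k (leqnn _))] := @coef_cvg y.
by exists k.
Qed.

Lemma norm_le_basis_tail y k : `|y| <= \sum_(0 <= j < k) `|coef y j| + `|basis_tail k y|.
Proof.
rewrite -{1}(subrK (\sum_(0 <= j < k) coef y j *: e j) y) addrC.
rewrite (le_trans (ler_normD _ _))// lerD2r (le_trans (ler_norm_sum _ _ _))//.
by apply: ler_sum => j _; rewrite normrZ he1 mulr1.
Qed.

Lemma coef_lim (a : nat -> R) (C : R) : (forall j, `|a j| <= C * 2 ^- j) ->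
  coef (limn (series (fun j => a j *: e j))) = a.
Proof.
move=> aC; apply: coef_unique; apply: normed_cvg.
apply: (@series_le_cvg _ _ (geometric C 2^-1)).
- by move=> n /=.
- move=> n; rewrite /geometric /=; have := aC n; have := normr_ge0 (a n).
  by rewrite exprVn; exact: le_trans.
- by move=> n; rewrite /= normrZ he1 mulr1 exprVn.
- apply: is_cvg_geometric_series; rewrite gtr0_norm ?invr_gt0//.
  by rewrite invf_lt1// ltr1n.
Qed.

Definition ratvec (s : seq rat) : Y :=
  \sum_(0 <= i < size s) `|ratr (nth 0 s i)| *: e i.

Lemma ratvec_ge0 s j : 0 <= coef (ratvec s) j.
Proof. by rewrite /ratvec (coef_sum _ (fun i => `|ratr (nth 0 s i)|)); case: ifP. Qed.

Lemma ratvec_nil : ratvec [::] = 0.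
Proof. by rewrite /ratvec big_geq. Qed.

Lemma ratvec_dense c d : (forall j, 0 <= coef c j) -> 0 < d ->
  exists s, `|c - ratvec s| <= d.
Proof.
move=> c0 d0; have d2 : 0 < d / 2 by exact: divr_gt0.
have [k hk] := basis_tail_small c d2.
have dk : 0 < d / 2 / k.+1%:R by rewrite divr_gt0// ltr0n.
have /choice[r hr] : forall i, exists r : rat, `|coef c i - `|ratr r| | <= d / 2 / k.+1%:R.
  move=> i; have := @rat_in_itvoo R (coef c i) (coef c i + d / 2 / k.+1%:R).
  rewrite ltrDl dk => /(_ isT)[r]; rewrite in_itv /= => /andP[r1 r2]; exists r.
  have r0 : 0 <= ratr r :> R by rewrite (le_trans (c0 i))// ltW.
  by rewrite (ger0_norm r0) distrC ger0_norm ?subr_ge0 ?ltW// ltrBlDl.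
exists (mkseq r k).
have -> : ratvec (mkseq r k) = \sum_(0 <= i < k) `|ratr (r i)| *: e i.
  rewrite /ratvec size_mkseq; apply: eq_big_nat => i /andP[_ ik].
  by rewrite nth_mkseq.
have -> : c - \sum_(0 <= i < k) `|ratr (r i)| *: e i =
    basis_tail k c + \sum_(0 <= i < k) (coef c i - `|ratr (r i)|) *: e i.
  under [X in _ = _ + X]eq_bigr do rewrite scalerBl.
  by rewrite sumrB /basis_tail addrA subrK.
rewrite (le_trans (ler_normD _ _))// [leRHS]splitr lerD//.
rewrite (le_trans (ler_norm_sum _ _ _))//.
apply: (@le_trans _ _ (\sum_(0 <= i < k) d / 2 / k.+1%:R)).
  by apply: ler_sum => i _; rewrite normrZ he1 mulr1 hr.
rewrite sumr_const_nat subn0 -[leLHS]mulr_natl mulrCA ger_pMr//.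
by rewrite ler_pdivrMr ?ltr0n// mul1r ler_nat.
Qed.

End Basis.

(** * Norms of weak limits of flat sequences *)

Section Selection.
Variables (R : realType) (V : normedModType R) (y : nat -> V) (C : R).
Variable P : set V.
Hypotheses (P0 : P 0) (PD : forall u v, P u -> P v -> P (u + v)).
Hypotheses (PZ : forall (a : R) u, 0 <= a -> P u -> P (a *: u)) (Py : forall n, P (y n)).
Hypothesis yC : forall n, `|y n| <= C.
Hypothesis flat_y : forall c, P c -> exists B,
  flat (fun n => `|y n + c|) (fun m n => `|y m + y n + 2 *: c|) B.

Let C0 : 0 <= C. Proof. exact: le_trans (normr_ge0 _) (yC 0%N). Qed.

(** In the terminology of Banach space theory, q is the type of the sequence. *)
Lemma type_exists : exists q : V -> R -> R, forall c s, P c -> 0 <= s ->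
  tends (fun n => `|c + s *: y n|) (q c s).
Proof.
suff h c s : P c -> 0 <= s -> exists l, tends (fun n => `|c + s *: y n|) l.
  have /choice[q hq] : forall cs : V * R, exists l,
      P cs.1 -> 0 <= cs.2 -> tends (fun n => `|cs.1 + cs.2 *: y n|) l.
    move=> [c s]; have [[Pc s0]|n] := pselect (P c /\ 0 <= s).
      by have [l hl] := h c s Pc s0; exists l.
    by exists 0 => Pc s0; case: n.
  by exists (fun c s => q (c, s)) => c s Pc s0; exact: (hq (c, s)).
move=> Pc; rewrite le_eqVlt => /predU1P[<-|s0].
  exists `|c| => e e0; exists 0%N => n _.
  by rewrite scale0r addr0 subrr normr0 ltW.
have [|B [hB _]] := @flat_y (s^-1 *: c); first by apply: PZ => //; rewrite invr_ge0 ltW.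
exists (s * B) => e e0; have [M hM] := hB (e / s) (divr_gt0 e0 s0).
exists M => n /hM; have -> : c + s *: y n = s *: (y n + s^-1 *: c).
  by rewrite scalerDr scalerA divff ?gt_eqF// scale1r addrC.
by rewrite normrZ gtr0_norm// -mulrBr normrM gtr0_norm// ler_pdivlMr// mulrC.
Qed.

Variable q : V -> R -> R.
Hypothesis hq : forall c s, P c -> 0 <= s -> tends (fun n => `|c + s *: y n|) (q c s).

Lemma type0 c : P c -> q c 0 = `|c|.
Proof.
move=> Pc; have h := hq Pc (lexx 0).
apply/eqP; rewrite eq_le; apply/andP; split.
  by apply: (tends_le h) => n; rewrite scale0r addr0.
by apply: (tends_ge h) => n; rewrite scale0r addr0.
Qed.

Lemma typeZ c s (a : R) : P c -> 0 <= s -> 0 <= a -> q (a *: c) (a * s) = a * q c s.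
Proof.
move=> Pc s0 a0; have h1 := hq Pc s0; have h2 := hq (PZ a0 Pc) (mulr_ge0 a0 s0).
have E n : `|a *: c + (a * s) *: y n| = a * `|c + s *: y n|.
  by rewrite -scalerA -scalerDr normrZ ger0_norm.
apply/eqP; rewrite -subr_eq0 -normr_le0; apply/ler_addgt0Pr => e e0; rewrite add0r.
have a1 : 0 < a + 1 by rewrite ltr_wpDl.
have e2 : 0 < e / 2 / (a + 1) by rewrite !divr_gt0.
have [M1 g1] := h1 _ e2; have [M2 g2] := h2 _ (divr_gt0 e0 (ltr0Sn _ 1)).
pose n := maxn M1 M2.
have k2 := g2 n (leq_maxr _ _); rewrite E in k2.
have k1 : `|a * `|c + s *: y n| - a * q c s| <= e / 2.
  rewrite -mulrBr normrM (ger0_norm a0) (@le_trans _ _ (a * (e / 2 / (a + 1))))//.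
    by rewrite ler_wpM2l// g1// leq_maxl.
  by rewrite mulrCA ger_pMr ?divr_gt0// ler_pdivrMr// mul1r lerDl.
rewrite (le_trans (ler_distD (a * `|c + s *: y n|) _ _))//.
by rewrite distrC in k2; lra.
Qed.

Lemma type_lip c c' s s' : P c -> P c' -> 0 <= s -> 0 <= s' ->
  q c s <= q c' s' + `|c - c'| + C * `|s - s'|.
Proof.
move=> Pc Pc' s0 s'0; apply/ler_addgt0Pr => e e0.
have e2 : 0 < e / 2 by exact: divr_gt0.
have [M1 g1] := hq Pc s0 e2; have [M2 g2] := hq Pc' s'0 e2.
pose n := maxn M1 M2.
have := g1 n (leq_maxl _ _); have := g2 n (leq_maxr _ _).
rewrite !ler_norml => /andP[_ k2] /andP[k1 _].
have : `|c + s *: y n| <= `|c' + s' *: y n| + (`|c - c'| + `|s - s'| * C).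
  rewrite -lerBlDl (le_trans (lerB_dist _ _))//.
  rewrite opprD addrACA -scalerBl (le_trans (ler_normD _ _))// lerD2l normrZ.
  by rewrite ler_wpM2l.
by rewrite mulrC; lra.
Qed.

(** Flatness says that the midpoint of y_m and y_n is almost extremal over c.
Exchanging the weights of y_m and y_n in a convex combination gives its mirror
image in the midpoint; as no combination exceeds the limit norm, the combination
and its mirror image must both almost attain it. *)
Lemma type_step c s t e : P c -> 0 <= s -> 0 <= t -> 0 < e ->
  exists M, forall m, (M <= m)%N -> q c (s + t) - e <= q (c + t *: y m) s.
Proof.
move=> Pc s0 t0 e0.
have [st0|st0] := eqVneq (s + t) 0.
  have [sE tE] : s = 0 /\ t = 0 by split; lra.
  exists 0%N => m _; rewrite tE scale0r !addr0 sE; lra.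
have {st0}st : 0 < s + t by rewrite lt_neqAle eq_sym st0 addr_ge0.
pose S := s + t.
pose c' := S^-1 *: c.
have Pc' : P c' by apply: PZ => //; rewrite invr_ge0 ltW.
have [B [hB1 hB2]] := flat_y Pc'.
have qB : q c S = S * B.
  have -> : q c S = q (S *: c') (S * 1).
    by rewrite mulr1 scalerA divff ?gt_eqF// scale1r.
  rewrite typeZ ?ltW//; congr (_ * _); apply/eqP; rewrite eq_le.
  have h1 := hq Pc' ler01.
  apply/andP; split; apply/ler_addgt0Pr => d d0;
    have [M1 g1] := hB1 _ (divr_gt0 d0 (ltr0Sn _ 1));
    have [M2 g2] := h1 _ (divr_gt0 d0 (ltr0Sn _ 1));
    have := g1 _ (leq_maxl M1 M2); have := g2 _ (leq_maxr M1 M2);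
    rewrite scale1r [c' + _]addrC !ler_norml => /andP[? ?] /andP[? ?]; lra.
pose d := e / (2 * S).
have d0 : 0 < d by rewrite divr_gt0// mulr_gt0.
have dE : S * (2 * d) = e by rewrite /d; field; rewrite gt_eqF.
have [M1 g1] := hB1 d d0; have [M2 g2] := hB2 d d0.
exists (maxn M1 M2) => m; rewrite geq_max => /andP[m1 m2].
apply: (@le_trans _ _ (S * (B - 2 * d))).
  by rewrite mulrBr dE -/S qB.
have hm : forall n, (maxn M1 M2 <= n)%N -> S * (B - 2 * d) <= `|c + t *: y m + s *: y n|.
  move=> n; rewrite geq_max => /andP[n1 n2].
  pose a := t / S; have a0 : 0 <= a by rewrite divr_ge0// ltW.
  have sE : s / S = 1 - a by rewrite /a /S; field; rewrite gt_eqF.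
  have a1 : 0 <= 1 - a by rewrite -sE divr_ge0// ltW.
  pose u := c' + a *: y m + (1 - a) *: y n.
  have -> : c + t *: y m + s *: y n = S *: u.
    rewrite /u -sE /a !scalerDr !scalerA divff ?gt_eqF// scale1r.
    by rewrite mulrCA divff ?gt_eqF// mulr1 mulrCA divff ?gt_eqF// mulr1.
  rewrite normrZ (gtr0_norm st) ler_pM2l//.
  pose v := c' + (1 - a) *: y m + a *: y n.
  have uv : u + v = y m + y n + 2 *: c'.
    rewrite /u /v !scalerBl !scale1r addrACA subrK addrACA addrC.
    by rewrite [a *: y m + _]addrC subrK [_ + y m]addrC addrA [y n + _]addrC scaler_nat mulr2n.
  have hv : `|v| <= B + d.
    have -> : v = a *: (y n + c') + (1 - a) *: (y m + c').
      rewrite !scalerDr addrACA -[a *: c' + _]scalerDl [a + _]addrC subrK scale1r.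
      by rewrite /v addrC addrA addrAC.
    have pos (r : R) (w : V) : 0 <= r -> `|r *: w| = r * `|w|.
      by move=> r0; rewrite normrZ ger0_norm.
    apply: (le_trans (ler_normD _ _)); rewrite !pos//.
    have := g1 m m1; have := g1 n n1; rewrite !ler_norml => /andP[_ k1] /andP[_ k2].
    have l1 : a * `|y n + c'| <= a * (B + d) by rewrite ler_wpM2l//; lra.
    have l2 : (1 - a) * `|y m + c'| <= (1 - a) * (B + d) by rewrite ler_wpM2l//; lra.
    by lra.
  have := g2 m n m2 n2; rewrite -uv; have := ler_normD u v; lra.
apply/ler_addgt0Pr => r r0.
have Pt : P (c + t *: y m) by apply: PD => //; exact: PZ.
have [M3 g3] := hq Pt s0 r0.
have := hm _ (leq_maxl (maxn M1 M2) M3); have := g3 _ (leq_maxr (maxn M1 M2) M3).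
by rewrite ler_norml => /andP[_ ?]; lra.
Qed.

(** The type is Lipschitz, so the pointwise estimate is uniform on compact
sets. *)
Lemma type_step_uniform (K : set V) e : compact K -> K `<=` P -> 0 < e ->
  exists M, forall m, (M <= m)%N -> forall c s t, K c -> 0 <= s <= 1 -> 0 <= t <= 1 ->
    q c (s + t) - e <= q (c + t *: y m) s.
Proof.
move=> cK KP e0.
pose I := `[0 : R, 1]%classic.
have cI : compact I by exact: segment_compact.
have := compact_setX cK (compact_setX cI cI).
rewrite compact_near_coveringP => /near_covering_withinP.
move=> /(_ nat \oo (fun m (p : V * (R * R)) =>
  q p.1 (p.2.1 + p.2.2) - e <= q (p.1 + p.2.2 *: y m) p.2.1) _).
case=> [[c [s t]] [/= Kc [Is It]]|M _ hM]; last first.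
  exists M => m Mm c s t Kc s01 t01; apply: (hM m Mm (c, (s, t))).
  by split => //; split; rewrite /= in_itv.
have s0 : 0 <= s by move: Is; rewrite /I /= in_itv /= => /andP[].
have t0 : 0 <= t by move: It; rewrite /I /= in_itv /= => /andP[].
have e2 : 0 < e / 2 by exact: divr_gt0.
have [M hM] := type_step (KP _ Kc) s0 t0 e2.
pose r := e / (4 * (1 + 2 * C)).
have C1 : 0 < 1 + 2 * C by rewrite ltr_pwDl// mulr_ge0.
have r0 : 0 < r by rewrite divr_gt0// mulr_gt0.
have rE : 2 * (r + 2 * C * r) = e / 2 by rewrite /r; field; rewrite gt_eqF.
exists (ball (c, (s, t)) r, [set m | (M <= m)%N]).
  by split; [exact: nbhsx_ballx|exists M].
move=> [[c1 [s1 t1]] m] /= [[b1 [b2 b3]] Mm] [K1 [I1 I2]].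
move: b1 b2 b3; rewrite -!ball_normE /= => /ltW b1 /ltW b2 /ltW b3.
have s10 : 0 <= s1 by move: I1; rewrite /I /= in_itv /= => /andP[].
have t10 : 0 <= t1 by move: I2; rewrite /I /= in_itv /= => /andP[].
have h1 := hM m Mm.
have h2 := type_lip (KP _ K1) (KP _ Kc) (addr_ge0 s10 t10) (addr_ge0 s0 t0).
have h3 := @type_lip (c + t *: y m) (c1 + t1 *: y m) s s1
  (PD (KP _ Kc) (PZ t0 (Py m))) (PD (KP _ K1) (PZ t10 (Py m))) s0 s10.
have h4 : `|c + t *: y m - (c1 + t1 *: y m)| <= r + r * C.
  rewrite opprD addrACA -scalerBl (le_trans (ler_normD _ _))// lerD// normrZ.
  by rewrite ler_pM.
have h5 : C * `|s - s1| <= C * r by rewrite ler_wpM2l.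
have h6 : C * `|s1 + t1 - (s + t)| <= C * (r + r).
  rewrite ler_wpM2l// opprD addrACA (le_trans (ler_normD _ _))// lerD// distrC//.
rewrite distrC in b1; move: h1 h2 h3 h4 h5 h6 b1 rE; lra.
Qed.

Lemma box_step_compact (K : set V) v : compact K ->
  compact [set c.1 + c.2 *: v | c in K `*` `[0 : R, 1]%classic].
Proof.
move=> cK; apply: continuous_compact; last first.
  by apply: compact_setX => //; exact: segment_compact.
apply: continuous_subspaceT => p.
by apply: cvgD; [exact: cvg_fst|apply: cvgZr_tmp; exact: cvg_snd].
Qed.

(** The indices are chosen one after the other, each time uniformly over the
compact box spanned by the members already chosen. A convex combination is then
reached from the type at (0, 1) by moving its weights, one at a time, from the
limit to the chosen members; the losses add up to at most e. *)
Lemma extremal_subsequence a e : tends (fun n => `|y n|) a -> 0 < e ->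
  exists n_ : nat -> nat, (forall i, (i <= n_ i)%N) /\
    forall (N : nat) (b : nat -> R), (forall i, 0 <= b i) ->
      (a - e) * (\sum_(i < N) b i) <= `|\sum_(i < N) b i *: y (n_ i)|.
Proof.
move=> ha e0.
have qa : q 0 1 = a.
  have h := hq P0 ler01; apply/eqP; rewrite eq_le.
  apply/andP; split; apply/ler_addgt0Pr => d d0;
    have [M1 g1] := ha _ (divr_gt0 d0 (ltr0Sn _ 1));
    have [M2 g2] := h _ (divr_gt0 d0 (ltr0Sn _ 1));
    have := g1 _ (leq_maxl M1 M2); have := g2 _ (leq_maxr M1 M2);
    rewrite scale1r add0r !ler_norml => /andP[? ?] /andP[? ?]; lra.
have /choice[pick hpick] : forall iK : nat * set V, exists M, compact iK.2 -> iK.2 `<=` P ->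
    (iK.1 <= M)%N /\ forall c s t, iK.2 c -> 0 <= s <= 1 -> 0 <= t <= 1 ->
      q c (s + t) - e * 2 ^- iK.1.+1 <= q (c + t *: y M) s.
  move=> [i K] /=; have [[cK KP]|nK] := pselect (compact K /\ K `<=` P); last first.
    by exists 0%N => cK KP; case: nK.
  have ei : 0 < e * 2 ^- i.+1 by rewrite mulr_gt0// invr_gt0 exprn_gt0.
  have [M hM] := type_step_uniform cK KP ei.
  by exists (maxn M i) => _ _; split; [exact: leq_maxr|apply: hM; exact: leq_maxl].
pose box := fix box i := if i is k.+1
  then [set c.1 + c.2 *: y (pick (k, box k)) | c in box k `*` `[0 : R, 1]%classic]
  else [set 0].
pose n_ i := pick (i, box i).
have hbox i : compact (box i) /\ box i `<=` P.
  elim: i => [|i [cb bP]] /=.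
    by split; [exact: compact_set1|move=> _ ->].
  split; first exact: box_step_compact.
  move=> _ [[c t] /= [bc It] <-]; apply: PD; first exact: bP.
  by apply: PZ => //; move: It; rewrite /= in_itv /= => /andP[].
have hn i : (i <= n_ i)%N /\ forall c s t, box i c -> 0 <= s <= 1 -> 0 <= t <= 1 ->
    q c (s + t) - e * 2 ^- i.+1 <= q (c + t *: y (n_ i)) s.
  by have [cb bP] := hbox i; have := hpick (i, box i) cb bP.
exists n_; split; first by move=> i; have [] := hn i.
suff key N (b : nat -> R) : (forall i, 0 <= b i) -> \sum_(0 <= i < N) b i = 1 ->
    a - e <= `|\sum_(0 <= i < N) b i *: y (n_ i)|.
  move=> N b b0; rewrite -(big_mkord xpredT b) -(big_mkord xpredT (fun i => b i *: y (n_ i))).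
  set S := \sum_(0 <= i < N) b i.
  have S0 : 0 <= S by exact: sumr_ge0.
  have [->|Sn0] := eqVneq S 0; first by rewrite mulr0.
  have Sp : 0 < S by rewrite lt_neqAle eq_sym Sn0.
  have := key N (fun i => S^-1 * b i) _ _.
  rewrite -mulr_sumr mulVf// => /(_ (fun i => mulr_ge0 _ (b0 i))) h.
  have {}h := h (ltac:(by rewrite invr_ge0)) erefl.
  move: h; have -> : \sum_(0 <= i < N) (S^-1 * b i) *: y (n_ i) =
      S^-1 *: \sum_(0 <= i < N) b i *: y (n_ i).
    by rewrite scaler_sumr; apply: eq_bigr => i _; rewrite scalerA.
  by rewrite normrZ gtr0_norm ?invr_gt0// mulrC ler_pdivlMr// .
move=> b0 b1.
pose c k := \sum_(0 <= i < k) b i *: y (n_ i).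
pose s k := \sum_(k <= i < N) b i.
have s01 k : (k <= N)%N -> 0 <= s k <= 1.
  move=> kN; apply/andP; split; first exact: sumr_ge0.
  by rewrite -b1 (big_cat_nat (n := k))//= lerDr sumr_ge0.
have b01 k : (k < N)%N -> 0 <= b k <= 1.
  move=> kN; rewrite b0 /=; have /andP[_] := s01 k (ltnW kN).
  by rewrite /s big_ltn//; have /andP[] := s01 k.+1 kN; rewrite /s; lra.
have cbox k : (k <= N)%N -> box k (c k).
  elim: k => [|k IH] kN; first by rewrite /c big_geq.
  rewrite /c big_nat_recr//= -/(c k); exists (c k, b k) => //=.
  by split; [apply: IH; exact: ltnW|rewrite /= in_itv /= b01].
have main k : (k <= N)%N -> a - e * (1 - 2 ^- k) <= q (c k) (s k).
  elim: k => [|k IH] kN.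
    by rewrite expr0 invr1 subrr mulr0 subr0 /c big_geq// /s b1 qa.
  have := IH (ltnW kN).
  have [_ /(_ (c k) (s k.+1) (b k) (cbox k (ltnW kN)) (s01 _ kN) (b01 _ kN))] := hn k.
  have -> : s k.+1 + b k = s k by rewrite /s [in RHS]big_ltn// addrC.
  have -> : c k + b k *: y (n_ k) = c k.+1 by rewrite /c big_nat_recr.
  have -> : 2 ^- k = 2 * 2 ^- k.+1 :> R by rewrite exprS invfM mulrA divff// mul1r.
  by move: (2 ^- k.+1 : R) => z; lra.
have := main N (leqnn _); rewrite /s big_geq// type0; last first.
  by have [_ bP] := hbox N; apply: bP; exact: cbox.
have : 0 < e * 2 ^- N by rewrite mulr_gt0// invr_gt0 exprn_gt0.
by rewrite -/(c N); move: (2 ^- N : R) => z; lra.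
Qed.

End Selection.

(** The norm of a weak limit may drop in general; here it does not, because
some functional of norm at most 1 is almost norming for a whole subsequence. The
cone P makes it enough to know flatness over positive translates. *)
Lemma norm_weak_limit (R : realType) (V : normedModType R) (y : nat -> V) (C : R) (P : set V) :
  reflexive_space V -> P 0 -> (forall u v, P u -> P v -> P (u + v)) ->
  (forall (a : R) u, 0 <= a -> P u -> P (a *: u)) -> (forall n, P (y n)) ->
  (forall n, `|y n| <= C) ->
  (forall c, P c -> exists B,
    flat (fun n => `|y n + c|) (fun m n => `|y m + y n + 2 *: c|) B) ->
  forall a e, tends (fun n => `|y n|) a -> 0 < e ->
  exists z, a - e <= `|z| /\
    forall f b, dual f -> tends (fun n => f (y n)) b -> f z = b.
Proof.
move=> hV P0 PD PZ Py yC fy a e ha e0.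
have [q hq] := type_exists PZ fy.
have [n_ [ni hn]] := extremal_subsequence P0 PD PZ Py yC fy hq ha e0.
have [f [fl f1 fa]] := @norming_functional _ _ (y \o n_) _ hn.
have [z [hz1 hz2]] := weak_limit hV (fun i => yC (n_ i)).
exists z; split.
  apply: le_trans (f1 z); apply: hz2 => //.
  apply: (bounded_dual (C := 1) fl) => v; rewrite mul1r ler_norml f1 andbT.
  have := f1 (- v); rewrite -scaleN1r (functionalZ _ _ fl) scaleN1r normrN; lra.
move=> g b dg tb; apply: hz1 => // d d0; have [M hM] := tb d d0.
exists M => i Mi; apply: hM; exact: leq_trans (ni i).
Qed.

(** * Convergence in the space *)

Section MainSpace.
Variables (R : realType) (S : finType).
Local Notation T := (branch S).
Variables (F : nat -> set {fset T}) (Y : completeNormedModType R) (e : nat -> Y).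
Hypotheses (hF : admissible F) (hY : reflexive_space Y) (he : schauder_basis e).
Hypotheses (he1 : forall j, `|e j| = 1) (heu : unconditional1 (fun y : Y => `|y|) e).
Implicit Types x : T -> R.

Let neF i : F i !=set0. Proof. by exists fset0; exact: admissible0. Qed.

Let fn j x := family_norm (R := R) (F j) x.

Let lfn j : lattice_seminorm (fn j).
Proof. exact: family_seminorm. Qed.

(** The vector of Y whose norm is the norm of x in X. *)
Definition profile x : Y := limn (series (fun j => (2 ^- j * family_norm (F j) x) *: e j)).

Let nrm x := space_norm F e x.

Let w0 j : 0 <= 2 ^- j :> R. Proof. by rewrite invr_ge0 exprn_ge0. Qed.

Let fn0 j x : c00 x -> 0 <= fn j x.
Proof. by have [+ _ _ _] := lfn j; exact. Qed.

Lemma coef_profile x j : c00 x -> coef he (profile x) j = 2 ^- j * fn j x.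
Proof.
move=> cx; rewrite /profile (coef_lim he he1 (C := mass (supp x) x))// => i.
rewrite normrM !ger0_norm ?fn0//.
by rewrite mulrC ler_wpM2r//; apply: family_le => // A _; exact: mass_supp.
Qed.

Let cp0 x j : c00 x -> 0 <= coef he (profile x) j.
Proof. by move=> cx; rewrite coef_profile// mulr_ge0// fn0. Qed.

Lemma family_norm_le j x : c00 x -> fn j x <= 2 ^+ j * nrm x.
Proof.
move=> cx; have := coef_le he he1 heu (profile x) j.
rewrite coef_profile// ger0_norm ?mulr_ge0 ?fn0// => h.
by rewrite -ler_pdivrMl ?exprn_gt0.
Qed.

Lemma coord_le x g : c00 x -> `|x g| <= nrm x.
Proof.
move=> cx; have := family_norm_le 0 cx; rewrite expr0 mul1r; apply: le_trans.
by rewrite -mass1; apply: family_ub => //; exact: admissible1.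
Qed.

Lemma nrm_abs x y : c00 x -> c00 y -> (forall g, `|x g| = `|y g|) -> nrm x = nrm y.
Proof.
move=> cx cy xy; rewrite /nrm /space_norm; congr (`| limn (series _) |).
apply/funext => j; congr (_ * _ *: _); rewrite /family_norm; congr sup.
by apply/seteqP; split => _ [A GA <-]; exists A => //; apply: eq_bigr.
Qed.

(** Scaling the translate by the norm of the tail makes this homogeneous, while
along a sequence for which these norms converge to a it behaves as the
translation by a times the vector. *)
Definition twisted_tail k s x : R :=
  `|basis_tail he k (profile x) + `|basis_tail he k (profile x)| *: ratvec e s|.

Let cT k x j : c00 x -> 0 <= coef he (basis_tail he k (profile x)) j.
Proof. by move=> cx; rewrite coef_basis_tail; case: ifP => // _; exact: cp0. Qed.

Let cR s j : 0 <= coef he (ratvec e s) j. Proof. exact: ratvec_ge0. Qed.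

Lemma coef_tailD k x y j : c00 x -> c00 y ->
  coef he (basis_tail he k (profile (x \+ y))) j <=
  coef he (basis_tail he k (profile x)) j + coef he (basis_tail he k (profile y)) j.
Proof.
move=> cx cy; rewrite !coef_basis_tail; case: ifP => _; first by rewrite addr0.
rewrite !coef_profile//; last exact: c00D.
by rewrite -mulrDr ler_wpM2l//; have [_ + _ _] := lfn j; exact.
Qed.

Lemma norm_tailD k x y : c00 x -> c00 y ->
  `|basis_tail he k (profile (x \+ y))| <= `|basis_tail he k (profile x)| + `|basis_tail he k (profile y)|.
Proof.
move=> cx cy; apply: le_trans (ler_normD _ _); apply: (norm_mono_ge0 (he := he) heu) => j.
  by apply: cT; exact: c00D.
by rewrite [leRHS]coefD; exact: coef_tailD.
Qed.

Lemma basis_tailZ k a x : c00 x -> basis_tail he k (profile (a \*o x)) = `|a| *: basis_tail he k (profile x).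
Proof.
move=> cx; apply: (@eq_coef _ _ _ he) => j; rewrite coefZ !coef_basis_tail; case: ifP => _.
  by rewrite mulr0.
rewrite !coef_profile//; last exact: c00Z.
by have [_ _ fnZ _] := lfn j; rewrite fnZ// mulrCA.
Qed.

Lemma twisted_tailD_le k s x y : c00 x -> c00 y ->
  twisted_tail k s (x \+ y) <= `|basis_tail he k (profile x) + basis_tail he k (profile y) +
    (`|basis_tail he k (profile x)| + `|basis_tail he k (profile y)|) *: ratvec e s|.
Proof.
move=> cx cy; have cxy := c00D cx cy; apply: (norm_mono_twist (he := he) heu) => //.
- by move=> j; exact: cT.
- by move=> j; rewrite [leRHS]coefD; exact: coef_tailD.
- exact: norm_tailD.
Qed.

Lemma twisted_tail_seminorm k s : lattice_seminorm (twisted_tail k s).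
Proof.
split.
- by move=> x _; exact: normr_ge0.
- move=> x y cx cy; apply: (le_trans (twisted_tailD_le k s cx cy)).
  by rewrite scalerDl addrACA ler_normD.
- move=> a x cx; rewrite /twisted_tail basis_tailZ// normrZ normr_id -scalerA -scalerDr.
  by rewrite normrZ normr_id.
- move=> x y cx cy xy.
  have le1 j : coef he (basis_tail he k (profile x)) j <= coef he (basis_tail he k (profile y)) j.
    rewrite !coef_basis_tail; case: ifP => // _; rewrite !coef_profile// ler_wpM2l//.
    by have [_ _ _] := lfn j; exact.
  have le2 : `|basis_tail he k (profile x)| <= `|basis_tail he k (profile y)|.
    by apply: (norm_mono_ge0 (he := he) heu) => // j; exact: cT.
  by apply: (norm_mono_twist (he := he) heu) => // j; exact: cT.
Qed.

Lemma twisted_tail_bound k s x : twisted_tail k s x <= (1 + `|ratvec e s|) * nrm x.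
Proof.
have h : `|basis_tail he k (profile x)| <= nrm x by exact: basis_tail_le.
rewrite /twisted_tail (le_trans (ler_normD _ _))// normrZ normr_id mulrDl mul1r.
by rewrite lerD// mulrC ler_wpM2l.
Qed.

Lemma twisted_tail_nil k x : twisted_tail k [::] x = `|basis_tail he k (profile x)|.
Proof. by rewrite /twisted_tail ratvec_nil scaler0 addr0. Qed.

Section Sequence.
Variable x : nat -> T -> R.
Hypotheses (cx : forall n, c00 (x n)) (xb : forall n, nrm (x n) <= 2).
Hypothesis flat_twisted : forall k s, exists a,
  flat (fun n => twisted_tail k s (x n)) (fun m n => twisted_tail k s (x m \+ x n)) a.
Hypothesis cauchy_fn : forall j d, 0 < d -> exists M, forall m n, (M <= m)%N -> (M <= n)%N ->
  fn j (x m \- x n) <= d.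

Let y k n := basis_tail he k (profile (x n)).

(** The rational vectors are dense among the positive ones, and the norms of the
tails converge to a > 0, so every positive c is approximated by a times a
rational vector. *)
Lemma flat_translates k a : 0 < a -> tends (fun n => `|y k n|) a ->
  forall c, (forall j, 0 <= coef he c j) -> exists B,
    flat (fun n => `|y k n + c|) (fun m n => `|y k m + y k n + 2 *: c|) B.
Proof.
move=> a0 ha c c0.
have cancel (u v w : Y) : u + v - (u + w) = v - w.
  by rewrite opprD addrACA subrr add0r.
have approx d : 0 < d -> exists A, exists M, forall m n, (M <= m)%N -> (M <= n)%N ->
    `| `|y k n + c| - A| <= d /\ 2 * A - d <= `|y k m + y k n + 2 *: c|.
  move=> d0; have d6 : 0 < d / 6 by exact: divr_gt0.
  have ac0 j : 0 <= coef he (a^-1 *: c) j by rewrite coefZ mulr_ge0// invr_ge0 ltW.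
  have [s hs] := ratvec_dense he1 ac0 (divr_gt0 d6 a0).
  have hs' : `|c - a *: ratvec e s| <= d / 6.
    have -> : c - a *: ratvec e s = a *: (a^-1 *: c - ratvec e s).
      by rewrite scalerBr scalerA divff ?gt_eqF// scale1r.
    by rewrite normrZ gtr0_norm// mulrC -ler_pdivlMr.
  have [A [hA1 hA2]] := flat_twisted k s.
  have n1 : 0 < `|ratvec e s| + 1 by rewrite ltr_wpDl.
  have [M1 g1] := hA1 _ d6; have [M2 g2] := hA2 _ d6.
  have [M3 g3] := ha _ (divr_gt0 d6 n1).
  have near_s n : (M3 <= n)%N -> `|c - `|y k n| *: ratvec e s| <= d / 3.
    move=> n3; rewrite (le_trans (ler_distD (a *: ratvec e s) _ _))//.
    have -> : d / 3 = d / 6 + d / 6 by lra.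
    rewrite lerD// -scalerBl normrZ distrC.
    rewrite (@le_trans _ _ (d / 6 / (`|ratvec e s| + 1) * `|ratvec e s|))//.
      by rewrite ler_wpM2r// g3.
    by rewrite mulrAC ler_pdivrMr// ler_wpM2l ?(ltW d6)// lerDl.
  exists A, (maxn M1 (maxn M2 M3)) => m n; rewrite !geq_max.
  move=> /and3P[m1 m2 m3] /and3P[n1' n2 n3]; split.
    have := g1 n n1'; rewrite /twisted_tail -/(y k n) => h1.
    have h2 := ler_dist_dist (y k n + c) (y k n + `|y k n| *: ratvec e s).
    rewrite cancel in h2.
    have h3 := near_s n n3.
    rewrite (le_trans (ler_distD `|y k n + `|y k n| *: ratvec e s| _ _))//; lra.
  have h1 := le_trans (g2 m n m2 n2) (twisted_tailD_le k s (cx m) (cx n)).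
  rewrite -!/(y k _) in h1.
  have h2 := ler_dist_dist (y k m + y k n + (`|y k m| + `|y k n|) *: ratvec e s)
    (y k m + y k n + 2 *: c).
  rewrite cancel in h2.
  have h3 : `|(`|y k m| + `|y k n|) *: ratvec e s - 2 *: c| <= d / 3 + d / 3.
    rewrite distrC scaler_nat mulr2n scalerDl opprD addrACA.
    by rewrite (le_trans (ler_normD _ _))// lerD// near_s.
  by move: h2; rewrite ler_norml => /andP[? ?]; lra.
have [B hB] : exists B, tends (fun n => `|y k n + c|) B.
  apply: cauchy_tends => d d0.
  have [A [M hM]] := approx _ (divr_gt0 d0 (ltr0Sn _ 1)).
  exists M => m n Mm Mn.
  have [+ _] := hM m m Mm Mm; have [+ _] := hM n n Mn Mn.
  by rewrite !ler_norml => /andP[? ?] /andP[? ?]; apply/andP; split; lra.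
exists B; split => // d d0; have d8 : 0 < d / 8 by exact: divr_gt0.
have [A [M1 g1]] := approx _ d8; have [M2 g2] := hB _ d8.
exists (maxn M1 M2) => m n; rewrite !geq_max => /andP[m1 m2] /andP[n1 n2].
have [h1 h2] := g1 m n m1 n1; have h3 := g2 n n2.
by move: h1 h2 h3; rewrite !ler_norml => /andP[? ?] ? /andP[? ?]; lra.
Qed.

Lemma coef_tends k j : exists b, tends (fun n => coef he (profile (x n)) j) b /\
  tends (fun n => coef he (y k n) j) (if (j < k)%N then 0 else b).
Proof.
have [b hb] : exists b, tends (fun n => coef he (profile (x n)) j) b.
  apply: cauchy_tends => d d0.
  have p0 : 0 < (2 ^+ j : R) by exact: exprn_gt0.
  have [M hM] := cauchy_fn j (mulr_gt0 d0 p0).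
  exists M => m n Mm Mn; rewrite !coef_profile// -mulrBr normrM ger0_norm//.
  rewrite ler_pdivrMl// mulrC (le_trans (seminorm_dist (lfn j) (cx m) (cx n)))//.
  exact: hM.
exists b; split => // d d0; have [M hM] := hb d d0; exists M => n /hM.
rewrite coef_basis_tail; case: ifP => // _ _.
by rewrite subrr normr0 ltW.
Qed.

(** The coordinates of the profiles converge, so the k-tails of the profiles can
only converge weakly to the k-tail of one vector z. By flatness their norms
converge to at most the norm of this tail, which is small for k large. *)
Lemma small_profile_tails d : 0 < d -> exists k M, forall n, (M <= n)%N ->
  `|basis_tail he k (profile (x n))| <= d.
Proof.
move=> d0; have d3 : 0 < d / 3 by exact: divr_gt0.
have pb n : `|profile (x n)| <= 2 by exact: xb.
have [z [hz _]] := weak_limit hY pb.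
have [k hk] := basis_tail_small he z d3; exists k.
have [a [ha _]] := flat_twisted k [::].
have {}ha : tends (fun n => `|y k n|) a.
  by move=> r /ha[M hM]; exists M => n /hM; rewrite twisted_tail_nil.
suff ad : a <= d / 3 + d / 3.
  have [M hM] := ha _ d3; exists M => n /hM; rewrite ler_norml -/(y k n) => /andP[_ ?].
  lra.
have [a0|a0] := leP a 0; first by lra.
have yb n : `|y k n| <= 2 by rewrite (le_trans _ (pb n))// basis_tail_le.
pose P := [set c : Y | forall j, 0 <= coef he c j].
have P0 : P 0 by move=> j; rewrite coef0.
have PD u v : P u -> P v -> P (u + v) by move=> u0 v0 j; rewrite coefD addr_ge0.
have PZ (r : R) u : 0 <= r -> P u -> P (r *: u).
  by move=> r0 u0 j; rewrite coefZ mulr_ge0.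
have Py n : P (y k n) by move=> j; exact: cT.
have [z' [az' hz']] := norm_weak_limit hY P0 PD PZ Py yb (flat_translates a0 ha) ha d3.
have zz : z' = basis_tail he k z.
  apply: (@eq_coef _ _ _ he) => j; have [b [hb1 hb2]] := coef_tends k j.
  have dj := coef_dual he he1 heu j.
  rewrite (hz' _ _ dj hb2) coef_basis_tail; case: ifP => // _.
  by rewrite (hz _ _ dj hb1).
by move: az'; rewrite zz; lra.
Qed.

Lemma space_cauchy d : 0 < d -> exists M, forall m n, (M <= m)%N -> (M <= n)%N ->
  nrm (x m \- x n) <= d.
Proof.
move=> d0; have d4 : 0 < d / 4 by exact: divr_gt0.
have [k [M1 h1]] := small_profile_tails d4.
have [M2 h2] : exists M, forall m n, (M <= m)%N -> (M <= n)%N ->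
    \sum_(0 <= j < k) fn j (x m \- x n) <= d / 4.
  have dk : 0 < d / 4 / k.+1%:R by rewrite divr_gt0// ltr0n.
  have /choice[N hN] := fun j => cauchy_fn j dk.
  exists (\max_(j < k) N j)%N => m n Mm Mn.
  apply: (@le_trans _ _ (\sum_(0 <= j < k) d / 4 / k.+1%:R)).
    rewrite big_nat [leRHS]big_nat; apply: ler_sum => j /andP[_ jk].
    have Nj := @leq_bigmax _ (fun j : 'I_k => N j) (Ordinal jk).
    by apply: hN; [exact: leq_trans Mm|exact: leq_trans Mn].
  rewrite sumr_const_nat subn0 -[leLHS]mulr_natl mulrCA ger_pMr//.
  by rewrite ler_pdivrMr ?ltr0n// mul1r ler_nat.
exists (maxn M1 M2) => m n; rewrite !geq_max => /andP[m1 m2] /andP[n1 n2].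
have cmn := c00B (cx m) (cx n).
have := norm_le_basis_tail he he1 (profile (x m \- x n)) k.
rewrite -/(nrm _).
have : \sum_(0 <= j < k) `|coef he (profile (x m \- x n)) j| <=
    \sum_(0 <= j < k) fn j (x m \- x n).
  apply: ler_sum => j _; rewrite coef_profile// ger0_norm ?mulr_ge0 ?fn0//.
  by rewrite ler_piMl ?fn0// invf_le1 ?exprn_gt0// exprn_ege1// ler1n.
have := h2 m n m2 n2; have := h1 m m1; have := h1 n n1.
have := seminormB (twisted_tail_seminorm k [::]) (cx m) (cx n).
by rewrite !twisted_tail_nil /nrm /space_norm; lra.
Qed.

End Sequence.

End MainSpace.

(** * The renorming theorem *)

Theorem corollary4p5 (R : realType) (S : finType) (hS : (2 <= #|S|)%N)
    (F : nat -> set {fset branch S}) (hF : admissible F)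
    (Y : completeNormedModType R) (hY : reflexive_space Y)
    (e : nat -> Y) (he : schauder_basis e)
    (he1 : forall j, `|e j| = 1)
    (heu : unconditional1 (fun y : Y => `|y|) e)
    (X : completeNormedModType R) (iota : (branch S -> R) -> X)
    (hX : is_completion (space_norm F e) iota) :
  (maximal F -> inclusion_condition F) /\
  (inclusion_condition F ->
     exists N : X -> R,
       [/\ equivalent_norm N, two_rotund N &
           unconditional1 N (fun g : branch S => iota \1_[set g])]).
Proof.
split; first exact: maximal_inclusion.
move=> hinc.
pose I := ((nat + nat * nat * nat) + nat * seq rat)%type.
pose q (i : I) : (branch S -> R) -> R := match i with
  | inl (inl l) => top_norm l
  | inl (inr (j, l, K)) => tail_norm (F j) l K
  | inr (k, s) => twisted_tail F he k s end.
pose C (i : I) : R := match i with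
  | inl (inl l) => l.+1%:R
  | inl (inr (j, l, K)) => (K * l).+1%:R * 2 ^+ j
  | inr (k, s) => 1 + `|ratvec e s| end.
have neF i : F i !=set0 by exists fset0; exact: admissible0.
apply: (@renorming _ _ _ _ _ hX I q C).
- move=> [[l|[[j l] K]]|[k s]] /=; first exact: top_norm_seminorm.
    exact: tail_seminorm.
  exact: twisted_tail_seminorm.
- move=> [[l|[[j l] K]]|[k s]] /=; first by rewrite ltr0n.
    by rewrite mulr_gt0 ?ltr0n// exprn_gt0.
  by rewrite ltr_pwDl.
- move=> [[l|[[j l] K]]|[k s]] x cx /=; last exact: twisted_tail_bound.
    by apply: top_norm_le => [|g]; [exact: normr_ge0|exact: (coord_le hF he he1 heu)].
  have n0 : 0 <= space_norm F e x by exact: normr_ge0.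
  rewrite -mulrA; apply: tail_norm_bound => //.
  + by move=> A B; exact: admissible_sub.
  + move=> g; rewrite (le_trans (coord_le hF he he1 heu g cx))//.
    by rewrite ler_peMl// exprn_ege1// ler1n.
  + exact: (family_norm_le hF he he1 heu).
  + by rewrite mulr_ge0// exprn_ge0.
- exact: nrm_abs.
- move=> x cx xb fl.
  apply: (space_cauchy hF hY he1 heu cx xb (he := he)).
    by move=> k s; exact: fl (inr (k, s)).
  apply: (family_cauchy hF hinc cx).
  + move=> i; exists (2 ^+ i * 2) => n.
    rewrite (le_trans (family_norm_le hF he he1 heu i (cx n)))//.
    by rewrite ler_wpM2l ?exprn_ge0// xb.
  + by move=> l; exact: fl (inl (inl l)).
  + by move=> j l K; exact: fl (inl (inr (j, l, K))).
Qed.
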